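(* Let $G$ be a finitely generated nilpotent group and $\mu\in\mathcal P_{\preceq}(G,\mathrm{reg})$ with data $k,H_i,\phi_i,\Phi_i$. Let $S_0$ be the support of $\mu_0$ and, for $1\le i\le k$, let $S_i$ be a finite symmetric generating set of $H_i$. Let $\Sigma=(s_1,\dots,s_m)$ be a tuple of distinct representatives of $(\bigcup_{i=0}^kS_i)\setminus\{e\}$ under the equivalence relation $s\sim s^{-1}$, and let $\mathfrak F=\{F_\sigma:\sigma\in\Sigma\}$ with $F_\sigma=\max\{\Phi_i^{-1}: 0\le i\le k,\ \sigma\in S_i\}$. Let $\mathbf F=\mathbf F_{G,\mathfrak F}$ be the nilpotent volume function of $(G,\Sigma,\mathfrak F)$. Then $$\Lambda_{2,G,\mu}(v)\succeq 1/\mathbf F^{-1}(v)\ (v\ge1)\qquad\text{and}\qquad \mu^{(n)}(e)\preceq 1/\mathbf F(n)\ (n=1,2,\dots).$$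
   Context: Notation. For positive functions $f_1,f_2$ on a set $D$, $f_1\asymp f_2$ means there are constants $0<c_1\le c_2<\infty$ with $c_1f_1\le f_2\le c_2f_1$ on $D$. For positive functions on $D=[1,\infty)$ or $D=\{1,2,\dots\}$ (or on a neighbourhood of infinity), $f_1\preceq f_2$ means there are constants $c_1,c_2>0$ with $f_1(t)\le c_1f_2(c_2t)$ for all $t\in D$ (with $c_2t$ replaced by $\max(c_2t,1)$, resp. a nearby integer), and $f_1\simeq f_2$ means $f_1\preceq f_2$ and $f_2\preceq f_1$. A positive function $f$ is regularly varying of index $\gamma$ at infinity if $f(\lambda t)/f(t)\to\lambda^\gamma$ as $t\to\infty$ for every $\lambda>0$. For a group $H$ with finite symmetric generating set $S$, $|h|_S$ denotes word length; $H$ has polynomial volume growth of degree $d$ if $\#\{h:|h|_S\le r\}\asymp r^d$ on $[1,\infty)$. Convolution: $u*v(x)=\sum_y u(y)v(y^{-1}x)$; $\mu^{(n)}$ is the $n$-fold convolution power of $\mu$; $e$ is the identity; $\mu$ is symmetric if $\mu(g^{-1})=\mu(g)$. Dirichlet form and spectral profile. $\mathcal E_{G,\mu}(f,f)=\frac12\sum_{x,y\in G}|f(xy)-f(x)|^2\mu(y)$ for $f\in L^2(G)$, and $\Lambda_{2,G,\mu}(v)=\min\{\mathcal E_{G,\mu}(f,f)/\|f\|_2^2:\ 1\le \#\mathrm{supp}(f)\le v\}$ for $v\ge1$. The class $\mathcal P(G,\mathrm{reg})$. Let $G$ be a finitely generated group of polynomial volume growth. A probability measure $\mu$ on $G$ belongs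 to $\mathcal P(G,\mathrm{reg})$ if $\mu=\sum_{i=0}^k p_i\mu_i$ with an integer $k\ge0$, $p_0\ge0$, $p_i>0$ for $1\le i\le k$, $\sum_{i=0}^kp_i=1$, each $\mu_i$ a symmetric probability measure on $G$, such that: $\mu_0$ is finitely supported; for each $1\le i\le k$ there are a subgroup $H_i$ of $G$ with a word length $|\cdot|_i$ (w.r.t. a finite symmetric generating set of $H_i$), of polynomial volume growth of degree $d_i$, and a positive increasing function $\phi_i$ on $[0,\infty)$, regularly varying of positive index at infinity, with $\mu_i(h)\asymp[\phi_i(1+|h|_i)(1+|h|_i)^{d_i}]^{-1}$ for $h\in H_i$ and $\mu_i(h)=0$ for $h\notin H_i$; and there is $\varepsilon>0$ such that the finite set $\{g:\mu(g)>\varepsilon\}$ generates $G$ and contains $e$. Set $H_0=G$. Define $\Phi_0(t)=\max\{t,t^2\}$ and, for $1\le i\le k$, $\Phi_i(t)=t^2\big/\int_0^t\frac{2s}{\phi_i(s)}\,ds$ for $t\ge1$, extended linearly on $[0,1]$ with $\Phi_i(0)=0$; each $\Phi_i$ is increasing with inverse $\Phi_i^{-1}$. The measure $\mu$ belongs to $\mathcal P_{\preceq}(G,\mathrm{reg})$ if moreover, for every pair of distinct $i,j\in\{1,\dots,k\}$, either $\Phi_i\preceq\Phi_j$ or $\Phi_j\preceq\Phi_i$ on a neighbourhood of infinity. Weight function systems. Given a group $G$ and a finite tuple $\Sigma$ of elements of $G$ (regarded also as abstract letters), a weight function system $\mathfrak F=\{F_s:s\in\Sigma\}$ is a family of continuous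 strictly increasing functions $F_s:[0,\infty)\to[0,\infty)$ with $F_s(t)\asymp t$ on $[0,1]$, such that for all $s,s'\in\Sigma$ either $F_s\preceq F_{s'}$ or $F_{s'}\preceq F_s$ on a neighbourhood of infinity. Nilpotent volume function. Let $N$ be a finitely generated nilpotent group with a generating tuple $\Sigma$ and a weight function system $\mathfrak F$ all of whose members are doubling (there is $A$ with $F(2t)\le AF(t)$ and $2F(t)\le F(At)$ for $t>0$). Extend the weights to formal commutators over $\Sigma\cup\Sigma^{-1}$ by $F_{s^{-1}}=F_s$ and $F_{[c_1,c_2]}=F_{c_1}F_{c_2}$. The $\simeq$-classes (near infinity) of the functions $F_c$ are totally ordered; list them increasingly as $\bar w_1<\bar w_2<\cdots$ and pick representatives $\mathbf F_j\in\bar w_j$. Let $N_j^{\mathfrak F}$ be the subgroup of $N$ generated by the images of the formal commutators $c$ with $F_c\succeq\mathbf F_j$; these subgroups decrease, $[N,N_j^{\mathfrak F}]\subseteq N_{j+1}^{\mathfrak F}$, $j_*$ denotes the least index with $N^{\mathfrak F}_{j_*+1}=\{e\}$, and $\mathfrak r_j$ is the torsion-free rank of the abelian group $N_j^{\mathfrak F}/N_{j+1}^{\mathfrak F}$. Set $\mathbf F_{N,\mathfrak F}=\prod_{j=1}^{j_*}\mathbf F_j^{\mathfrak r_j}$. *)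

(* Defs.v *)
From HB Require Import structures.
From mathcomp Require Import all_boot all_order all_algebra.
From mathcomp Require Import all_classical all_reals all_analysis.
Set Implicit Arguments.
Unset Strict Implicit.
Unset Printing Implicit Defensive.
Import Order.TTheory GRing.Theory Num.Theory numFieldNormedType.Exports.
Local Open Scope classical_set_scope.
Local Open Scope ring_scope.

Section Defs.
Variable R : realType.
Variable G : groupType.

Inductive gen (A : set G) : G -> Prop :=
| gen_one : gen A 1%g
| gen_in a : A a -> gen A a
| gen_inv x : gen A x -> gen A (x^-1)%g
| gen_mul x y : gen A x -> gen A y -> gen A (x * y)%g.

Definition finitely_generated : Prop :=
  exists S : seq G, forall x, gen [set s | s \in S] x.

Fixpoint lcs (n : nat) : set G :=
  match n with
  | 0 => setT
  | n'.+1 => gen [set z | exists x y, lcs n' y /\ z = [~ x, y]%g]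
  end.

Definition nilpotent : Prop := exists n, lcs n = [set 1%g].

Definition zexp (x : G) (n : int) : G :=
  match n with
  | Posz m => (x ^+ m)%g
  | Negz m => (x ^- m.+1)%g
  end.

Definition indep_mod (B : set G) (l : seq G) : Prop :=
  forall n : seq int, size n = size l ->
    B (\big[(fun x y => (x * y)%g)/1%g]_(i < size l) zexp (nth 1%g l i) (nth 0 n i)) ->
    forall i, nth 0 n i = 0.

(* torsion-free rank of the abelian group A/B (B <= A) equals r *)
Definition tf_rank (A B : set G) (r : nat) : Prop :=
  (exists l : seq G, size l = r /\ (forall x, x \in l -> A x) /\ indep_mod B l) /\
  (forall l : seq G, (forall x, x \in l -> A x) -> indep_mod B l -> (size l <= r)%N).

Inductive word_le (S : seq G) : nat -> G -> Prop :=
| wl_one n : word_le S n 1%g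
| wl_cons n s x : s \in S -> word_le S n x -> word_le S n.+1 (s * x)%g.

Definition is_wlen (S : seq G) (x : G) (n : nat) : Prop :=
  word_le S n x /\ forall m, word_le S m x -> (n <= m)%N.

Definition ball_card (S : seq G) (r : R) (N : nat) : Prop :=
  exists l : seq G, uniq l /\
    (forall x, x \in l <-> exists n : nat, n%:R <= r /\ word_le S n x) /\ size l = N.

Definition poly_growth (S : seq G) (d : nat) : Prop :=
  exists c1 c2 : R, 0 < c1 /\ 0 < c2 /\
    forall r : R, 1 <= r -> exists N, ball_card S r N /\
      c1 * r ^+ d <= N%:R /\ N%:R <= c2 * r ^+ d.

Definition regularly_varying (f : R -> R) (gam : R) : Prop :=
  forall lam : R, 0 < lam -> (f (lam * t) / f t) @[t --> +oo] --> lam `^ gam.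

Definition preceq_inf (f1 f2 : R -> R) : Prop :=
  exists c1 c2 T : R, 0 < c1 /\ 0 < c2 /\ forall t, T <= t -> f1 t <= c1 * f2 (c2 * t).
Definition simeq_inf (f1 f2 : R -> R) : Prop := preceq_inf f1 f2 /\ preceq_inf f2 f1.
Definition prec_strict_inf (f1 f2 : R -> R) : Prop := preceq_inf f1 f2 /\ ~ preceq_inf f2 f1.

Definition inv_incr (F : R -> R) (v : R) : R := sup [set t | 0 <= t /\ F t <= v].

Definition Phi0 (t : R) : R := Num.max t (t ^+ 2).

Definition PhiInt (phi : R -> R) (t : R) : R :=
  Rintegral lebesgue_measure `[0, t] (fun s => 2 * s / phi s).

Definition PhiReg (phi : R -> R) (t : R) : R :=
  if 1 <= t then t ^+ 2 / PhiInt phi t else t * (1 / PhiInt phi 1).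

Definition PhiI (phi : nat -> R -> R) (i : nat) : R -> R :=
  if i == 0%N then Phi0 else PhiReg (phi i).

Definition prob_measure (m : G -> R) : Prop :=
  (forall x, 0 <= m x) /\ (\esum_(x in setT) (m x)%:E = 1)%E.

Definition symmetric_measure (m : G -> R) : Prop := forall x, m (x^-1)%g = m x.

Definition Preg_le (mu : G -> R) (k : nat) (p : nat -> R) (mus : nat -> G -> R)
    (H : nat -> set G) (phi : nat -> R -> R) : Prop :=
  [/\ (forall x, mu x = \sum_(i < k.+1) p i * mus i x) /\
      (0 <= p 0%N /\ (forall i, (1 <= i <= k)%N -> 0 < p i) /\ \sum_(i < k.+1) p i = 1),
      (forall i, (i <= k)%N -> prob_measure (mus i) /\ symmetric_measure (mus i)) /\
      (exists l : seq G, forall x, mus 0%N x != 0 -> x \in l),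
      (forall i, (1 <= i <= k)%N ->
        exists (T : seq G) (d : nat),
          [/\ (forall s, s \in T -> (s^-1)%g \in T) /\
              (forall x, H i x <-> gen [set s | s \in T] x),
              poly_growth T d,
              ((forall t, 0 <= t -> 0 < phi i t) /\
              (forall s t, 0 <= s -> s <= t -> phi i s <= phi i t) /\
              (exists gam : R, 0 < gam /\ regularly_varying (phi i) gam)),
              (exists c1 c2 : R, 0 < c1 /\ 0 < c2 /\
                 forall h n, H i h -> is_wlen T h n ->
                   c1 / (phi i (1 + n%:R) * (1 + n%:R) ^+ d) <= mus i h /\
                   mus i h <= c2 / (phi i (1 + n%:R) * (1 + n%:R) ^+ d)) &
              (forall h, ~ H i h -> mus i h = 0)]),
      (exists eps : R, 0 < eps /\ (forall x, gen [set g | eps < mu g] x) /\ eps < mu 1%g) &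
      (forall i j, (1 <= i <= k)%N -> (1 <= j <= k)%N -> i != j ->
         preceq_inf (PhiI phi i) (PhiI phi j) \/ preceq_inf (PhiI phi j) (PhiI phi i))].

Definition dirichlet (mu : G -> R) (f : G -> R) : \bar R :=
  ((1/2)%:E * \esum_(x in setT) \esum_(y in setT) ((f (x * y)%g - f x) ^+ 2 * mu y)%:E)%E.

Definition l2sq (f : G -> R) : \bar R := \esum_(x in setT) (f x ^+ 2)%:E.

Definition spectral_profile (mu : G -> R) (v : R) : \bar R :=
  ereal_inf [set r | exists (f : G -> R) (l : seq G),
     [/\ uniq l, (forall x, x \in l <-> f x != 0), (1 <= size l)%N, (size l)%:R <= v &
         r = (dirichlet mu f * ((fine (l2sq f))^-1)%:E)%E]].

Definition conv (u v : G -> R) (x : G) : R :=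
  fine (\esum_(y in setT) (u y * v (y^-1 * x)%g)%:E).

Fixpoint convpow (mu : G -> R) (n : nat) : G -> R :=
  match n with
  | 0 => fun x => if x == 1%g then 1 else 0
  | n'.+1 => conv (convpow mu n') mu
  end.

(* formal commutators over the letters Sigma ∪ Sigma^{-1}, Sigma of size m;
   [FLet j b] is s_j (b = false) or s_j^{-1} (b = true) *)
Inductive fcomm (m : nat) : Type :=
| FLet of 'I_m & bool
| FCom of fcomm m & fcomm m.

Fixpoint feval (Sig : seq G) (c : fcomm (size Sig)) : G :=
  match c with
  | FLet j b => if b then ((nth 1%g Sig j)^-1)%g else nth 1%g Sig j
  | FCom c1 c2 => [~ feval c1, feval c2]%g
  end.

Fixpoint fweight (Sig : seq G) (Fw : G -> R -> R) (c : fcomm (size Sig)) : R -> R :=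
  match c with
  | FLet j _ => Fw (nth 1%g Sig j)
  | FCom c1 c2 => fun t => fweight Fw c1 t * fweight Fw c2 t
  end.

(* Fs = [F_1; ...; F_{j_*}] are representatives of the first j_* classes
   (increasing) of the weights F_c, and rs = [r_1; ...; r_{j_*}] the
   torsion-free ranks of N_j / N_{j+1}. *)
Definition volume_data (Sig : seq G) (Fw : G -> R -> R)
    (Fs : seq (R -> R)) (rs : seq nat) : Prop :=
  let W := fweight Fw in
  let above_last (c : fcomm (size Sig)) :=
      if Fs is f0 :: _ then prec_strict_inf (last f0 Fs) (W c) else True in
  let N (j : nat) : set G :=
      if (j < size Fs)%N
      then gen [set g | exists c, preceq_inf (nth (fun _ => 0) Fs j) (W c) /\ g = feval c]
      else gen [set g | exists c, above_last c /\ g = feval c] in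
  [/\ size rs = size Fs /\
      (forall j, (j < size Fs)%N -> exists c, nth (fun _ => 0) Fs j = W c),
      (forall j, (j.+1 < size Fs)%N ->
         prec_strict_inf (nth (fun _ => 0) Fs j) (nth (fun _ => 0) Fs j.+1)),
      (forall c, (exists2 j, (j < size Fs)%N & simeq_inf (W c) (nth (fun _ => 0) Fs j))
                 \/ above_last c),
      (forall j, (1 <= j < size Fs)%N -> N j <> [set 1%g]) /\
      N (size Fs) = [set 1%g] &
      (forall j, (j < size Fs)%N -> tf_rank (N j) (N j.+1) (nth 0%N rs j))].

Definition volume_fn (Fs : seq (R -> R)) (rs : seq nat) (t : R) : R :=
  \prod_(j < size Fs) (nth (fun _ => 0) Fs j t) ^+ (nth 0%N rs j).

Definition Fsigma (k : nat) (phi : nat -> R -> R) (S : nat -> seq G) (s : G) (t : R) : R :=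
  \big[Num.max/0]_(i < k.+1 | s \in S i) inv_incr (PhiI phi i) t.

End Defs.

(* Main.v *)
Require Import Defs.
From HB Require Import structures.
From mathcomp Require Import all_boot all_order all_algebra.
From mathcomp Require Import all_classical all_reals all_analysis.
From mathcomp Require Import measurable_realfun zify ring lra.
Import Order.TTheory GRing.Theory Num.Theory numFieldNormedType.Exports.
Local Open Scope classical_set_scope.
Local Open Scope ring_scope.
Set Implicit Arguments.
Unset Strict Implicit.
Unset Printing Implicit Defensive.

(** Displacements d_g(f) = sum_x |f(xg) - f(x)|^2 are compared with the Dirichlet form
    E(f): call g small at scale t when d_g(f) <= K t E(f) for all f.
    For a letter s of S_i, the powers s^n with n <= Phi_i^{-1}(t) are small: at each
    scale rho <= n one bounds d_{s^n} by the part of E living on the annulus |h| ~ rho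
    of H_i, and these annuli are disjoint.
    The small elements are closed under bounded products, so if |n| <= F_c(t) for a formal
    commutator c, then c^n is congruent, modulo commutators of strictly larger weight, to a
    small element: write n = a q + r and use [c1^a, c2^q] = [c1, c2]^{a q} up to larger weight.
    No collection formula is needed, since congruence is enough to count:
    multiplying such elements level by level gives at least F(t) distinct small elements.
    Averaging f over these elements gives the lower bound on the spectral profile (f of
    small support) and a Nash inequality (f of mass one), whence the return probability
    decay by iteration in time. *)

(** Every constant must be independent of [t], so an element may be built from a bounded number of
    small ones only. Written as a word in the letters, [c ^+ n] with [n] up to the weight of [c] is
    far too long. Commutators of high powers of the letters are what keeps the number of factors
    bounded by the shape of [c]. The errors of larger weight are never estimated. The elements are
    counted by their cosets in N_j / N_{j+1}, so any small representative of a coset serves. The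
    torsion-free rank enters through an independent family, whose products of powers lie in distinct
    cosets. For the letters, one annulus of radius about n yields only phi(n). If phi grows like a
    power of exponent above 2, this is far more than the required n^2 / I(n), with I the integral in
    the definition of Phi_i. Weighting the scales by their share of I(n) closes the gap. For the
    return probability, the mass of mu at e lets the energy be bounded by the drop of the squared l2
    norm over one step of the walk. *)

Section Esum.
Context (R : realType) (T : choiceType).
Implicit Types (a b : T -> \bar R) (s : seq T).

Lemma sum_le_esum a s : uniq s -> (forall x, (0 <= a x)%E) ->
  (\sum_(x <- s) a x <= \esum_(x in setT) a x)%E.
Proof.
move=> us a0; apply: esum_ge; exists [set` s]; first by split.
by rewrite -fsbig_seq.
Qed.

Lemma esum_finsupp a s : uniq s -> (forall x, (0 <= a x)%E) ->
  (forall x, x \notin s -> a x = 0%E) ->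
  \esum_(x in setT) a x = (\sum_(x <- s) a x)%E.
Proof.
move=> us a0 as0.
transitivity (\esum_(x in [set` s]) a x); last first.
  by rewrite esum_fset// -fsbig_seq.
rewrite [RHS]esum_mkcond; apply: eq_esum => x _.
by case: ifPn => // /negP; rewrite inE/= => /negP /as0.
Qed.

Lemma esumZl a (c : R) : 0 <= c -> (forall x, (0 <= a x)%E) ->
  (\esum_(x in setT) (c%:E * a x) = c%:E * \esum_(x in setT) a x)%E.
Proof.
(* Both inequalities come from this one: the reverse is its instance at [c^-1] and the family
   [c * a]. *)
have le (d : R) b : 0 <= d -> (forall x, (0 <= b x)%E) ->
    (\esum_(x in setT) (d%:E * b x) <= d%:E * \esum_(x in setT) b x)%E.
  move=> d0 b0; apply: ge_ereal_sup => _ [X [finX _] <-].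
  rewrite fsbig_finite//= -ge0_sume_distrr// lee_wpmul2l ?lee_fin//.
  rewrite -fsbig_finite//; apply: ereal_sup_ubound; exists X => //; split => //.
move=> c0 a0; apply/eqP; rewrite eq_le le//=.
have [->|cn0] := eqVneq c 0.
  by rewrite mul0e; apply: esum_ge0 => x _; rewrite mul0e.
have {cn0} c0 : 0 < c by rewrite lt_neqAle eq_sym cn0.
have cc : (c%:E * c^-1%:E = 1)%E by rewrite -EFinM mulfV// gt_eqF.
have := @le c^-1 (fun x => c%:E * a x)%E.
rewrite invr_ge0 (ltW c0) => /(_ isT).
have -> : \esum_(x in setT) ((c^-1)%:E * (c%:E * a x))%E = \esum_(x in setT) a x.
  by apply: eq_esum => x _; rewrite muleA [X in (X * _)%E]muleC cc mul1e.
move=> /(_ (fun x => mule_ge0 (ltW c0 : (0 <= c%:E)%E) (a0 x))) H.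
have := lee_wpmul2l (ltW c0 : (0 <= c%:E)%E) H.
by rewrite muleA cc mul1e.
Qed.

End Esum.

Lemma esum_exchange (R : realType) (T U : choiceType) (a : T -> U -> \bar R) :
  (forall x y, (0 <= a x y)%E) ->
  (\esum_(x in setT) \esum_(y in setT) a x y =
   \esum_(y in setT) \esum_(x in setT) a x y)%E.
Proof.
move=> a0; rewrite esum_esum// esum_esum//.
rewrite (@reindex_esum R (U * T)%type (T * U)%type
  (setT `*`` (fun=> setT)) _ (fun k => (k.2, k.1)))//.
split; first by [].
  by move=> [x y] [x' y'] _ _ [-> ->].
by move=> [x y] _; exists (y, x).
Qed.

Section GroupSum.
Context (R : realType) (G : groupType).
Implicit Types (a : G -> \bar R).

Lemma esum_rmul a g :
  \esum_(x in setT) a (x * g)%g = \esum_(x in setT) a x.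
Proof.
rewrite [RHS](@reindex_esum R G G setT setT (fun x => x * g)%g)//.
split => //; first by move=> x y _ _ /mulIg.
by move=> x _; exists (x / g)%g => //; rewrite mulgVK.
Qed.

Lemma esum_lmul a g :
  \esum_(x in setT) a (g * x)%g = \esum_(x in setT) a x.
Proof.
rewrite [RHS](@reindex_esum R G G setT setT (fun x => g * x)%g)//.
split => //; first by move=> x y _ _ /mulgI.
by move=> x _; exists (g^-1 * x)%g => //; rewrite mulVKg.
Qed.

Lemma esum_inv a :
  \esum_(x in setT) a (x^-1)%g = \esum_(x in setT) a x.
Proof.
rewrite [RHS](@reindex_esum R G G setT setT (fun x => x^-1)%g)//.
split => //; first by move=> x y _ _ /invg_inj.
by move=> x _; exists (x^-1)%g => //; rewrite invgK.
Qed.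

End GroupSum.

Lemma sqr_sum_le (R : realType) (a : nat -> R) m :
  (\sum_(i < m) a i) ^+ 2 <= m%:R * \sum_(i < m) a i ^+ 2.
Proof.
elim: m => [|m IH]; first by rewrite !big_ord0 expr0n/= mul0r.
rewrite !big_ord_recr/= -natr1; move: (a m) => y.
case: m IH => [|m]; first by rewrite !big_ord0 !add0r mul1r.
have m0 : 0 < m.+1%:R :> R by rewrite ltr0n.
move: m.+1%:R (\sum_(i < m.+1) _) (\sum_(i < m.+1) _) m0 => M c b m0 IH.
(* After multiplication by [M] and the induction hypothesis [b ^+ 2 <= M * c], this is the
   nonnegativity of [(b - M * y) ^+ 2]. *)
have H2 : 2 * b * y <= M * y ^+ 2 + c.
  by rewrite -(ler_pM2l m0); have := sqr_ge0 (b - M * y); nra.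
nra.
Qed.

(** * Displacements and the Dirichlet form *)

Section Displacement.
Context (R : realType) (G : groupType).
Implicit Types (f : G -> R) (g h : G).

Definition disp f g : \bar R := \esum_(x in setT) ((f (x * g)%g - f x) ^+ 2)%:E.

Lemma disp_ge0 f g : (0 <= disp f g)%E.
Proof. by apply: esum_ge0 => x _; rewrite lee_fin sqr_ge0. Qed.

Lemma disp1 f : disp f 1%g = 0%E.
Proof. by apply: esum1 => x _; rewrite mulg1 subrr expr0n. Qed.

Lemma dispV f g : disp f (g^-1)%g = disp f g.
Proof.
rewrite /disp -(@esum_rmul R G _ g); apply: eq_esum => x _.
by rewrite mulgK -(sqrrN (_ - _)) opprB.
Qed.

Lemma dispM f g h : (disp f (g * h)%g <= 2%:E * (disp f g + disp f h))%E.
Proof.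
have p0 k x : (0 <= ((f (x * k)%g - f x) ^+ 2)%:E)%E by rewrite lee_fin sqr_ge0.
rewrite /disp -[X in (_ <= _ * (_ + X))%E](@esum_rmul R G _ g) -esumD// -esumZl//;
  last by move=> x; rewrite adde_ge0.
apply: le_esum => x _; rewrite /= -EFinD -EFinM lee_fin mulgA.
move: (f (x * g * h)%g) (f (x * g)%g) (f x) => a b c.
have := sqr_ge0 (a - b - (b - c)); nra.
Qed.

(** Telescoping along the powers of [g] and Cauchy-Schwarz give the factor n^2; iterating [dispM]
    one factor at a time would give an exponential one. *)
Lemma dispX f g n : (disp f (g ^+ n)%g <= (n%:R ^+ 2)%:E * disp f g)%E.
Proof.
case: n => [|n]; first by rewrite expg0 disp1 expr0n mul0e.
have key : (disp f (g ^+ n.+1)%g <=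
    n.+1%:R%:E * \sum_(i < n.+1) disp f g)%E.
  under eq_bigr => i _ do rewrite /disp
    -(@esum_rmul R G (fun x => ((f (x * g)%g - f x) ^+ 2)%:E) (g ^+ i)%g).
  rewrite -esum_sum; last by move=> *; rewrite lee_fin sqr_ge0.
  rewrite -esumZl//; last first.
    by move=> x; apply: sume_ge0 => i _; rewrite lee_fin sqr_ge0.
  apply: le_esum => x _; rewrite /= sumEFin -EFinM lee_fin.
  have -> : f (x * g ^+ n.+1)%g - f x =
      \sum_(i < n.+1) (f (x * g ^+ i * g)%g - f (x * g ^+ i)%g).
    rewrite -(big_mkord xpredT (fun i => f (x * g ^+ i * g)%g - f (x * g ^+ i)%g)).
    rewrite (eq_bigr (fun i => f (x * g ^+ i.+1)%g - f (x * g ^+ i)%g)); last first.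
      by move=> i _; rewrite -mulgA -expgSr.
    by rewrite telescope_sumr// expg0 mulg1.
  exact: (sqr_sum_le (fun i => f (x * g ^+ i * g)%g - f (x * g ^+ i)%g)).
apply: le_trans key _.
have -> : (\sum_(i < n.+1) disp f g = n.+1%:R%:E * disp f g)%E.
  rewrite mule_natl; elim: n => [|n IH]; first by rewrite big_ord1.
  by rewrite big_ord_recr/= IH addeC.
by rewrite muleA -EFinM expr2.
Qed.

Lemma dirichletE (mu : G -> R) f : (forall x, 0 <= mu x) ->
  (dirichlet mu f = (1 / 2)%:E * \esum_(y in setT) ((mu y)%:E * disp f y))%E.
Proof.
move=> mu0; congr (_ * _)%E; rewrite esum_exchange; last first.
  by move=> x y; rewrite lee_fin mulr_ge0// sqr_ge0.
apply: eq_esum => y _; rewrite -esumZl//; last first.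
  by move=> x; rewrite lee_fin sqr_ge0.
by apply: eq_esum => x _; rewrite -EFinM mulrC.
Qed.

Lemma dirichlet_ge0 (mu : G -> R) f : (forall x, 0 <= mu x) -> (0 <= dirichlet mu f)%E.
Proof.
move=> mu0; rewrite dirichletE//; apply: mule_ge0; first by rewrite lee_fin divr_ge0.
by apply: esum_ge0 => y _; rewrite mule_ge0 ?lee_fin ?disp_ge0.
Qed.

Lemma sum_disp_le_dirichlet (mu : G -> R) f s : (forall x, 0 <= mu x) -> uniq s ->
  (\sum_(y <- s) (mu y)%:E * disp f y <= 2%:E * dirichlet mu f)%E.
Proof.
move=> mu0 us; rewrite dirichletE// muleA -EFinM mul1r mulfV// mul1e.
by apply: sum_le_esum => // y; rewrite mule_ge0 ?lee_fin ?disp_ge0.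
Qed.

End Displacement.

(** * Small elements *)

Section Small.
Context (R : realType) (G : groupType) (mu : G -> R).
Hypothesis mu0 : forall x, 0 <= mu x.

(** The scale is part of [K]: smallness at scale t reads [small (K * t)] with [K] independent of
    t. *)
Definition small (K : R) (g : G) := forall f, (disp f g <= K%:E * dirichlet mu f)%E.

Lemma small_le K K' g : K <= K' -> small K g -> small K' g.
Proof.
move=> KK sg f; apply: le_trans (sg f) _.
by apply: lee_wpmul2r; [exact: dirichlet_ge0|rewrite lee_fin].
Qed.

Lemma small1 K : 0 <= K -> small K 1%g.
Proof. by move=> K0 f; rewrite disp1 mule_ge0// dirichlet_ge0. Qed.

Lemma smallV K g : small K g -> small K (g^-1)%g.
Proof. by move=> sg f; rewrite dispV. Qed.

Lemma smallM K K' g h : 0 <= K -> 0 <= K' -> small K g -> small K' h ->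
  small (2 * (K + K')) (g * h)%g.
Proof.
move=> K0 K'0 sg sh f; apply: le_trans (dispM f g h) _.
rewrite EFinM -muleA; apply: lee_wpmul2l; first by rewrite lee_fin.
by rewrite EFinD ge0_muleDl ?lee_fin//; exact: leeD.
Qed.

Lemma smallX K g n : 0 <= K -> small K g -> small (n%:R ^+ 2 * K) (g ^+ n)%g.
Proof.
move=> K0 sg f; apply: le_trans (dispX f g n) _.
rewrite (EFinM (n%:R ^+ 2) K) -muleA.
by apply: lee_wpmul2l.
Qed.

(** An element of mass above [eps] is bounded by its own term in the Dirichlet form, and words in
    such elements follow. [K] depends on [g], which is harmless for the finitely many letters. *)
Lemma small_gen eps g : 0 < eps -> gen [set x | eps < mu x] g ->
  exists2 K, 0 <= K & small K g.
Proof.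
move=> e0; elim=> [|a /= ea|x _ [K K0 sx]|x y _ [K K0 sx] _ [K' K'0 sy]].
- by exists 0 => //; exact: small1.
- exists (2 / eps); first by rewrite divr_ge0// ltW.
  move=> f; have := @sum_disp_le_dirichlet R G mu f [:: a] mu0 isT.
  rewrite big_seq1 => H.
  have : (eps%:E * disp f a <= 2%:E * dirichlet mu f)%E.
    apply: le_trans H; apply: lee_wpmul2r; first exact: disp_ge0.
    by rewrite lee_fin ltW.
  move=> /(lee_wpmul2l (_ : 0 <= (eps^-1)%:E)%E); rewrite lee_fin invr_ge0 (ltW e0).
  move=> /(_ isT); rewrite !muleA -!EFinM mulVf ?gt_eqF// mul1e.
  by rewrite [_ * 2]mulrC.
- by exists K => //; exact: smallV.
- exists (2 * (K + K')); first by rewrite mulr_ge0// addr_ge0.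
  exact: smallM.
Qed.

End Small.

Lemma sumr_const_seq (R : realType) (T : Type) (s : seq T) (c : R) :
  \sum_(i <- s) c = (size s)%:R * c.
Proof. by rewrite big_const_seq count_predT iter_addr_0 mulr_natl. Qed.

Lemma sume_const_seq (R : realType) (T : Type) (s : seq T) (c : \bar R) :
  (\sum_(i <- s) c = (size s)%:R%:E * c)%E.
Proof.
elim: s => [|x s IH]; first by rewrite big_nil mul0e.
by rewrite big_cons IH/= -natr1 EFinD ge0_muleDl ?lee_fin// mul1e addeC.
Qed.

(** * Averaging over a set of small elements: Faber-Krahn and Nash inequalities *)

Section FiniteSupport.
Context (R : realType) (G : groupType) (mu : G -> R).
Hypothesis mu0 : forall x, 0 <= mu x.

Lemma l2sq_ge0 (f : G -> R) : (0 <= l2sq f)%E.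
Proof. by apply: esum_ge0 => x _; rewrite lee_fin sqr_ge0. Qed.

Lemma l2sq_finsupp (f : G -> R) (A : seq G) : uniq A ->
  (forall x, x \in A <-> f x != 0) -> l2sq f = (\sum_(x <- A) f x ^+ 2)%:E.
Proof.
move=> uA fA; rewrite /l2sq (esum_finsupp uA) ?sumEFin//.
  by move=> x; rewrite lee_fin sqr_ge0.
move=> x xA; have [-> //|fx] := eqVneq (f x) 0; first by rewrite expr0n.
by move/fA: fx xA => ->.
Qed.

(* For x in the support A, at most #A of the translates x g, g in Q, return to A. *)
Lemma l2sq_le_disp (f : G -> R) (A Q : seq G) (M : R) : uniq A ->
  (forall x, x \in A <-> f x != 0) -> uniq Q ->
  (2 * size A <= size Q)%N -> (0 < size Q)%N ->
  (forall g, g \in Q -> (disp f g <= M%:E)%E) -> (l2sq f <= (2 * M)%:E)%E.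
Proof.
move=> uA fA uQ AQ Q0 dM; rewrite (l2sq_finsupp uA fA) lee_fin.
set L := \sum_(x <- A) _.
have Qp : 0 < (size Q)%:R :> R by rewrite ltr0n.
rewrite -(ler_pM2l Qp).
have up : \sum_(g <- Q) \sum_(x <- A) (f (x * g)%g - f x) ^+ 2 <= (size Q)%:R * M.
  rewrite -sumr_const_seq big_seq [leRHS]big_seq.
  apply: ler_sum => g gQ; rewrite -lee_fin; apply: le_trans (dM g gQ).
  rewrite -sumEFin; apply: sum_le_esum => // x.
  by rewrite lee_fin sqr_ge0.
have low : (size Q)%:R * L <= 2 * \sum_(g <- Q) \sum_(x <- A) (f (x * g)%g - f x) ^+ 2.
  rewrite exchange_big/= /L !mulr_sumr; apply: ler_sum => x _.
  have : \sum_(g <- Q | (x * g)%g \notin A) f x ^+ 2 <=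
         \sum_(g <- Q) (f (x * g)%g - f x) ^+ 2.
    rewrite big_mkcond/=; apply: ler_sum => g _.
    case: ifPn => [xg|_]; last exact: sqr_ge0.
    have -> : f (x * g)%g = 0.
      by apply/eqP/negPn/negP => /fA; exact/negP.
    by rewrite sub0r sqrrN.
  rewrite big_const_seq iter_addr_0 => H.
  have c1 : (count (fun g => (x * g)%g \in A) Q <= size A)%N.
    rewrite -size_filter -(size_map (fun g => x * g)%g).
    apply: uniq_leq_size; first by rewrite map_inj_uniq ?filter_uniq//; exact: mulgI.
    by move=> y /mapP[g]; rewrite mem_filter => /andP[xg _] ->.
  have c2 : (count (fun g => (x * g)%g \in A) Q +
             count (fun g => (x * g)%g \notin A) Q = size Q)%N := count_predC _ Q.
  have c3 : (size Q <= 2 * count (fun g => (x * g)%g \notin A) Q)%N.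
    by move: c1 c2 AQ; set u := count _ Q; set w := count _ Q; lia.
  apply: le_trans (_ : _ <= 2 * (f x ^+ 2 *+ count (fun g => (x * g)%g \notin A) Q)) _.
    rewrite -[f x ^+ 2 *+ _]mulr_natl mulrA ler_wpM2r ?sqr_ge0//.
    by rewrite -natrM ler_nat.
  by rewrite ler_pM2l.
apply: le_trans low _; rewrite mulrCA ler_pM2l//.
Qed.

Lemma spectral_profile_ge (K v : R) (Q : seq G) : 0 < K -> uniq Q ->
  (0 < size Q)%N -> 2 * v <= (size Q)%:R -> (forall g, g \in Q -> small mu K g) ->
  ((1 / (2 * K))%:E <= spectral_profile mu v)%E.
Proof.
move=> K0 uQ Q0 vQ sQ; apply: le_ereal_inf_tmp => _ [f [A [uA fA A1 Av ->]]].
have L0 : 0 < \sum_(x <- A) f x ^+ 2.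
  case: A uA fA A1 Av => // a A _ fA _ _; rewrite big_cons ltr_pwDl//.
    by rewrite exprn_even_gt0//=; apply/fA; rewrite mem_head.
  by apply: sumr_ge0 => x _; exact: sqr_ge0.
rewrite (l2sq_finsupp uA fA)/=.
have D0 := dirichlet_ge0 f mu0.
case E : (dirichlet mu f) D0 => [d| |//]; last first.
  by move=> _; rewrite gt0_mulye ?leey// lte_fin invr_gt0.
rewrite lee_fin => d0.
have : (l2sq f <= (2 * (K * d))%:E)%E.
  apply: (l2sq_le_disp uA fA uQ) => //.
    by rewrite -(ler_nat R) natrM; apply: le_trans vQ; rewrite ler_pM2l.
  by move=> g gQ; have := sQ g gQ f; rewrite E.
rewrite (l2sq_finsupp uA fA) lee_fin -EFinM lee_fin => H.
rewrite ler_pdivrMr ?mulr_gt0// mulrAC ler_pdivlMr// mul1r.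
by rewrite mulrC -mulrA.
Qed.

Lemma spectral_profile_ge0 v : (0 <= spectral_profile mu v)%E.
Proof.
apply: le_ereal_inf_tmp => _ [f [A [uA fA A1 Av ->]]].
rewrite mule_ge0 ?dirichlet_ge0// lee_fin invr_ge0 fine_ge0//.
exact: l2sq_ge0.
Qed.

(** Expand the square and sum over [g] in [Q]: the points x g are distinct, so the cross terms at x
    total at most 2 f(x), because f has mass one. Summing over x leaves the error 2 / #Q, whatever
    the support of f. *)
Lemma l2sq_le_prob (f : G -> R) (K : R) (Q : seq G) : (forall x, 0 <= f x) ->
  (\esum_(x in setT) (f x)%:E = 1)%E -> 0 <= K -> uniq Q -> (0 < size Q)%N ->
  (forall g, g \in Q -> small mu K g) ->
  (l2sq f <= K%:E * dirichlet mu f + (2 / (size Q)%:R)%:E)%E.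
Proof.
move=> f0 f1 K0 uQ Q0 sQ.
have Qp : 0 < (size Q)%:R :> R by rewrite ltr0n.
have sq0 (a : R) : (0 <= (a ^+ 2)%:E)%E by rewrite lee_fin sqr_ge0.
have key : ((size Q)%:R%:E * l2sq f <=
    \sum_(g <- Q) disp f g + 2%:E)%E.
  rewrite -esum_sum// -[X in (_ + X)%E]mule1 -f1 -!esumZl// -esumD//; first last.
  - by move=> x _; rewrite mule_ge0// lee_fin.
  - by move=> x _; apply: sume_ge0 => g _.
  apply: le_esum => x _; rewrite sumEFin -!EFinM -EFinD lee_fin.
  have : \sum_(g <- Q) f (x * g)%g <= 1.
    rewrite -lee_fin -sumEFin -f1 -(esum_lmul _ x).
    by apply: sum_le_esum => // g; rewrite lee_fin.
  move=> /(ler_wpM2l (f0 x)); rewrite mulr1 mulr_sumr => H.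
  apply: le_trans (_ : _ <= \sum_(g <- Q) (f (x * g)%g - f x) ^+ 2 +
      2 * \sum_(g <- Q) f x * f (x * g)%g) _; last by rewrite lerD2l ler_pM2l.
  rewrite mulr_sumr -big_split/= -sumr_const_seq.
  apply: ler_sum => g _; have := sqr_ge0 (f (x * g)%g); nra.
have key2 : (\sum_(g <- Q) disp f g <= (size Q)%:R%:E * (K%:E * dirichlet mu f))%E.
  have D0 : (0 <= K%:E * dirichlet mu f)%E by rewrite mule_ge0// dirichlet_ge0.
  apply: le_trans (_ : _ <= \sum_(g <- Q) K%:E * dirichlet mu f)%E _.
    by rewrite big_seq [leRHS]big_seq; apply: lee_sum => g /sQ; apply.
  by rewrite sume_const_seq.
have {key2}key := le_trans key (leeD key2 (lexx _)).
move: (dirichlet mu f) (dirichlet_ge0 f mu0) key => D D0 key.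
have Qi : (0 <= (size Q)%:R^-1%:E :> \bar R)%E by rewrite lee_fin invr_ge0 ltW.
have := lee_wpmul2l Qi key.
rewrite ge0_muleDr ?mule_ge0 ?lee_fin//.
rewrite !muleA -!EFinM mulVf ?gt_eqF// mul1e mul1r.
by rewrite [_^-1 * _]mulrC.
Qed.

End FiniteSupport.

(** * Convolution powers and their l2 norms *)

Section Markov.
Context (R : realType) (G : groupType) (mu : G -> R).
Hypotheses (mu_prob : prob_measure mu) (mu_sym : symmetric_measure mu).
Implicit Types (u v : G -> R).

Let mu0 x : 0 <= mu x. Proof. by case: mu_prob. Qed.
Let mu1 : (\esum_(x in setT) (mu x)%:E = 1)%E. Proof. by case: mu_prob. Qed.
Let musym x : mu (x^-1)%g = mu x. Proof. exact: mu_sym. Qed.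

Lemma prob_le1 u x : prob_measure u -> u x <= 1.
Proof.
move=> [u0 u1]; rewrite -lee_fin -u1.
have := @sum_le_esum R G (fun x => (u x)%:E) [:: x] isT.
by rewrite big_seq1; apply=> y; rewrite lee_fin.
Qed.

(** The substitution y = x z and the symmetry of [mu] turn convolution into an average over the
    steps of the walk. As [u] is bounded by 1 the sum is finite, so [fine] loses nothing. *)
Lemma conv_mean u x : prob_measure u ->
  ((Defs.conv u mu x)%:E = \esum_(z in setT) (mu z * u (x * z)%g)%:E)%E.
Proof.
move=> pu; have [u0 u1] := pu.
have E : (\esum_(y in setT) (u y * mu (y^-1 * x)%g)%:E =
    \esum_(z in setT) (mu z * u (x * z)%g)%:E)%E.
  rewrite -(esum_lmul _ x); apply: eq_esum => z _.
  by rewrite invgM -mulgA mulVg mulg1 musym mulrC.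
rewrite /Defs.conv E fineK// ge0_fin_numE; last first.
  by apply: esum_ge0 => z _; rewrite lee_fin mulr_ge0.
apply: (@le_lt_trans _ _ 1%E); last by rewrite ltry.
rewrite -mu1; apply: le_esum => z _; rewrite lee_fin.
by rewrite -[leRHS]mulr1 ler_wpM2l// prob_le1.
Qed.

Lemma conv_prob u : prob_measure u -> prob_measure (Defs.conv u mu).
Proof.
move=> pu; have [u0 u1] := pu; split.
  by move=> x; rewrite -lee_fin conv_mean//; apply: esum_ge0 => z _; rewrite lee_fin mulr_ge0.
rewrite (eq_esum (fun x _ => conv_mean x pu)) esum_exchange; last first.
  by move=> x y; rewrite lee_fin mulr_ge0.
rewrite -mu1; apply: eq_esum => z _.
under eq_esum => x _ do rewrite EFinM.
rewrite esumZl//; last by move=> x; rewrite lee_fin.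
by rewrite (esum_rmul (fun x => (u x)%:E)) u1 mule1.
Qed.

Lemma conv_adjoint u v : prob_measure u -> prob_measure v ->
  (\esum_(x in setT) (Defs.conv u mu x * v x)%:E =
   \esum_(x in setT) (u x * Defs.conv v mu x)%:E)%E.
Proof.
move=> pu pv; have [u0 _] := pu; have [v0 _] := pv.
have expand w w' : prob_measure w -> (forall x, 0 <= w x) -> (forall x, 0 <= w' x) ->
    (\esum_(x in setT) (w' x * Defs.conv w mu x)%:E =
     \esum_(z in setT) \esum_(x in setT) (w' x * (mu z * w (x * z)%g))%:E)%E.
  move=> pw w0 w'0; rewrite esum_exchange; last first.
    by move=> x y; rewrite lee_fin !mulr_ge0.
  apply: eq_esum => x _; rewrite EFinM conv_mean// -esumZl//.
  by move=> z; rewrite lee_fin mulr_ge0.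
under eq_esum => x _ do rewrite mulrC.
rewrite expand// expand// -[RHS](@esum_inv R G (fun z => \esum_(x in setT) _)).
apply: eq_esum => z _; rewrite -[RHS](esum_rmul _ z); apply: eq_esum => x _.
by rewrite mulgK musym; congr (_%:E); ring.
Qed.

Lemma convpow_prob n : prob_measure (convpow mu n).
Proof.
elim: n => [|n IH]; last exact: conv_prob.
split; first by move=> x /=; case: ifP.
rewrite (@esum_finsupp R G _ [:: 1%g])//.
- by rewrite big_seq1 /= eqxx.
- by move=> x; rewrite lee_fin /=; case: ifP.
- by move=> x; rewrite inE => /negbTE /= ->.
Qed.

(** By self-adjointness the factors pass one at a time from the left argument to the right one,
    starting from the pairing with the point mass at e. For m = n, return probabilities at even
    times become squared l2 norms. *)
Lemma convpow_pairing m n :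
  ((convpow mu (m + n) 1%g)%:E =
   \esum_(x in setT) (convpow mu m x * convpow mu n x)%:E)%E.
Proof.
have p0 k x : 0 <= convpow mu k x by case: (convpow_prob k).
elim: n m => [|n IH] m.
  rewrite addn0 (@esum_finsupp R G _ [:: 1%g])//.
  - by rewrite big_seq1 /= ?eqxx ?mulr1.
  - by move=> x; rewrite lee_fin mulr_ge0.
  - by move=> x; rewrite inE => /negbTE /= ->; rewrite mulr0.
rewrite addnS -addSn IH/= -conv_adjoint//; exact: convpow_prob.
Qed.

Lemma convpow_even n : ((convpow mu (n + n) 1%g)%:E = l2sq (convpow mu n))%E.
Proof. by rewrite convpow_pairing; apply: eq_esum => x _. Qed.

(* The l2 norm lost in one step is the total variance of u over the steps of the walk,
   and each variance dominates the gradient at the starting point as mu charges e. *)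
Lemma conv_energy u : prob_measure u ->
  ((mu 1%g / 2)%:E * dirichlet mu u + l2sq (Defs.conv u mu) <= l2sq u)%E.
Proof.
move=> pu; have [u0 u1] := pu.
have v0 x : 0 <= Defs.conv u mu x by case: (conv_prob pu).
pose V x := (\esum_(z in setT) (mu z * (u (x * z)%g - Defs.conv u mu x) ^+ 2)%:E)%E.
have V0 x : (0 <= V x)%E by apply: esum_ge0 => z _; rewrite lee_fin mulr_ge0 ?sqr_ge0.
have varE x : (V x + (Defs.conv u mu x ^+ 2)%:E =
    \esum_(z in setT) (mu z * u (x * z)%g ^+ 2)%:E)%E.
  set c := Defs.conv u mu x.
  have c0 : 0 <= c by exact: v0.
  (* The variance identity is written without subtraction, since the sums live in the extended
     reals; the finite term [c ^+ 2] is cancelled afterwards. *)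
  have H : (V x + (2 * c * c)%:E =
    \esum_(z in setT) (mu z * u (x * z)%g ^+ 2)%:E + (c ^+ 2)%:E)%E.
    rewrite [X in (_ + X)%E]EFinM conv_mean// -esumZl ?mulr_ge0//; last first.
      by move=> z; rewrite lee_fin mulr_ge0.
    rewrite -[X in (_ = _ + X)%E]mule1 -mu1 -esumZl ?sqr_ge0//.
    have q0 (b : R) z : (0 <= (mu z * b ^+ 2)%:E)%E by rewrite lee_fin mulr_ge0 ?sqr_ge0.
    have q1 z : (0 <= (2 * c)%:E * (mu z * u (x * z)%g)%:E)%E.
      by rewrite -EFinM lee_fin !mulr_ge0.
    have q2 z : (0 <= (c ^+ 2)%:E * (mu z)%:E)%E by rewrite -EFinM lee_fin mulr_ge0 ?sqr_ge0.
    rewrite /V -(esumD (fun z _ => q0 _ z) (fun z _ => q1 z)).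
    rewrite -(esumD (fun z _ => q0 _ z) (fun z _ => q2 z)).
    apply: eq_esum => z _; rewrite -!EFinM -!EFinD -/c; congr (_%:E); ring.
  have : (V x + (c ^+ 2)%:E + (c ^+ 2)%:E =
    \esum_(z in setT) (mu z * u (x * z)%g ^+ 2)%:E + (c ^+ 2)%:E)%E.
    by rewrite -H -addeA -EFinD; congr (_ + _%:E)%E; ring.
  by move/(congr1 (fun y => y - (c ^+ 2)%:E)%E); rewrite !addeK.
have sumV : (\esum_(x in setT) V x + l2sq (Defs.conv u mu) = l2sq u)%E.
  rewrite -esumD//; last by move=> x _; rewrite lee_fin sqr_ge0.
  rewrite (eq_esum (fun x _ => varE x)) esum_exchange; last first.
    by move=> x y; rewrite lee_fin mulr_ge0 ?sqr_ge0.
  have uu0 x : (0 <= (u x ^+ 2)%:E)%E by rewrite lee_fin sqr_ge0.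
  rewrite -[RHS]mul1e -mu1; rewrite [RHS]muleC.
  have l2 : (0 <= l2sq u)%E by exact: l2sq_ge0.
  have fin_l2 : (l2sq u \is a fin_num)%E.
    rewrite ge0_fin_numE//; apply: (@le_lt_trans _ _ 1%E); last by rewrite ltry.
    rewrite -u1; apply: le_esum => x _; rewrite lee_fin expr2.
    by rewrite -[leRHS]mulr1 ler_wpM2l// prob_le1.
  rewrite -(fineK fin_l2) -esumZl ?fine_ge0//.
  apply: eq_esum => z _; under eq_esum => x _ do rewrite EFinM.
  rewrite esumZl// (esum_rmul (fun x => (u x ^+ 2)%:E)) muleC.
  by rewrite fineK.
rewrite -sumV leeD2r// /dirichlet muleA -EFinM -esumZl; first last.
- by move=> x; apply: esum_ge0 => y _; rewrite lee_fin mulr_ge0 ?sqr_ge0.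
- by rewrite !mulr_ge0// invr_ge0.
apply: le_esum => x _.
set c := Defs.conv u mu x.
(* The step z = e stays at x and contributes this term to the variance. With [mu 1 <= 1] it fixes
   the constant [mu 1 / 2]: each of the two terms of [Dle] below then costs at most half of
   [V x]. *)
have V1 : ((mu 1%g * (u x - c) ^+ 2)%:E <= V x)%E.
  have := @sum_le_esum R G (fun z => (mu z * (u (x * z)%g - c) ^+ 2)%:E) [:: 1%g] isT.
  rewrite big_seq1 mulg1; apply=> z; by rewrite lee_fin mulr_ge0 ?sqr_ge0.
have Dle : (\esum_(y in setT) ((u (x * y)%g - u x) ^+ 2 * mu y)%:E <=
   2%:E * V x + (2 * (u x - c) ^+ 2)%:E)%E.
  rewrite -[X in (_ <= _ + X)%E]mule1 -mu1 -!esumZl//; first last.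
  - by move=> z; rewrite lee_fin mulr_ge0 ?sqr_ge0.
  - by rewrite mulr_ge0 ?sqr_ge0.
  rewrite -esumD; first last.
  - by move=> z _; rewrite -EFinM lee_fin mulr_ge0// mulr_ge0 ?sqr_ge0.
  - by move=> z _; rewrite -EFinM lee_fin mulr_ge0// mulr_ge0 ?sqr_ge0.
  apply: le_esum => z _; rewrite -!EFinM -EFinD lee_fin.
  rewrite [leRHS](_ : _ = (2 * (u (x * z)%g - c) ^+ 2 + 2 * (u x - c) ^+ 2) * mu z); last by rewrite -/c; ring.
  rewrite ler_wpM2r//.
  have := sqr_ge0 ((u (x * z)%g - c) + (u x - c)); nra.
have m1 : mu 1%g <= 1 by exact: prob_le1.
have c4 : 0 <= mu 1%g / 2 * (1 / 2) by rewrite !mulr_ge0// invr_ge0.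
apply: le_trans (lee_wpmul2l _ Dle) _; first by rewrite lee_fin.
case EV : (V x) (V0 x) V1 => [w| |//]; last first.
  by move=> _ _; rewrite leey.
rewrite !lee_fin => w0 H1.
have := ler_wpM2r w0 m1; nra.
Qed.

Lemma l2sq_convpow_le n : (l2sq (convpow mu n.+1) <= l2sq (convpow mu n))%E.
Proof.
apply: le_trans (conv_energy (convpow_prob n)).
by rewrite leeDr// mule_ge0 ?dirichlet_ge0// lee_fin divr_ge0.
Qed.

Lemma convpow_even_le n : convpow mu (n.+1 + n.+1) 1%g <= convpow mu (n + n) 1%g.
Proof. by rewrite -lee_fin !convpow_even l2sq_convpow_le. Qed.

(** Pair the two powers, use 2ab <= a^2 + b^2, and then the decrease of the l2 norms. *)
Lemma convpow_odd_le n : convpow mu (n + n.+1) 1%g <= convpow mu (n + n) 1%g.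
Proof.
have p0 k x : 0 <= convpow mu k x by case: (convpow_prob k).
have step := l2sq_convpow_le n.
rewrite -(ler_pM2l (ltr0n R 2)) -lee_fin EFinM convpow_pairing -esumZl//; last first.
  by move=> x; rewrite lee_fin mulr_ge0.
apply: (@le_trans _ _ (l2sq (convpow mu n) + l2sq (convpow mu n.+1))%E).
  rewrite -esumD; [|by move=> x _; rewrite lee_fin sqr_ge0..].
  apply: le_esum => x _; rewrite -EFinM -EFinD lee_fin.
  have := sqr_ge0 (convpow mu n x - convpow mu n.+1 x); nra.
apply: le_trans (leeD (lexx _) step) _.
by rewrite -convpow_even -EFinD lee_fin; lra.
Qed.

Lemma convpow_nash_step (K : R) (Q : seq G) n : 0 <= K -> 0 < mu 1%g ->
  uniq Q -> (0 < size Q)%N -> (forall g, g \in Q -> small mu K g) ->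
  convpow mu (n + n) 1%g <=
    K * (2 / mu 1%g) * (convpow mu (n + n) 1%g - convpow mu (n.+1 + n.+1) 1%g)
    + 2 / (size Q)%:R.
Proof.
move=> K0 e0 uQ Q0 sQ; have pu := convpow_prob n; have [u0 u1] := pu.
have := l2sq_le_prob mu0 u0 u1 K0 uQ Q0 sQ.
have := conv_energy pu.
have D0 := dirichlet_ge0 (convpow mu n) mu0.
have -> : Defs.conv (convpow mu n) mu = convpow mu n.+1 by [].
rewrite -!convpow_even.
case E : (dirichlet mu (convpow mu n)) D0 => [D| |//]; last first.
  by move=> _; rewrite gt0_muley ?lte_fin ?divr_gt0.
rewrite -!EFinM -!EFinD !lee_fin => D0 h1 h2; apply: le_trans h2 _.
rewrite lerD2r -mulrA ler_wpM2l//.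
rewrite mulrC mulrA ler_pdivlMr//.
lra.
Qed.

End Markov.

(** * Iterating the Nash inequality in time *)

Section Recursion.
Context (R : realType).

(** Multiply by (1 + x)^n, which is at least 1 + N by Bernoulli, and use (1 - x^2)^n <= 1. Decay by
    the factor 1 / (1 + N) is enough, as one doubling of t multiplies F by at most a constant. *)
Lemma geom_decay_le (y x N : R) (n : nat) : 0 <= x -> x <= 1 -> N <= n%:R * x ->
  0 <= N -> 0 <= y -> (1 - x) ^+ n * y <= y / (1 + N).
Proof.
move=> x0 x1 Nn N0 y0; rewrite ler_pdivlMr ?ltr_wpDr//.
rewrite -mulrA [y * _]mulrC mulrA -[leRHS]mul1r ler_wpM2r//.
apply: le_trans (_ : _ <= (1 - x) ^+ n * (1 + x) ^+ n) _; last first.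
  by rewrite -exprMn exprn_ile1//; nra.
apply: ler_wpM2l; first by rewrite exprn_ge0// subr_ge0.
apply: le_trans (_ : 1 + n%:R * x <= _); first by rewrite lerD2l.
elim: n {Nn} => [|n IH]; first by rewrite mul0r addr0 expr0.
rewrite exprS -natr1; have n0 : 0 <= n%:R :> R by []. nra.
Qed.

(* Each doubling of t costs O(t) further steps, so reaching a_n <= B / F t takes O(t) steps in all. *)
Lemma nash_recursion (a : nat -> R) (F : R -> R) (C A : R) :
  (forall n, 0 <= a n) -> (forall n, a n.+1 <= a n) -> a 0%N <= 1 -> 1 <= C -> 1 <= A ->
  (forall t, 1 <= t -> 0 < F t) ->
  (forall s t, 1 <= s -> s <= t -> F s <= F t) ->
  (forall t, 1 <= t -> F (2 * t) <= A * F t) ->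
  (forall n t, 1 <= t -> a n <= C * t * (a n - a n.+1) + 2 / F t) ->
  exists B (M : nat), [/\ 0 < B, (0 < M)%N &
    forall n, a n <= B / F (Num.max (n%:R / (2 * M%:R)) 1)].
Proof.
move=> a0 aS a01 C1 A1 F0 Fm F2 step.
have am m n : (m <= n)%N -> a n <= a m.
  by move=> /subnK <-; elim: (n - m)%N => // k IH; apply: le_trans IH; rewrite addSn.
(* With 4 the error 2 / F(2t) is at most half of any term above B / F(2t); with F(1) the bound holds
   initially, as [a 0 <= 1]. *)
pose B := Num.max 4 (F 1).
have B4 : 4 <= B by rewrite /B le_max lexx.
have B0 : 0 < B by apply: lt_le_trans B4.
have decay t n0 n : 1 <= t -> a n0 <= B / F t -> 4 * C * t * A <= n%:R ->
    a (n0 + n)%N <= B / F (2 * t).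
  move=> t1 h0 hn.
  have t21 : 1 <= 2 * t by lra.
  have Ft := F0 _ t1; have F2t := F0 _ t21.
  (* If the last term exceeds the target, so do all earlier ones by monotonicity. The error is then
     absorbed throughout, each step contracts by 1 - x, and n contractions contradict the
     assumption. *)
  rewrite leNgt; apply/negP => habs.
  pose x := (4 * C * t)^-1.
  have Ct : 0 < 4 * C * t by nra.
  have x0 : 0 < x by rewrite invr_gt0.
  have x1 : x <= 1 by rewrite invf_le1//; nra.
  have rec m : (m <= n)%N -> a (n0 + m)%N <= (1 - x) ^+ m * a n0.
    elim: m => [_|m IH mn]; first by rewrite addn0 expr0 mul1r.
    have {}IH := IH (ltnW mn).
    have big : B / F (2 * t) < a (n0 + m)%N.
      by apply: lt_le_trans habs _; apply: am; rewrite leq_add2l ltnW.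
    have := step (n0 + m)%N _ t21; rewrite -addnS => st.
    have h4 : 2 / F (2 * t) <= a (n0 + m)%N / 2.
      rewrite ler_pdivlMr// mulrAC; apply: le_trans (ltW big).
      by rewrite ler_wpM2r ?invr_ge0 ?(ltW F2t)//; lra.
    have h5 : a (n0 + m.+1)%N <= (1 - x) * a (n0 + m)%N.
      have e : x * (4 * C * t) = 1 by rewrite mulVf// gt_eqF.
      have : a (n0 + m)%N <= 4 * C * t * (a (n0 + m)%N - a (n0 + m.+1)%N) by lra.
      move=> /(ler_wpM2l (ltW x0)); rewrite mulrA e mul1r; lra.
    apply: le_trans h5 _; rewrite exprS -mulrA ler_wpM2l//; lra.
  have h1 := rec n (leqnn n).
  have An : A <= n%:R * x by rewrite /x ler_pdivlMr//; lra.
  have h2 := geom_decay_le (ltW x0) x1 An (le_trans ler01 A1) (a0 n0).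
  have h3 : a n0 / (1 + A) <= B / F (2 * t).
    rewrite ler_pdivrMr ?ltr_pwDl//; last lra.
    apply: le_trans h0 _; rewrite -mulrA ler_pM2l// mulrC ler_pdivlMr//.
    rewrite mulrC ler_pdivrMr//.
    have := F2 _ t1; nra.
  by have := lt_le_trans habs (le_trans h1 (le_trans h2 h3)); rewrite ltxx.
(* The k-th doubling lasts M 2^k steps, at least the 4 C A 2^k that [decay] asks for, and leads from
   time M 2^k to time M 2^(k+1). *)
pose M := (Num.truncn (4 * C * A)).+1.
have MP : 4 * C * A <= M%:R by apply/ltW/truncnS_gt.
have dy k : a (M * 2 ^ k)%N <= B / F (2 ^+ k).
  elim: k => [|k IH].
    rewrite expr0; apply: le_trans (am 0%N _ _) _ => //.
    apply: (le_trans a01); rewrite ler_pdivlMr ?F0// mul1r.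
    by rewrite /B le_max lexx orbT.
  have -> : (M * 2 ^ k.+1 = M * 2 ^ k + M * 2 ^ k)%N by rewrite expnS; lia.
  rewrite exprS; apply: decay => //; first by rewrite exprn_ege1// ler1n.
  rewrite natrM natrX mulrAC ler_wpM2r//.
exists B, M; split => // n.
have M0 : 0 < M%:R :> R by rewrite ltr0n.
have [nM|Mn] := ltnP n M.
  have -> : Num.max (n%:R / (2 * M%:R)) 1 = 1 :> R.
    apply/max_idPr; rewrite ler_pdivrMr ?mul1r; last by lra.
    have : n%:R <= M%:R :> R by rewrite ler_nat ltnW.
    lra.
  apply: le_trans (am 0%N _ _) _ => //; apply: (le_trans a01).
  by rewrite ler_pdivlMr ?F0// mul1r /B le_max lexx orbT.
(* [2 ^ k] is the largest power of two with M 2^k <= n. Rounding down to it loses less than a factor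
   2, whence the 2 M in the statement. *)
pose q := (n %/ M)%N; pose k := trunc_log 2 q.
have q0 : (0 < q)%N by rewrite divn_gt0.
have kq : (2 ^ k <= q < 2 ^ k.+1)%N by apply: trunc_log_bounds.
have lo : (M * 2 ^ k <= n)%N.
  move: kq => /andP[kq _]; rewrite mulnC; apply: leq_trans (leq_trunc_div n M).
  by rewrite leq_mul2r kq orbT.
have hi : (n < M * 2 ^ k.+1)%N.
  move: kq => /andP[_ kq]; rewrite mulnC -ltn_divLR//.
apply: le_trans (am _ _ lo) _; apply: le_trans (dy k) _.
have k1 : 1 <= 2 ^+ k :> R by rewrite exprn_ege1// ler1n.
have m1 : 1 <= Num.max (n%:R / (2 * M%:R)) 1 :> R by rewrite le_max lexx orbT.
rewrite ler_wpM2l ?(ltW B0)// lef_pV2 ?posrE ?F0//; apply: Fm => //.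
rewrite ge_max k1 andbT ler_pdivrMr; last by lra.
apply: ltW; rewrite -natrX mulrCA mulrA -!natrM ltr_nat.
by move: hi; rewrite expnS mulnC.
Qed.

End Recursion.

(** * The integral of 2s / phi(s) *)

Section PhiIntegral.
Context (R : realType) (phi : R -> R).
Hypotheses (phi_pos : forall t : R, 0 <= t -> 0 < phi t)
  (phi_mono : forall s t : R, 0 <= s -> s <= t -> phi s <= phi t).
Notation leb := (@lebesgue_measure R).

Let integrand (s : R) : R := 2 * s / phi s.

Let integrand_integrable (a b : R) : 0 <= a ->
  leb.-integrable `[a, b] (EFin \o integrand).
Proof.
move=> a0; apply: measurable_bounded_integrable => //=.
- by rewrite lebesgue_measure_itv/=; case: ifP => _; rewrite ?ltry// -EFinD ltry.
(* [phi] is monotone only on nonnegative arguments. Truncating the argument at 0 gives a function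
   monotone on the whole line, hence measurable, with the same values on the interval. *)
- pose g (s : R) := 2 * s * (phi (Num.max s 0))^-1.
  have mg : measurable_fun `[a, b] g.
    apply: measurable_funM; first exact: measurable_funM.
    apply: nonincreasing_measurable => // s t st.
    have m0 u : 0 <= Num.max u 0 :> R by rewrite le_max lexx orbT.
    rewrite lef_pV2 ?posrE ?phi_pos//; apply: phi_mono => //.
    by rewrite ge_max !le_max st lexx orbT.
  apply: eq_measurable_fun mg => s; rewrite inE/= in_itv/= => /andP[as_ _].
  by rewrite /g /integrand max_l// (le_trans a0).
- exists (2 * `|b| / phi 0); split => //; first by rewrite num_real.
  move=> x hx s /=; rewrite in_itv/= => /andP[as_ sb].
  have s0 : 0 <= s by apply: le_trans as_.
  apply: le_trans (ltW hx).
  rewrite ger0_norm; last by rewrite divr_ge0 ?mulr_ge0// ltW// phi_pos.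
  apply: ler_pM; rewrite ?mulr_ge0 ?invr_ge0//.
  + exact/ltW/phi_pos.
  + by rewrite ler_wpM2l// (le_trans sb)// ler_norm.
  + by rewrite lef_pV2 ?posrE ?phi_pos//; apply: phi_mono.
Qed.

Let int_linear (c a b : R) : a < b ->
  \int[leb]_(s in `[a, b]) (2 * s * c) = (b ^+ 2 - a ^+ 2) * c.
Proof.
move=> ab; rewrite /Rintegral.
have dF x : is_derive x (1:R) (fun s : R => s ^+ 2 * c) (2 * x * c).
  apply: is_derive_eq; rewrite /GRing.scale/=; ring.
have cF (x : R) : (fun s : R => s ^+ 2 * c) @ x --> x ^+ 2 * c.
  by apply: cvgM; [exact: exprn_continuous|exact: cvg_cst].
rewrite (@continuous_FTC2 _ _ (fun s => s ^+ 2 * c))//.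
- by rewrite -EFinB/=; ring.
- by apply: continuous_subspaceT => x; apply: cvgM; [apply: cvgM|]; [exact: cvg_cst|exact: cvg_id|exact: cvg_cst].
- split.
  + by move=> x _; apply: ex_derive.
  + apply: cvg_at_right_filter; exact: cF.
  + apply: cvg_at_left_filter; exact: cF.
- by move=> x _; rewrite derive1E; exact: derive_val.
Qed.

(** Monotonicity of [phi] squeezes the integrand between two linear functions. Beyond its value at
    0, this is all that is used about the integral later. *)
Lemma PhiInt_bounds (a b : R) : 0 <= a -> a <= b ->
  (b ^+ 2 - a ^+ 2) / phi b <= PhiInt phi b - PhiInt phi a <= (b ^+ 2 - a ^+ 2) / phi a.
Proof.
move=> a0; rewrite le_eqVlt => /orP[/eqP <-|ab]; first by rewrite !subrr !mul0r lexx.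
have b0 : 0 < b by apply: le_lt_trans ab.
have -> : PhiInt phi b - PhiInt phi a = \int[leb]_(s in `[a, b]) integrand s.
  rewrite /PhiInt -/integrand Rintegral_itvB ?bnd_simp ?(ltW ab)//; last first.
    exact: (@integrand_integrable 0 b).
  apply: Rintegral_itv_obnd_cbnd.
  by apply: integrableS (@integrand_integrable a b a0) => //; exact: subset_itv_oc_cc.
have lin c : leb.-integrable `[a, b] (EFin \o (fun s => 2 * s * c)).
  apply: measurable_bounded_integrable => //=.
  - by rewrite lebesgue_measure_itv/= lte_fin ab -EFinD ltry.
  - by apply: measurable_funM => //; exact: measurable_funM.
  - exists (2 * b * `|c|); split; first by rewrite num_real.
    move=> x hx s /=; rewrite in_itv/= => /andP[as_ sb].
    apply: le_trans (ltW hx); rewrite normrM ler_wpM2r//.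
    by rewrite ger0_norm ?ler_wpM2l// mulr_ge0// (le_trans a0).
rewrite -!int_linear//; apply/andP; split; apply: le_Rintegral => //; try exact: integrand_integrable.
- move=> s /=; rewrite in_itv/= => /andP[as_ sb]; have s0 := le_trans a0 as_.
  rewrite ler_wpM2l ?mulr_ge0// lef_pV2 ?posrE ?phi_pos ?(ltW b0)//.
  exact: phi_mono.
- move=> s /=; rewrite in_itv/= => /andP[as_ sb]; have s0 := le_trans a0 as_.
  rewrite ler_wpM2l ?mulr_ge0// lef_pV2 ?posrE ?phi_pos//.
  exact: phi_mono.
Qed.

Lemma PhiInt0 : PhiInt phi 0 = 0.
Proof. by rewrite /PhiInt set_itv1 Rintegral_set1. Qed.

Lemma PhiInt_ge t : 0 <= t -> t ^+ 2 / phi t <= PhiInt phi t.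
Proof.
move=> t0; have /andP[+ _] := PhiInt_bounds (lexx 0) t0.
by rewrite PhiInt0 subr0 expr0n subr0.
Qed.

Lemma PhiInt_gt0 t : 0 < t -> 0 < PhiInt phi t.
Proof.
move=> t0; apply: lt_le_trans (PhiInt_ge (ltW t0)).
by rewrite divr_gt0 ?exprn_gt0// phi_pos// ltW.
Qed.

Lemma PhiInt_mono s t : 0 <= s -> s <= t -> PhiInt phi s <= PhiInt phi t.
Proof.
move=> s0 st; have /andP[+ _] := PhiInt_bounds s0 st.
rewrite -subr_ge0 => h; rewrite -subr_ge0; move: h; rewrite subr_ge0; apply: le_trans.
rewrite divr_ge0//; last by rewrite ltW// phi_pos// (le_trans s0).
by rewrite subr_ge0 lerXn2r// nnegrE (le_trans s0).
Qed.

End PhiIntegral.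

(** * Common properties of the functions Phi_i *)

Section ScaleFunctions.
Context (R : realType).
Implicit Types (Phi phi : R -> R).

(** What the inverses need, for [Phi0] and the regularly varying case alike: [scale_growth] makes
    the inverse doubling, [scale_quadratic] carries bounds on the inverse back to [Phi],
    [scale_linear] fixes the behaviour near 0. *)
Record scale_fun Phi : Prop := ScaleFun {
  scale_mono : forall s t : R, 0 <= s -> s <= t -> Phi s <= Phi t;
  scale_quadratic : forall l t : R, 1 <= l -> 0 <= t -> Phi (l * t) <= l ^+ 2 * Phi t;
  scale_growth : exists A t0 : R, [/\ 1 <= A, 1 <= t0 & forall t : R, t0 <= t -> 2 * Phi t <= Phi (A * t)];
  scale_linear : exists2 kap : R, 0 < kap & forall t : R, 0 <= t -> t <= 1 -> Phi t = kap * t }.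

Lemma scale_Phi0 : scale_fun (@Phi0 R).
Proof.
have E (t : R) : 1 <= t -> Phi0 t = t ^+ 2 by move=> t1; apply/max_idPr; nra.
have e (t : R) : 0 <= t -> t <= 1 -> Phi0 t = t by move=> t0 t1; apply/max_idPl; nra.
split.
- move=> s t s0 st; rewrite /Phi0 ge_max !le_max st/= lerXn2r ?orbT// nnegrE.
  exact: le_trans st.
- move=> l t l1 t0.
  rewrite {1}/Phi0 ge_max; apply/andP; split.
    apply: le_trans (_ : l ^+ 2 * t <= _); first by rewrite ler_wpM2r//; nra.
    by rewrite ler_wpM2l ?sqr_ge0// /Phi0 le_max lexx.
  by rewrite exprMn ler_wpM2l ?sqr_ge0// /Phi0 le_max lexx orbT.
- exists 2, 1; split => // [|t t1]; first by rewrite ler1n.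
  by rewrite !E//; nra.
- by exists 1 => // t t0 t1; rewrite e// mul1r.
Qed.

Section Reg.
Variables (phi : R -> R) (gam : R).
Hypotheses (phi_pos : forall t : R, 0 <= t -> 0 < phi t)
  (phi_mono : forall s t : R, 0 <= s -> s <= t -> phi s <= phi t)
  (gam0 : 0 < gam) (phi_reg : regularly_varying phi gam).

Lemma regular_eventually (l : R) : 0 < l -> exists2 t0 : R, 1 <= t0 &
  forall t, t0 <= t -> `|phi (l * t) / phi t - l `^ gam| <= 1.
Proof.
move=> l0; have /cvgrPdist_le/(_ 1 ltr01) := phi_reg l0.
move=> [M [_ HM]]; exists (Num.max 1 (M + 1)); first by rewrite le_max lexx.
move=> t; rewrite ge_max => /andP[_ tM]; rewrite distrC; apply: HM.
by apply: lt_le_trans tM; rewrite ltrDl.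
Qed.

(** Regular variation controls large t only; on the bounded range left over, monotonicity bounds the
    quotient by its extreme values. The constant is the sum of the two. *)
Lemma phi_doubling (l : R) : 1 <= l -> exists2 C : R, 0 < C &
  forall t, 0 <= t -> phi (l * t) <= C * phi t.
Proof.
move=> l1; have l0 : 0 < l by apply: lt_le_trans l1.
have [t0 t01 ht] := regular_eventually l0.
have p0 := phi_pos (lexx 0).
have t00 : 0 <= t0 by apply: le_trans t01.
have plt : 0 < phi (l * t0) by apply: phi_pos; rewrite mulr_ge0// ltW.
have c10 : 0 < l `^ gam + 1 by rewrite ltr_wpDl// powR_ge0.
have c20 : 0 < phi (l * t0) / phi 0 by rewrite divr_gt0.
exists (l `^ gam + 1 + phi (l * t0) / phi 0); first by rewrite addr_gt0.
move=> t tp; have pt := phi_pos tp; rewrite mulrDl.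
have [tt0|/ltW tt0] := leP t0 t.
  have := ht _ tt0; rewrite ler_norml => /andP[_]; rewrite lerBlDl => h.
  apply: ler_wpDr; first by rewrite mulr_ge0// ltW.
  by rewrite -ler_pdivrMr// addrC.
apply: ler_wpDl; first by rewrite mulr_ge0// ltW.
apply: le_trans (_ : phi (l * t0) <= _).
  by apply: phi_mono; [rewrite mulr_ge0// ltW|rewrite ler_wpM2l// ltW].
rewrite mulrAC ler_pdivlMr// ler_pM2l//; exact: phi_mono.
Qed.

Lemma phi_growth : exists M t0 : R, [/\ 2 <= M, 1 <= t0 &
  forall t, t0 <= t -> 2 * phi t <= phi (M * t)].
Proof.
(* 3 rather than 2, to leave room for the error 1 in [regular_eventually]. The lower bound 2 on [M]
   makes M^2 / 2 at least 2 in [scale_PhiReg]. *)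
pose M := Num.max 2 (3 `^ gam^-1) : R.
have M2 : 2 <= M by rewrite /M le_max lexx.
have M0 : 0 < M by apply: lt_le_trans M2.
have M3 : 3 <= M `^ gam.
  apply: le_trans (_ : (3 `^ gam^-1) `^ gam <= _).
    by rewrite -powRrM mulVf ?gt_eqF// powRr1.
  apply: ge0_ler_powR; rewrite ?nnegrE ?(ltW gam0) ?(ltW M0) ?powR_ge0//.
  by rewrite /M le_max lexx orbT.
have [t0 t01 ht] := regular_eventually M0.
exists M, t0; split => // t tt0.
have pt : 0 < phi t by rewrite phi_pos// (le_trans _ tt0)// (le_trans _ t01).
have := ht _ tt0; rewrite ler_norml => /andP[+ _] => h.
by rewrite -ler_pdivlMr//; lra.
Qed.

Let I := PhiInt phi.
Let I_ge := PhiInt_ge phi_pos phi_mono.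
Let I_gt0 := PhiInt_gt0 phi_pos phi_mono.

(** This is the monotonicity of t^2 / I(t): the increment of I is at most (t^2 - s^2) / phi(s), and
    1 / phi(s) is at most I(s) / s^2. *)
Let ratio_le s t : 0 < s -> s <= t -> s ^+ 2 * I t <= t ^+ 2 * I s.
Proof.
move=> s0 st; have /andP[_] := PhiInt_bounds phi_pos phi_mono (ltW s0) st.
rewrite -/I => h1; have h2 : s ^+ 2 / phi s <= I s := I_ge (ltW s0).
have t0 : 0 < t by apply: lt_le_trans st.
have d0 : 0 <= t ^+ 2 - s ^+ 2 by nra.
have := ler_wpM2l d0 h2; rewrite mulrCA => h3.
have := ler_wpM2l (sqr_ge0 s) h1; lra.
Qed.

Lemma scale_PhiReg : scale_fun (PhiReg phi).
Proof.
have I1 : 0 < I 1 by exact: I_gt0.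
have Eb t : 1 <= t -> PhiReg phi t = t ^+ 2 / I t by move=> t1; rewrite /PhiReg t1.
have Es t : t <= 1 -> PhiReg phi t = t / I 1.
  rewrite le_eqVlt => /orP[/eqP ->|]; first by rewrite Eb// expr1n.
  by rewrite ltNge /PhiReg => /negbTE ->; rewrite mul1r.
have mono1 s t : 1 <= s -> s <= t -> PhiReg phi s <= PhiReg phi t.
  move=> s1 st; have s0 : 0 < s by apply: lt_le_trans s1.
  have t1 := le_trans s1 st; have t0 := lt_le_trans s0 st.
  rewrite !Eb// ler_pdivrMr ?I_gt0// mulrAC ler_pdivlMr ?I_gt0//.
  exact: ratio_le.
have quad1 l t : 1 <= l -> 1 <= t -> PhiReg phi (l * t) <= l ^+ 2 * PhiReg phi t.
  move=> l1 t1; have t0 : 0 < t by apply: lt_le_trans t1.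
  have tl : t <= l * t by rewrite ler_peMl// ltW.
  rewrite !Eb//; last exact: le_trans tl.
  rewrite exprMn -mulrA ler_wpM2l ?sqr_ge0// ler_wpM2l ?sqr_ge0//.
  rewrite lef_pV2 ?posrE ?I_gt0//; last exact: lt_le_trans tl.
  exact: PhiInt_mono (ltW t0) tl.
split.
- move=> s t s0 st; have [s1|/ltW s1] := leP 1 s; first exact: mono1.
  have [t1|/ltW t1] := leP 1 t.
    apply: le_trans (mono1 _ _ (lexx 1) t1).
    by rewrite !Es// ler_wpM2r// invr_ge0 ltW.
  by rewrite !Es// ler_wpM2r// invr_ge0 ltW.
- move=> l t l1 t0; have [t1|/ltW t1] := leP 1 t; first exact: quad1.
  have l0 : 0 < l by apply: lt_le_trans l1.
  have [lt1|/ltW lt1] := leP 1 (l * t).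
    have tp : 0 < t by rewrite lt_neqAle t0 andbT; apply/negP => /eqP t0'; move: lt1; rewrite -t0' mulr0 ler10.
    have := quad1 _ _ lt1 (lexx 1); rewrite mulr1 => h; apply: le_trans h _.
    rewrite Es// (Es t)// exprMn div1r -mulrA ler_wpM2l ?sqr_ge0//.
    by rewrite ler_wpM2r ?invr_ge0 ?(ltW I1)//; nra.
  rewrite !Es// mulrA ler_wpM2r ?invr_ge0 ?(ltW I1)//.
  by have := mulr_ge0 (ltW l0) t0; nra.
- have [M [t0 [M2 t01 hM]]] := phi_growth.
  (* Over a factor M, [phi] at least doubles, so I(M^k t) is at most of order rho^k I(t), while t^2
     gains M^(2k) = 2^k rho^k. The quotient thus gains 2^k up to a constant, and k = p is taken
     large enough to beat that constant. *)
  pose rho := M ^+ 2 / 2.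
  have rho2 : 2 <= rho by rewrite /rho ler_pdivlMr//; nra.
  have Mr : M ^+ 2 = 2 * rho by rewrite /rho; field.
  have M0 : 0 < M by lra.
  have Mk1 k : 1 <= M ^+ k by rewrite exprn_ege1//; lra.
  have growk k t : t0 <= t -> 2 ^+ k * phi t <= phi (M ^+ k * t).
    move=> tt0; elim: k => [|k IH]; first by rewrite !expr0 !mul1r.
    rewrite !exprS -!mulrA; apply: le_trans (hM _ _).
      by rewrite ler_pM2l.
    by apply: (le_trans tt0); rewrite ler_peMl// (le_trans _ tt0)// (le_trans _ t01).
  have Ik k t : t0 <= t -> I (M ^+ k * t) <= I t * (1 + M ^+ 2 * rho ^+ k).
    move=> tt0; have tp : 0 < t by apply: lt_le_trans (lt_le_trans ltr01 t01) tt0.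
    have It : 0 < I t by exact: I_gt0.
    elim: k => [|k IH].
      by rewrite !expr0 mul1r mulr1 ler_peMr ?(ltW It)// lerDl sqr_ge0.
    have s0 : 0 < M ^+ k * t by rewrite mulr_gt0// exprn_gt0.
    have st : M ^+ k * t <= M ^+ k.+1 * t.
      by rewrite ler_wpM2r ?(ltW tp)// exprS ler_peMl ?exprn_ge0 ?(ltW M0)//; lra.
    have /andP[_] := PhiInt_bounds phi_pos phi_mono (ltW s0) st; rewrite -/I => h.
    have h2 : ((M ^+ k.+1 * t) ^+ 2 - (M ^+ k * t) ^+ 2) / phi (M ^+ k * t) <=
              M ^+ 2 * rho ^+ k * I t.
      apply: le_trans (_ : (M ^+ k.+1 * t) ^+ 2 / (2 ^+ k * phi t) <= _).
        apply: ler_pM.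
        - by rewrite subr_ge0 lerXn2r ?nnegrE ?(ltW s0)// (le_trans (ltW s0)).
        - by rewrite invr_ge0 ltW// phi_pos// ltW.
        - by rewrite lerBlDr lerDl sqr_ge0.
        - rewrite lef_pV2 ?posrE ?growk//; first by rewrite phi_pos// ltW.
          by rewrite mulr_gt0 ?exprn_gt0// phi_pos// ltW.
      have -> : (M ^+ k.+1 * t) ^+ 2 / (2 ^+ k * phi t) =
          M ^+ 2 * rho ^+ k * (t ^+ 2 / phi t).
        have p0 : phi t != 0 by rewrite gt_eqF// phi_pos// ltW.
        have e : (M ^+ k.+1) ^+ 2 = M ^+ 2 * (2 ^+ k * rho ^+ k).
          by rewrite -exprMn -Mr -!exprM -exprD mulSn [(k * 2)%N]mulnC.
        have : (2:R) ^+ k != 0 by rewrite expf_eq0 pnatr_eq0 andbF.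
        by rewrite exprMn e; move: (2 ^+ k) (rho ^+ k) => u w u0; field; rewrite u0 p0.
      by rewrite ler_wpM2l ?mulr_ge0 ?sqr_ge0 ?exprn_ge0 ?I_ge ?(ltW tp)//; lra.
    have r0 : 0 <= rho ^+ k by rewrite exprn_ge0//; lra.
    have : I (M ^+ k.+1 * t) <= I t * (1 + M ^+ 2 * rho ^+ k) + M ^+ 2 * rho ^+ k * I t by lra.
    move=> /le_trans; apply; rewrite [rho ^+ k.+1]exprS.
    have q0 : 0 <= M ^+ 2 * rho ^+ k * I t by rewrite !mulr_ge0 ?sqr_ge0// ltW.
    have d0 : 0 <= rho - 2 by rewrite subr_ge0.
    have := mulr_ge0 d0 q0; lra.
  pose p := (Num.truncn (4 * M ^+ 2 + 4)).+1.
  have hp : 4 * M ^+ 2 + 4 <= 2 ^+ p.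
    apply: (@le_trans _ _ p%:R); first exact/ltW/truncnS_gt.
    by rewrite -natrX ler_nat ltnW// ltn_expl.
  exists (M ^+ p), t0; split => // t tt0.
  have t1 := le_trans t01 tt0; have tp : 0 < t := lt_le_trans ltr01 t1.
  have It : 0 < I t by exact: I_gt0.
  have mt : 0 < M ^+ p * t by rewrite mulr_gt0// exprn_gt0.
  rewrite !Eb//; last by apply: (le_trans t1); rewrite ler_peMl// ltW.
  rewrite mulrA ler_pdivrMr// mulrAC ler_pdivlMr ?I_gt0//.
  apply: le_trans (ler_wpM2l _ (Ik p _ tt0)) _; first by rewrite mulr_ge0 ?sqr_ge0.
  have e : (M ^+ p) ^+ 2 = 2 ^+ p * rho ^+ p.
    by rewrite -exprMn -Mr -!exprM mulnC.
  rewrite [(M ^+ p * t) ^+ 2]exprMn e.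
  have r1 : 1 <= rho ^+ p by rewrite exprn_ege1//; lra.
  have q0 : 0 <= t ^+ 2 * I t by rewrite mulr_ge0 ?sqr_ge0// ltW.
  rewrite [leLHS](_ : _ = (2 + 2 * M ^+ 2 * rho ^+ p) * (t ^+ 2 * I t)); last by ring.
  rewrite [leRHS](_ : _ = (2 ^+ p * rho ^+ p) * (t ^+ 2 * I t)); last by ring.
  rewrite ler_wpM2r//.
  have := ler_wpM2r (le_trans ler01 r1) hp; nra.
- exists (I 1)^-1; first by rewrite invr_gt0.
  by move=> t t0 t1; rewrite Es// mulrC.
Qed.

End Reg.
End ScaleFunctions.

(** * Weight functions and inverses of scale functions *)

Section Weights.
Context (R : realType).
Implicit Types (F : R -> R).

(** [weight_small] serves the inverse of the volume function: for v >= 1 it makes the set in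
    [inv_incr] nonempty and puts [del] into it. *)
Record weight F : Prop := Weight {
  weight_mono : forall s t : R, 0 <= s -> s <= t -> F s <= F t;
  weight_ge0 : forall t : R, 0 <= t -> 0 <= F t;
  weight_gt0 : forall t : R, 1 <= t -> 0 < F t;
  weight_doubling : exists2 A : R, 1 <= A & forall t : R, 1 <= t -> F (2 * t) <= A * F t;
  weight_small : exists2 del : R, 0 < del & forall t : R, 0 <= t -> t <= del -> F t <= 1 }.

Definition unbounded F := forall M : R, exists2 t : R, 1 <= t & M <= F t.

Lemma weight_cst1 : weight (fun=> 1).
Proof.
split=> //; last by exists 1.
by exists 1 => // t _; rewrite mul1r.
Qed.

Lemma weight_mul F H : weight F -> weight H -> weight (fun t => F t * H t).
Proof.
move=> [Fm Fp Fq [A A1 FA] [d d0 Fd]] [Hm Hp Hq [B B1 HB] [e e0 He]]; split.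
- move=> s t s0 st; have t0 := le_trans s0 st; apply: ler_pM; rewrite ?Fp ?Hp ?Fm ?Hm//.
- by move=> t t0; rewrite mulr_ge0 ?Fp ?Hp.
- by move=> t t0; rewrite mulr_gt0 ?Fq ?Hq.
- exists (A * B); first by rewrite mulr_ege1.
  move=> t t1; have t0 : 0 <= 2 * t by lra.
  apply: le_trans (_ : _ <= (A * F t) * (B * H t)) _; last by rewrite mulrACA.
  by apply: ler_pM; rewrite ?Fp ?Hp ?FA ?HB.
- exists (Num.min d e); first by rewrite lt_min d0.
  move=> t t0; rewrite le_min => /andP[td te].
  by rewrite mulr_ile1 ?Fp ?Hp ?Fd ?He.
Qed.

Lemma weight_exp F n : weight F -> weight (fun t => F t ^+ n).
Proof.
move=> wF; elim: n => [|n IH].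
  by rewrite (_ : (fun t => _) = fun=> 1); [exact: weight_cst1|apply/funext => t; rewrite expr0].
rewrite (_ : (fun t => _) = fun t => F t * F t ^+ n).
  exact: weight_mul.
by apply/funext => t; rewrite exprS.
Qed.

Lemma weight_max F H : weight F -> weight H -> weight (fun t => Num.max (F t) (H t)).
Proof.
move=> [Fm Fp Fq [A A1 FA] [d d0 Fd]] [Hm Hp Hq [B B1 HB] [e e0 He]]; split.
- by move=> s t s0 st; rewrite ge_max !le_max Fm// Hm ?orbT.
- by move=> t t0; rewrite le_max Fp.
- by move=> t t0; rewrite lt_max Fq.
- exists (A * B); first by rewrite mulr_ege1.
  move=> t t1; have t0 : 0 <= t by lra.
  have F0 := Fp _ t0; have H0 := Hp _ t0.
  have FM : F t <= Num.max (F t) (H t) by rewrite le_max lexx.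
  have HM : H t <= Num.max (F t) (H t) by rewrite le_max lexx orbT.
  have M0 := le_trans F0 FM.
  move: (Num.max (F t) (H t)) FM HM M0 => M FM HM M0.
  rewrite ge_max; apply/andP; split.
    apply: le_trans (FA _ t1) _.
    apply: le_trans (_ : A * M <= _); first by rewrite ler_wpM2l//; lra.
    by rewrite ler_wpM2r// ler_peMr//; lra.
  apply: le_trans (HB _ t1) _.
  apply: le_trans (_ : B * M <= _); first by rewrite ler_wpM2l//; lra.
  by rewrite ler_wpM2r// ler_peMl//; lra.
- exists (Num.min d e); first by rewrite lt_min d0.
  by move=> t t0; rewrite le_min => /andP[td te]; rewrite ge_max Fd// He.
Qed.

Lemma weight_doubling_pow F l : weight F -> 1 <= l -> exists2 C : R, 1 <= C &
  forall t, 1 <= t -> F (l * t) <= C * F t.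
Proof.
move=> wF l1; have [A A1 FA] := weight_doubling wF.
have it k t : 1 <= t -> F (2 ^+ k * t) <= A ^+ k * F t.
  move=> t1; elim: k => [|k IH]; first by rewrite !expr0 !mul1r.
  rewrite !exprS -!mulrA; apply: le_trans (FA _ _) _.
    by rewrite (le_trans t1)// ler_peMl ?exprn_ege1 ?ler1n//; lra.
  by rewrite ler_wpM2l//; lra.
pose k := (Num.truncn l).+1.
have lk : l <= 2 ^+ k.
  apply: (@le_trans _ _ k%:R); first exact/ltW/truncnS_gt.
  by rewrite -natrX ler_nat ltnW// ltn_expl.
exists (A ^+ k); first exact: exprn_ege1.
move=> t t1; apply: le_trans (it k t t1); apply: weight_mono => //.
  by rewrite mulr_ge0//; lra.
by rewrite ler_wpM2r//; lra.
Qed.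

(** Doubling absorbs the inner rescaling of t, and monotonicity covers the bounded range below the
    threshold. In this pointwise form, comparisons can be multiplied. *)
Lemma weight_preceqP F H : weight F -> weight H ->
  preceq_inf F H <-> exists2 C : R, 0 < C & forall t : R, 1 <= t -> F t <= C * H t.
Proof.
move=> wF wH; split; last first.
  by move=> [C C0 HC]; exists C, 1, 1; split=> //; split=> // t t1; rewrite mul1r; exact: HC.
move=> [c1 [c2 [T [c10 [c20 HT]]]]].
pose l := Num.max 1 c2; have l1 : 1 <= l by rewrite /l le_max lexx.
have [D D1 HD] := weight_doubling_pow wH l1.
pose T1 := Num.max 1 T; have T11 : 1 <= T1 by rewrite /T1 le_max lexx.
have H1 := weight_gt0 wH (lexx 1).
have FT : 0 < F T1 by apply: weight_gt0 wF _ T11.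
have q0 : 0 < F T1 / H 1 by rewrite divr_gt0.
have p0 : 0 < c1 * D by rewrite mulr_gt0//; lra.
exists (c1 * D + F T1 / H 1); first by rewrite addr_gt0.
move=> t t1; have t0 : 0 <= t by lra.
have Ht := weight_gt0 wH t1; rewrite mulrDl.
have [tT|/ltW tT] := leP T1 t.
  apply: ler_wpDr; first by rewrite mulr_ge0// ltW.
  apply: le_trans (HT t _) _; first by apply: le_trans tT; rewrite /T1 le_max lexx orbT.
  rewrite -mulrA ler_pM2l//; apply: le_trans (HD t t1); apply: weight_mono => //.
    by rewrite mulr_ge0// ltW.
  by rewrite ler_wpM2r// /l le_max lexx orbT.
apply: ler_wpDl; first by rewrite mulr_ge0// ltW.
apply: le_trans (weight_mono wF t0 tT) _.
rewrite mulrAC ler_pdivlMr// ler_pM2l//.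
by apply: weight_mono wH _ _ _ t1.
Qed.

Section InverseOfScale.
Variable Phi : R -> R.
Hypothesis sPhi : scale_fun Phi.

Lemma scale_ge0 t : 0 <= t -> 0 <= Phi t.
Proof.
move=> t0; have [kap k0 E] := scale_linear sPhi.
by apply: le_trans (scale_mono sPhi (lexx 0) t0); rewrite E// mulr0.
Qed.

Lemma scale_unbounded v : exists2 T, 1 <= T & v < Phi T.
Proof.
have [kap k0 E] := scale_linear sPhi.
have [A [t0 [A1 t01 HA]]] := scale_growth sPhi.
have it k : 2 ^+ k * kap <= Phi (A ^+ k * t0).
  elim: k => [|k IH].
    rewrite !expr0 !mul1r; have <- : Phi 1 = kap by rewrite E// mulr1.
    exact: scale_mono.
  rewrite !exprS -!mulrA; apply: le_trans (HA _ _); first by rewrite ler_pM2l.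
  by rewrite ler_peMl ?exprn_ege1//; lra.
pose k := (Num.truncn (v / kap)).+1.
exists (A ^+ k * t0).
  by rewrite (le_trans t01)// ler_peMl ?exprn_ege1//; lra.
apply: lt_le_trans (it k); rewrite -ltr_pdivrMr//.
apply: (@lt_le_trans _ _ k%:R); first exact: truncnS_gt.
by rewrite -natrX ler_nat ltnW// ltn_expl.
Qed.

Lemma has_sup_scale v : 0 <= v -> has_sup [set t | 0 <= t /\ Phi t <= v].
Proof.
move=> v0; split.
  exists 0; split => //=; have [kap k0 E] := scale_linear sPhi.
  by rewrite E// mulr0.
have [T T1 vT] := scale_unbounded v; exists T => t [t0 tv].
rewrite leNgt; apply/negP => Tt; move: vT; rewrite ltNge => /negP; apply.
by apply: le_trans tv; apply: scale_mono => //; [lra|exact: ltW].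
Qed.

Lemma inv_incr_ge t v : 0 <= v -> 0 <= t -> Phi t <= v -> t <= inv_incr Phi v.
Proof. by move=> v0 t0 tv; apply: ub_le_sup => //; have [] := has_sup_scale v0. Qed.

Lemma inv_incr_lt t v : 0 <= v -> 0 <= t -> t < inv_incr Phi v -> Phi t <= v.
Proof.
move=> v0 t0 tv; have d : 0 < inv_incr Phi v - t by rewrite subr_gt0.
have [s [s0 sv]] := sup_adherent d (has_sup_scale v0).
rewrite -/(inv_incr Phi v) subKr => ts.
by apply: le_trans sv; apply: scale_mono => //; exact: ltW.
Qed.

(** Continuity is not part of [scale_fun], so the supremum in [inv_incr] need not be attained.
    Dividing by 2B instead of B puts the argument strictly below it, and quadratic growth pays for
    the factor. *)
Lemma scale_le_inv_incr n B t : 0 <= n -> 1 <= B -> 0 <= t ->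
  n <= B * inv_incr Phi t -> Phi n <= (2 * B) ^+ 2 * t.
Proof.
move=> n0 B1 t0 nB; have B0 : 0 < 2 * B by lra.
have [->|n1] := eqVneq n 0.
  have [kap k0 E] := scale_linear sPhi.
  by rewrite E// mulr0 mulr_ge0// sqr_ge0.
have np : 0 < n by rewrite lt_neqAle eq_sym n1.
have e : n = 2 * B * (n / (2 * B)) by field; lra.
have h0 : 0 <= n / (2 * B) by rewrite divr_ge0// ltW.
rewrite e; apply: le_trans (scale_quadratic sPhi _ h0) _; first by lra.
rewrite ler_wpM2l ?sqr_ge0//; apply: inv_incr_lt => //.
rewrite ltr_pdivrMr//; lra.
Qed.

Lemma inv_incr_unbounded : unbounded (inv_incr Phi).
Proof.
move=> M; pose m := Num.max M 0; pose v := Num.max 1 (Phi m).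
have m0 : 0 <= m by rewrite /m le_max lexx orbT.
have v1 : 1 <= v by rewrite /v le_max lexx.
exists v => //; apply: (@le_trans _ _ m); first by rewrite /m le_max lexx.
by apply: inv_incr_ge => //; [lra|rewrite /v le_max lexx orbT].
Qed.

Lemma weight_inv_incr : weight (inv_incr Phi).
Proof.
have [kap k0 E] := scale_linear sPhi.
have ge0 (t : R) : 0 <= t -> 0 <= inv_incr Phi t.
  by move=> t0; apply: inv_incr_ge => //; rewrite E// mulr0.
have le (v b : R) : 0 <= v -> (forall t, 0 <= t -> Phi t <= v -> t <= b) -> inv_incr Phi v <= b.
  move=> v0 H; apply: ge_sup; first by have [] := has_sup_scale v0.
  by move=> t [t0 tv]; exact: H.
have gt0 (t : R) : 1 <= t -> 0 < inv_incr Phi t.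
  move=> t1; pose x := Num.min 1 kap^-1.
  have x0 : 0 < x by rewrite lt_min ltr01 invr_gt0.
  apply: lt_le_trans (x0) _; apply: inv_incr_ge; [by lra|exact: ltW|].
  rewrite E ?(ltW x0)//; last by rewrite /x ge_min lexx.
  apply: le_trans t1; rewrite -ler_pdivlMl// mulr1 /x ge_min lexx orbT//.
have mono (s t : R) : 0 <= s -> s <= t -> inv_incr Phi s <= inv_incr Phi t.
  move=> s0 st; apply: le => // x x0 xs.
  by apply: inv_incr_ge => //; [exact: le_trans st|exact: le_trans st].
split => //.
(* If Phi(x) <= 2t and x / A >= t0, growth gives Phi(x / A) <= t, so x is at most A times the
   inverse at t. The remaining x are below A t0, which the value of the inverse at 1 absorbs. *)
- have [A [t0 [A1 t01 HA]]] := scale_growth sPhi.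
  have F1 := gt0 _ (lexx 1).
  have c0 : 0 <= A * t0 / inv_incr Phi 1 by rewrite divr_ge0 ?mulr_ge0//; lra.
  have A0 : 0 < A by lra.
  exists (A + A * t0 / inv_incr Phi 1); first by lra.
  move=> t t1; have tp : 0 <= t by lra.
  have Ft := ge0 _ tp; apply: le => [|x x0 xt]; first by lra.
  rewrite mulrDl; have [h|/ltW h] := leP t0 (x / A).
    apply: ler_wpDr; first exact: mulr_ge0.
    rewrite -ler_pdivrMl// mulrC; apply: inv_incr_ge => //; first by rewrite divr_ge0// ltW.
    have := HA _ h; have -> : A * (x / A) = x by field; lra.
    lra.
  apply: ler_wpDl; first by rewrite mulr_ge0//; lra.
  apply: le_trans (_ : A * t0 <= _); first by rewrite mulrC -ler_pdivrMr.
  rewrite -mulrA ler_peMr//; first by rewrite mulr_ge0//; lra.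
  rewrite mulrC ler_pdivlMr// mul1r; exact: mono.
- pose d := Num.min (kap / 2) kap.
  have d0 : 0 < d by rewrite lt_min k0 divr_gt0.
  exists d => // t tp td; apply: le => // x x0 xt.
  rewrite leNgt; apply/negP => x1.
  have := scale_mono sPhi ler01 (ltW x1); rewrite E// mulr1.
  have : d <= kap / 2 by rewrite /d ge_min lexx.
  lra.
Qed.

End InverseOfScale.
End Weights.

(** * Word length with respect to a symmetric finite set *)

Section WordLength.
Context (G : groupType) (T : seq G).
Hypothesis Tsym : forall s, s \in T -> (s^-1)%g \in T.

Lemma word_leW m n x : (m <= n)%N -> word_le T m x -> word_le T n x.
Proof.
move=> + w; elim: w n => [k|k s y sT _ IH] n; first by move=> _; exact: wl_one.
by case: n => // n; rewrite ltnS => /IH; exact: wl_cons.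
Qed.

Lemma word_leM m n x y : word_le T m x -> word_le T n y -> word_le T (m + n) (x * y)%g.
Proof.
move=> w wy; elim: w => [k|k s z sT _ IH].
  by rewrite mul1g; apply: word_leW wy; rewrite leq_addl.
by rewrite addSn -mulgA; exact: wl_cons.
Qed.

Lemma word_leV n x : word_le T n x -> word_le T n (x^-1)%g.
Proof.
elim=> [k|k s z sT _ IH]; first by rewrite invg1; exact: wl_one.
rewrite invgM -addn1; apply: word_leM => //.
by rewrite -[(s^-1)%g]mulg1; apply: wl_cons; [exact: Tsym|exact: wl_one].
Qed.

Lemma word_leX n x k : word_le T n x -> word_le T (n * k) (x ^+ k)%g.
Proof.
move=> w; elim: k => [|k IH]; first by rewrite muln0 expg0; exact: wl_one.
by rewrite mulnS expgS; exact: word_leM.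
Qed.

Lemma word_le_gen x : gen [set s | s \in T] x -> exists n, word_le T n x.
Proof.
elim=> [|a /= aT|y _ [n w]|y z _ [n w] _ [m w']].
- by exists 0%N; exact: wl_one.
- by exists 1%N; rewrite -[a]mulg1; apply: wl_cons => //; exact: wl_one.
- by exists n; exact: word_leV.
- by exists (n + m)%N; exact: word_leM.
Qed.

Lemma is_wlen_exists n x : word_le T n x -> exists2 k, (k <= n)%N & is_wlen T x k.
Proof.
move=> w; have ex : exists k, `[< word_le T k x >] by exists n; apply/asboolP.
exists (ex_minn ex); case: ex_minnP => k /asboolP wk kmin.
  by apply: kmin; apply/asboolP.
by split => // m wm; apply: kmin; apply/asboolP.
Qed.

Lemma word_le_in_gen n x : word_le T n x -> gen [set s | s \in T] x.
Proof.
elim=> [k|k s y sT _ IH]; first exact: gen_one.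
by apply: gen_mul => //; exact: gen_in.
Qed.

End WordLength.

Lemma sum_subseq_le (R : realType) (T : choiceType) (a : T -> \bar R) (s t : seq T) :
  (forall x, (0 <= a x)%E) -> uniq s -> uniq t -> {subset s <= t} ->
  (\sum_(x <- s) a x <= \sum_(x <- t) a x)%E.
Proof.
move=> a0 us ut st; pose b x := if x \in t then a x else 0%E.
have b0 x : (0 <= b x)%E by rewrite /b; case: ifP.
have bs : (\sum_(x <- s) a x = \sum_(x <- s) b x)%E.
  by apply: eq_big_seq => x /st; rewrite /b => ->.
have bt : (\sum_(x <- t) a x = \sum_(x <- t) b x)%E.
  by apply: eq_big_seq => x; rewrite /b => ->.
rewrite bs bt -(esum_finsupp ut b0); first exact: sum_le_esum.
by move=> x; rewrite /b => /negbTE ->.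
Qed.

(** * Displacement of the powers of a letter of H_i *)

Section PowersOfLetters.
Context (R : realType) (G : groupType) (mu nu : G -> R) (p : R) (T : seq G) (d : nat)
  (phi : R -> R) (gam c : R).
Hypotheses (mu0 : forall x, 0 <= mu x) (nu0 : forall x, 0 <= nu x)
  (p0 : 0 < p) (numu : forall x, p * nu x <= mu x)
  (Tsym : forall s, s \in T -> (s^-1)%g \in T) (Tgrowth : poly_growth R T d)
  (phi_pos : forall t : R, 0 <= t -> 0 < phi t)
  (phi_mono : forall s t : R, 0 <= s -> s <= t -> phi s <= phi t)
  (gam0 : 0 < gam) (phi_reg : regularly_varying phi gam) (c0 : 0 < c)
  (nu_ge : forall h n, gen [set s | s \in T] h -> is_wlen T h n ->
     c / (phi (1 + n%:R) * (1 + n%:R) ^+ d) <= nu h).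

Lemma ball_list : exists c1 c2 : R, [/\ 0 < c1, 0 < c2 & forall m, (0 < m)%N ->
  exists L : seq G, [/\ uniq L, (forall x, x \in L <-> word_le T m x),
    c1 * m%:R ^+ d <= (size L)%:R & (size L)%:R <= c2 * m%:R ^+ d]].
Proof.
have [c1 [c2 [c10 [c20 H]]]] := Tgrowth; exists c1, c2; split => // m m0.
have m1 : 1 <= m%:R :> R by rewrite ler1n.
have [N [[L [uL [LP sL]]] [h1 h2]]] := H _ m1.
exists L; split; rewrite ?sL// => x; split.
  by move=> /LP[n [nm w]]; apply: word_leW w; rewrite -(ler_nat R).
by move=> w; apply/LP; exists m.
Qed.

(** Average the factorisation h = g (g^-1 h) over an annulus with at least rho^d elements: both
    factors stay in a slightly wider annulus, on which nu is at least of order 1 / (phi(rho) rho^d).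
    The powers of rho cancel and phi(rho) remains. *)
Lemma annulus_disp : (0 < d)%N -> exists (kap : nat) (C : R), [/\ (1 < kap)%N, 0 < C &
  forall rho, (0 < rho)%N -> exists A : seq G,
    [/\ uniq A,
      (forall x, x \in A -> word_le T (kap * rho) x /\ ~ word_le T rho x) &
      forall h f, word_le T rho h ->
        (disp f h <= (C * phi rho%:R)%:E * \sum_(g <- A) (nu g)%:E * disp f g)%E]].
Proof.
move=> d0; have [c1 [c2 [c10 c20 balls]]] := ball_list.
(* The ball of radius k1 rho then has at least rho^d elements more than the ball of radius 2 rho.
   Since d > 0, k1 <= k1^d, so a choice linear in the ratio suffices. *)
pose k1 := (Num.truncn ((c2 * 2 ^+ d + 1) / c1)).+2.
have k1P : c2 * 2 ^+ d + 1 <= c1 * k1%:R ^+ d.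
  have h : (c2 * 2 ^+ d + 1) / c1 <= k1%:R.
    apply: ltW; apply: lt_le_trans (truncnS_gt ((c2 * 2 ^+ d + 1) / c1)) _.
    by rewrite ler_nat /k1 leqnSn.
  apply: le_trans (_ : c1 * k1%:R <= _); first by rewrite [c1 * _]mulrC -ler_pdivrMr.
  rewrite ler_pM2l// -{1}(expr1 k1%:R) ler_weXn2l// ler1n//.
pose kap := k1.+1.
(* [kap.+1] because [nu] is evaluated at 1 + n with n <= kap rho, and rho >= 1. *)
have [D D0 HD] := phi_doubling phi_pos phi_mono phi_reg (ler1n R kap.+1).
pose kd : R := kap.+1%:R ^+ d.
have kd0 : 0 < kd by rewrite exprn_gt0// ltr0n.
exists kap, (4 * (D * kd / c)); split; rewrite ?mulr_gt0 ?invr_gt0//.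
move=> rho r0; have rp : 0 < rho%:R :> R by rewrite ltr0n.
have prho : 0 < phi rho%:R by rewrite phi_pos// ltW.
have r20 : (0 < 2 * rho)%N by rewrite muln_gt0.
have [L1 [uL1 L1P _ L1u]] := balls _ r20.
have k1r : (0 < k1 * rho)%N by rewrite muln_gt0 r0.
have [L2 [uL2 L2P L2l _]] := balls _ k1r.
have kr : (0 < kap * rho)%N by rewrite muln_gt0 r0.
have [L3 [uL3 L3P _ _]] := balls _ kr.
have [L0 [uL0 L0P _ _]] := balls _ r0.
(* [A] keeps a margin rho on both sides inside [A'], so that g^-1 h stays in [A'] for g in [A] and h
   of length at most rho. *)
pose A := [seq x <- L2 | x \notin L1].
pose A' := [seq x <- L3 | x \notin L0].
have uA : uniq A by rewrite filter_uniq.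
have uA' : uniq A' by rewrite filter_uniq.
have sA : rho%:R ^+ d <= (size A)%:R :> R.
  have : (size L2 <= size A + size L1)%N.
    have e := count_predC (fun x => x \in L1) L2.
    have : (count (fun x => x \in L1) L2 <= size L1)%N.
      rewrite -size_filter; apply: uniq_leq_size; first by rewrite filter_uniq.
      by move=> y; rewrite mem_filter => /andP[].
    have -> : size A = count (predC (fun x => x \in L1)) L2 by rewrite size_filter.
    by rewrite -e addnC leq_add2l.
  rewrite -(ler_nat R) natrD => h.
  have rd : 0 <= rho%:R ^+ d :> R by rewrite exprn_ge0.
  move: L1u L2l; rewrite !natrM !exprMn => L1u L2l.
  have := ler_wpM2r rd k1P; lra.
exists A'; split => //.
  move=> x; rewrite mem_filter => /andP[x0 /L3P xk]; split => // w.
  by move/negP: x0; apply; apply/L0P.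
move=> h f wh.
have subA : {subset A <= A'}.
  move=> x; rewrite !mem_filter => /andP[x1 /L2P x2]; apply/andP; split.
    apply/negP => /L0P w; move/negP: x1; apply; apply/L1P.
    by apply: word_leW w; rewrite leq_pmull.
  by apply/L3P; apply: word_leW x2; rewrite leq_mul2r leqnSn orbT.
have subA2 : {subset [seq (g^-1 * h)%g | g <- A] <= A'}.
  move=> y /mapP[g]; rewrite mem_filter => /andP[g1 /L2P g2] ->.
  rewrite mem_filter; apply/andP; split.
    apply/negP => /L0P w; move/negP: g1; apply; apply/L1P.
    have -> : g = (h * (g^-1 * h)^-1)%g by rewrite invgM invgK mulVKg.
    by rewrite mul2n -addnn; apply: word_leM => //; exact: word_leV.
  apply/L3P; rewrite /kap mulSn addnC; apply: word_leM => //; exact: word_leV.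
have uA2 : uniq [seq (g^-1 * h)%g | g <- A].
  by rewrite map_inj_uniq// => x y /mulIg/invg_inj.
have dd g : (0 <= disp f g)%E by exact: disp_ge0.
have sum1 : ((size A)%:R%:E * disp f h <= 4%:E * \sum_(g <- A') disp f g)%E.
  rewrite -sume_const_seq.
  apply: le_trans (_ : _ <= \sum_(g <- A) 2%:E * (disp f g + disp f (g^-1 * h)%g))%E _.
    apply: lee_sum => g _; have := dispM f g (g^-1 * h)%g.
    by rewrite mulVKg.
  rewrite -ge0_sume_distrr; last by move=> g _; rewrite adde_ge0.
  rewrite big_split/= (_ : 4%:E = 2%:E * 2%:E)%E; last by rewrite -EFinM; congr (_%:E); ring.
  rewrite -muleA lee_pmul2l// [X in (_ <= X * _)%E](_ : _ = 1%:E + 1%:E)%E; last first.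
    by rewrite -EFinD.
  rewrite ge0_muleDl ?lee_fin// mul1e leeD//; first exact: sum_subseq_le.
  rewrite -(big_map (fun g => g^-1 * h)%g xpredT (disp f)).
  exact: sum_subseq_le.
have sum2 : (\sum_(g <- A') disp f g <=
   ((D * kd / c) * (phi rho%:R * rho%:R ^+ d))%:E * \sum_(g <- A') (nu g)%:E * disp f g)%E.
  rewrite ge0_sume_distrr; last by move=> g _; rewrite mule_ge0 ?lee_fin.
  rewrite big_seq [leRHS]big_seq; apply: lee_sum => g.
  rewrite mem_filter => /andP[g1 /L3P g3]; rewrite muleA -EFinM -[leLHS]mul1e.
  apply: lee_wpmul2r; rewrite // lee_fin.
  have [n nk wn] := is_wlen_exists g3.
  have low := nu_ge (word_le_in_gen g3) wn.
  have n1 : 1 + n%:R <= kap.+1%:R * rho%:R :> R.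
    by rewrite -natrM nat1r ler_nat mulSn -add1n leq_add.
  have n0 : 0 <= 1 + n%:R :> R by rewrite addr_ge0.
  have q1 : phi (1 + n%:R) * (1 + n%:R) ^+ d <= D * kd * (phi rho%:R * rho%:R ^+ d).
    rewrite mulrACA; apply: ler_pM.
    - exact/ltW/phi_pos.
    - by rewrite exprn_ge0.
    - by apply: le_trans (HD _ (ltW rp)); apply: phi_mono.
    - by rewrite /kd -exprMn; apply: lerXn2r; rewrite ?nnegrE//; apply: mulr_ge0.
  have q2 : 0 < phi (1 + n%:R) * (1 + n%:R) ^+ d.
    by apply: mulr_gt0; [exact: phi_pos|apply: exprn_gt0; rewrite ltr_pwDl].
  have q3 : 0 < D * kd * (phi rho%:R * rho%:R ^+ d) by apply: lt_le_trans q1.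
  apply: le_trans (_ : D * kd / c * (phi rho%:R * rho%:R ^+ d) *
     (c / (D * kd * (phi rho%:R * rho%:R ^+ d))) <= _).
    have z1 : c != 0 by rewrite gt_eqF.
    have z2 : D * kd * (phi rho%:R * rho%:R ^+ d) != 0 by rewrite gt_eqF.
    move: (phi rho%:R * rho%:R ^+ d) (D * kd) z2 => u v.
    rewrite mulf_eq0 negb_or => /andP[zv zu]; rewrite le_eqVlt; apply/orP; left; apply/eqP; field.
    by rewrite z1 zv zu.
  rewrite ler_wpM2l//.
    by rewrite mulrAC divr_ge0 ?(ltW q3)// ltW.
  apply: le_trans low; rewrite ler_wpM2l ?(ltW c0)// lef_pV2 ?posrE//.
have rd : 0 < rho%:R ^+ d :> R by rewrite exprn_gt0.
have S0 : (0 <= \sum_(g <- A') (nu g)%:E * disp f g)%E.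
  by apply: sume_ge0 => g _; rewrite mule_ge0 ?lee_fin.
have : ((rho%:R ^+ d)%:E * disp f h <= (rho%:R ^+ d)%:E *
   ((4 * (D * kd / c) * phi rho%:R)%:E * \sum_(g <- A') (nu g)%:E * disp f g))%E.
  apply: le_trans (_ : _ <= (size A)%:R%:E * disp f h)%E _.
    by apply: lee_wpmul2r => //; rewrite lee_fin.
  apply: le_trans sum1 _.
  apply: le_trans (lee_wpmul2l _ sum2) _ => //.
  rewrite !muleA -!EFinM lee_wpmul2r// lee_fin.
  by rewrite le_eqVlt; apply/orP; left; apply/eqP; ring.
by rewrite lee_pmul2l.
Qed.

(** In degree 0 the balls have bounded size, so by the pigeonhole principle two powers of [s]
    coincide and [s] has finite order. This case is separate because the annulus argument needs d >
    0. *)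
Lemma torsion_letter s (K0 : R) : d = 0%N -> gen [set t | t \in T] s ->
  0 <= K0 -> small mu K0 s -> exists2 K, 0 <= K & forall n, small mu K (s ^+ n)%g.
Proof.
move=> d0 /(word_le_gen Tsym)[lam ws] K00 sK.
have [c1 [c2 [c10 c20 balls]]] := ball_list.
pose N := (Num.truncn c2).+1; pose pw := [seq (s ^+ i)%g | i <- iota 0 N].
have npw : ~~ uniq pw.
  apply/negP => upw; have [|L [_ LP _ Lu]] := balls (lam * N).+1; first by [].
  have : (size pw <= size L)%N.
    apply: uniq_leq_size => // x /mapP[i]; rewrite mem_iota => /andP[_ iN] ->.
    apply/LP; apply: word_leW (word_leX i ws).
    by apply: (@leq_trans (lam * N)%N) => //; rewrite leq_mul2l ltnW// orbT.
  rewrite size_map size_iota -(ler_nat R) => h.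
  have := le_trans h Lu; rewrite d0 expr0 mulr1 leNgt => /negP; apply.
  exact: truncnS_gt.
have [q q0 sq] : exists2 q, (0 < q)%N & (s ^+ q = 1)%g.
  have [i [j [ij]]] := uniqPn 1%g npw; rewrite size_map size_iota => jN.
  have iN := ltn_trans ij jN.
  rewrite !(nth_map 0%N) ?size_iota// !nth_iota// !add0n => e.
  exists (j - i)%N; first by rewrite subn_gt0.
  apply: (mulgI (s ^+ i)%g); rewrite -expgnDr mulg1 subnKC// ltnW//.
exists (q%:R ^+ 2 * K0); first by rewrite mulr_ge0// sqr_ge0.
move=> n; have -> : (s ^+ n = s ^+ (n %% q))%g.
  by rewrite {1}(divn_eq n q) expgnDr mulnC expgnA sq expg1n mul1g.
apply: small_le (smallX (n %% q) K00 sK) => //.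
by rewrite ler_wpM2r// lerXn2r ?nnegrE// ler_nat ltnW// ltn_pmod.
Qed.

(* The displacement of s^n is estimated at every scale kap^j <= n by the part of the
   Dirichlet form living on the j-th annulus; summing over the disjoint annuli
   gains the factor I(n) over the single-scale bound phi(n). *)
Lemma letter_powers s (K0 : R) : gen [set t | t \in T] s -> 0 <= K0 -> small mu K0 s ->
  exists2 C : R, 0 < C & forall n, small mu (C * PhiReg phi n%:R) (s ^+ n)%g.
Proof.
move=> Ts K00 sK.
have sc : scale_fun (PhiReg phi) := scale_PhiReg phi_pos phi_mono gam0 phi_reg.
have I0 := PhiInt_gt0 phi_pos phi_mono.
have E1 : PhiReg phi 1 = (PhiInt phi 1)^-1 by rewrite /PhiReg lexx expr1n div1r.
have P1 : 0 < PhiReg phi 1 by rewrite E1 invr_gt0 I0.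
have [d0|d0] := posnP d.
  have [K K0' sn] := torsion_letter d0 Ts K00 sK.
  exists ((K + 1) / PhiReg phi 1); first by rewrite divr_gt0// ltr_wpDl.
  case=> [|n].
    rewrite expg0; apply: small1 => //; rewrite mulr_ge0//.
      by rewrite divr_ge0 ?addr_ge0// ltW.
    exact: scale_ge0 sc _ _.
  apply: small_le (sn n.+1) => //.
  rewrite mulrAC ler_pdivlMr//; apply: ler_pM => //; rewrite ?(ltW P1)//.
    by rewrite lerDl.
  by apply: scale_mono sc _ _ _ _ => //; rewrite ler1n.
have [kap [C [kap1 C0 ann]]] := annulus_disp d0.
have /(word_le_gen Tsym)[lam' ws'] := Ts; pose lam := lam'.+1.
have ws : word_le T lam s by apply: word_leW ws'.
have lam1 : 1 <= lam%:R :> R by rewrite ler1n.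
have [D D0 HD] := phi_doubling phi_pos phi_mono phi_reg lam1.
(* Powers of [s] up to [kap ^ j] have length at most [rho j]. As consecutive radii differ by the
   factor [kap], the outer radius of one annulus is the inner radius of the next, and the annuli are
   disjoint. *)
pose rho j := (lam * kap ^ j)%N.
have kj0 j : (0 < kap ^ j)%N by rewrite expn_gt0 (ltn_trans _ kap1).
have rho0 j : (0 < rho j)%N by rewrite /rho muln_gt0 kj0.
have prho j : 0 < phi (rho j)%:R by apply: phi_pos.
have annj j := ann _ (rho0 j).
have [A HA] := choice annj.
pose S f j := (\sum_(g <- A j) (nu g)%:E * disp f g)%E.
have S0 f j : (0 <= S f j)%E.
  by apply: sume_ge0 => g _; rewrite mule_ge0 ?lee_fin ?disp_ge0.
(* With n = q k + r and k = kap^j, the displacement costs 2 (q^2 + 1) <= 4 q^2 times the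
   single-scale bound, and q k <= n. The weight k^2 / phi(rho j) is, up to a constant, the share of
   scale k in the integral I(n). *)
have single f n j : (kap ^ j <= n)%N ->
    (((kap ^ j)%:R ^+ 2 / phi (rho j)%:R)%:E * disp f (s ^+ n)%g <=
     (4 * C * n%:R ^+ 2)%:E * S f j)%E.
  move=> kn; have [_ _ hA] := HA j.
  set k := (kap ^ j)%N in kn *; have k0 : (0 < k)%N by exact: kj0.
  have kR : 0 < k%:R :> R by rewrite ltr0n.
  have hk : (disp f (s ^+ k)%g <= (C * phi (rho j)%:R)%:E * S f j)%E.
    by apply: hA; exact: word_leX.
  have hr : (disp f (s ^+ (n %% k))%g <= (C * phi (rho j)%:R)%:E * S f j)%E.
    apply: hA; apply: word_leW (word_leX _ ws).
    by rewrite /rho leq_mul2l (ltnW (ltn_pmod n k0)) orbT.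
  pose q := (n %/ k)%N.
  have q1 : (0 < q)%N by rewrite divn_gt0.
  have Cp : 0 <= C * phi (rho j)%:R by rewrite mulr_ge0// ltW.
  have X0 : (0 <= (C * phi (rho j)%:R)%:E * S f j)%E by rewrite mule_ge0// lee_fin.
  have qr : 0 <= q%:R ^+ 2 :> R by rewrite sqr_ge0.
  have hn : (disp f (s ^+ n)%g <= (4 * q%:R ^+ 2)%:E * ((C * phi (rho j)%:R)%:E * S f j))%E.
    rewrite {1}(divn_eq n k) expgnDr mulnC expgnA -/q.
    apply: le_trans (dispM _ _ _) _.
    apply: le_trans (_ : _ <= 2%:E * ((q%:R ^+ 2)%:E * ((C * phi (rho j)%:R)%:E * S f j) +
        (C * phi (rho j)%:R)%:E * S f j))%E _.
      rewrite lee_pmul2l//; apply: leeD => //.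
      apply: le_trans (dispX _ _ _) _; apply: lee_wpmul2l => //.
    rewrite -[X in (_ + X)%E]mul1e -ge0_muleDl ?lee_fin//.
    rewrite muleA -EFinM; apply: lee_wpmul2r => //.
    have q1R : 1 <= q%:R :> R by rewrite ler1n.
    rewrite lee_fin; nra.
  have w0 : 0 <= k%:R ^+ 2 / phi (rho j)%:R by rewrite divr_ge0 ?sqr_ge0// ltW.
  apply: le_trans (lee_wpmul2l _ hn) _; first by rewrite lee_fin.
  rewrite !muleA -!EFinM; apply: lee_wpmul2r => //; rewrite lee_fin.
  have -> : k%:R ^+ 2 / phi (rho j)%:R * (4 * q%:R ^+ 2) * (C * phi (rho j)%:R) =
      4 * C * (q * k)%:R ^+ 2.
    have pn : phi (rho j)%:R != 0 by rewrite gt_eqF.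
    by rewrite natrM; field.
  rewrite ler_wpM2l ?mulr_ge0 ?(ltW C0)// lerXn2r ?nnegrE//.
  by rewrite ler_nat leq_trunc_div.
have total f J : (\sum_(j < J) S f j <= (2 / p)%:E * dirichlet mu f)%E.
  pose L := flatten [seq A j | j <- iota 0 J].
  have uL : uniq L /\ forall x, x \in L -> word_le T (rho J) x.
    rewrite /L; elim: J {L} => [|J [IHu IHw]]; first by [].
    rewrite -addn1 iotaD map_cat flatten_cat/= add0n cats0.
    have [uA AP _] := HA J; split.
      rewrite cat_uniq IHu uA andbT; apply/hasPn => x /AP[_ nx].
      by apply/negP => /IHw.
    move=> x; rewrite mem_cat => /orP[/IHw w|/AP[w _]].
      by apply: word_leW w; rewrite /rho leq_mul2l leq_pexp2l ?orbT// ?addn1 ?(ltnW kap1).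
    by rewrite /rho addn1 expnS mulnCA.
  have -> : (\sum_(j < J) S f j = \sum_(g <- L) (nu g)%:E * disp f g)%E.
    by rewrite /L big_flatten/= big_map -(big_mkord xpredT (S f)) /index_iota subn0.
  have h := sum_disp_le_dirichlet f mu0 uL.1.
  have h2 : (p%:E * \sum_(g <- L) (nu g)%:E * disp f g <= 2%:E * dirichlet mu f)%E.
    apply: le_trans h; rewrite ge0_sume_distrr; last first.
      by move=> g _; rewrite mule_ge0 ?lee_fin ?disp_ge0.
    apply: lee_sum => g _; rewrite muleA -EFinM; apply: lee_wpmul2r; first exact: disp_ge0.
    by rewrite lee_fin.
  have pi : (0 <= p^-1%:E :> \bar R)%E by rewrite lee_fin invr_ge0 ltW.
  have := lee_wpmul2l pi h2; rewrite muleA -EFinM mulVf ?gt_eqF// mul1e.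
  by rewrite muleA -EFinM [_ / p]mulrC.
(* The first summand handles the increments of I between consecutive powers of [kap]; the second
   lets the term j = 0 dominate the initial piece I(1). *)
pose K1 : R := kap%:R ^+ 2 * D + PhiInt phi 1 * phi (rho 0%N)%:R.
have kR : 1 <= kap%:R :> R by rewrite ler1n ltnW.
have K10 : 0 < K1.
  by rewrite /K1 ltr_wpDl ?mulr_ge0 ?sqr_ge0 ?(ltW D0)// mulr_gt0 ?I0.
have Ibound J : PhiInt phi (kap ^ J)%:R <=
   K1 * \sum_(j < J) ((kap ^ j)%:R ^+ 2 / phi (rho j)%:R) + PhiInt phi 1.
  elim: J => [|J IH]; first by rewrite big_ord0 mulr0 add0r expn0.
  have kk : (kap ^ J)%:R <= (kap ^ J.+1)%:R :> R by rewrite ler_nat leq_exp2l.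
  have /andP[_] := PhiInt_bounds phi_pos phi_mono (ler0n R (kap ^ J)) kk.
  rewrite big_ord_recr/= mulrDr => h.
  have h2 : ((kap ^ J.+1)%:R ^+ 2 - (kap ^ J)%:R ^+ 2) / phi (kap ^ J)%:R <=
     K1 * ((kap ^ J)%:R ^+ 2 / phi (rho J)%:R).
    have pk : 0 < phi (kap ^ J)%:R by apply: phi_pos.
    have h3 : phi (rho J)%:R <= D * phi (kap ^ J)%:R by rewrite /rho natrM HD.
    rewrite ler_pdivrMr// mulrA mulrAC ler_pdivlMr//.
    have x0 : 0 <= (kap ^ J)%:R ^+ 2 :> R by rewrite sqr_ge0.
    apply: le_trans (_ : (kap ^ J.+1)%:R ^+ 2 * phi (rho J)%:R <= _).
      by rewrite ler_wpM2r ?(ltW (prho J))// lerBlDr lerDl.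
    rewrite expnS natrM exprMn.
    apply: le_trans (_ : kap%:R ^+ 2 * (kap ^ J)%:R ^+ 2 * (D * phi (kap ^ J)%:R) <= _).
      by rewrite ler_wpM2l// mulr_ge0 ?sqr_ge0.
    rewrite [leLHS](_ : _ = (kap%:R ^+ 2 * D) * ((kap ^ J)%:R ^+ 2 * phi (kap ^ J)%:R)); last by ring.
    rewrite -[leRHS]mulrA; apply: ler_wpM2r; first by rewrite mulr_ge0// ltW.
    by rewrite lerDl mulr_ge0// ltW// I0.
  lra.
have I1le J : (0 < J)%N -> PhiInt phi 1 <= K1 * \sum_(j < J) ((kap ^ j)%:R ^+ 2 / phi (rho j)%:R).
  case: J => // J _; rewrite big_ord_recl/= expn0 expr1n div1r.
  apply: le_trans (_ : K1 * (phi (rho 0%N)%:R)^-1 <= _).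
    rewrite -ler_pdivrMr ?invr_gt0// invrK /K1 lerDr mulr_ge0 ?sqr_ge0// ltW//.
  rewrite ler_wpM2l ?(ltW K10)// lerDl sumr_ge0// => j _.
  by rewrite divr_ge0 ?sqr_ge0// ltW.
exists (2 * K1 * (4 * C) * (2 / p)).
  by rewrite !mulr_gt0// invr_gt0.
case=> [|n] f.
  rewrite expg0 disp1 mule_ge0 ?dirichlet_ge0// lee_fin mulr_ge0//; last first.
    exact: scale_ge0 sc _ _.
  by rewrite !mulr_ge0 ?invr_ge0 ?(ltW K10) ?(ltW C0) ?(ltW p0).
set m := n.+1; have m1 : 1 <= m%:R :> R by rewrite ler1n.
have Im : 0 < PhiInt phi m%:R by rewrite I0// ltr0n.
pose J := (trunc_log kap m).+1.
have /andP[Jl Ju] := @trunc_log_bounds kap m kap1 isT.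
pose Sg := \sum_(j < J) ((kap ^ j)%:R ^+ 2 / phi (rho j)%:R).
have Sg0 : 0 <= Sg by apply: sumr_ge0 => j _; rewrite divr_ge0 ?sqr_ge0// ltW.
have ImS : PhiInt phi m%:R <= 2 * K1 * Sg.
  have : PhiInt phi m%:R <= PhiInt phi (kap ^ J)%:R.
    by apply: PhiInt_mono => //; rewrite ler_nat ltnW.
  have := Ibound J; have := I1le J isT; rewrite -/Sg; lra.
have key : (Sg%:E * disp f (s ^+ m)%g <=
     (4 * C * m%:R ^+ 2 * (2 / p))%:E * dirichlet mu f)%E.
  rewrite -sumEFin ge0_sume_distrl; last first.
    by move=> j _; rewrite lee_fin divr_ge0 ?sqr_ge0// ltW.
  apply: le_trans (_ : _ <= \sum_(j < J) (4 * C * m%:R ^+ 2)%:E * S f j)%E _.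
    apply: lee_sum => j _; apply: single.
    by apply: leq_trans Jl; rewrite leq_exp2l// -ltnS.
  rewrite -ge0_sume_distrr// (EFinM (4 * C * m%:R ^+ 2)) -muleA.
  apply: lee_wpmul2l (total f J).
  by rewrite lee_fin !mulr_ge0 ?sqr_ge0// ltW.
have -> : PhiReg phi m%:R = m%:R ^+ 2 / PhiInt phi m%:R by rewrite /PhiReg m1.
have : ((PhiInt phi m%:R)%:E * disp f (s ^+ m)%g <=
    (2 * K1)%:E * ((4 * C * m%:R ^+ 2 * (2 / p))%:E * dirichlet mu f))%E.
  apply: le_trans (_ : _ <= (2 * K1)%:E * (Sg%:E * disp f (s ^+ m)%g))%E _.
    by rewrite muleA -EFinM; apply: lee_wpmul2r; [exact: disp_ge0|rewrite lee_fin].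
  by apply: lee_wpmul2l => //; rewrite lee_fin mulr_ge0// ltW.
have Ii : (0 <= (PhiInt phi m%:R)^-1%:E :> \bar R)%E by rewrite lee_fin invr_ge0 ltW.
move/(lee_wpmul2l Ii); rewrite muleA -EFinM mulVf ?gt_eqF// mul1e => h.
apply: le_trans h _; move: (dirichlet mu f) (dirichlet_ge0 f mu0) => E E0.
rewrite !muleA -!EFinM; apply: lee_wpmul2r; first exact: E0.
by rewrite lee_fin le_eqVlt; apply/orP; left; apply/eqP; ring.
Qed.

End PowersOfLetters.

(** * Congruence modulo a normal subgroup *)

Section NormalSubgroups.
Context (G : groupType).
Implicit Types (M A B : set G) (x y z : G).

Record normal_sub M : Prop := NormalSub {
  nsub1 : M 1%g;
  nsubM : forall x y, M x -> M y -> M (x * y)%g;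
  nsubV : forall x, M x -> M (x^-1)%g;
  nsubJ : forall x y, M x -> M (x ^ y)%g }.

Definition cong M x y := M (x^-1 * y)%g.

Section Cong.
Variable M : set G.
Hypothesis nM : normal_sub M.

Lemma cong_refl x : cong M x x.
Proof. by rewrite /cong mulVg; apply: nsub1 nM. Qed.

Lemma cong_sym x y : cong M x y -> cong M y x.
Proof. by move=> /(nsubV nM); rewrite /cong invgM invgK. Qed.

Lemma cong_trans y x z : cong M x y -> cong M y z -> cong M x z.
Proof. by move=> h1 /(nsubM nM h1); rewrite /cong mulgA mulgK. Qed.

Lemma congM x y x' y' : cong M x y -> cong M x' y' -> cong M (x * x')%g (y * y')%g.
Proof.
move=> /(nsubJ nM)-/(_ x') h1 h2; have := nsubM nM h1 h2.
by rewrite /cong /conjg invgM !mulgA mulgK.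
Qed.

Lemma congV x y : cong M x y -> cong M (x^-1)%g (y^-1)%g.
Proof.
move=> /cong_sym /(nsubJ nM)-/(_ (y^-1)%g).
by rewrite /cong /conjg !invgK !mulgA mulgV mul1g.
Qed.

Lemma cong1 x : M x -> cong M x 1%g.
Proof. by move=> h; rewrite /cong mulg1; apply: (nsubV nM). Qed.

Lemma cong_mem x y : cong M x y -> M x -> M y.
Proof. by move=> h /nsubM-/(_ nM _ h); rewrite mulVKg. Qed.

Lemma cong_commute x y : M [~ x, y]%g -> cong M (y * x)%g (x * y)%g.
Proof. by rewrite /cong /commg /conjg invgM !mulgA. Qed.

Lemma cong_conj x y : M [~ x, y]%g -> cong M x (x ^ y)%g.
Proof. by []. Qed.

Lemma nsub_commV x y : M [~ x, y]%g -> M [~ y, x]%g.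
Proof. by move=> h; rewrite -invgR; apply: (nsubV nM). Qed.

Lemma nsub_commMl x x' y : M [~ x, y]%g -> M [~ x', y]%g -> M [~ x * x', y]%g.
Proof.
move=> h h'; have -> : ([~ x * x', y] = [~ x, y] ^ x' * [~ x', y])%g.
  by rewrite /commg /conjg !invgM !mulgA !(mulgK, mulgVK).
by apply: (nsubM nM) => //; apply: (nsubJ nM).
Qed.

Lemma nsub_commVl x y : M [~ x, y]%g -> M [~ x^-1, y]%g.
Proof.
move=> h; have -> : ([~ x^-1, y] = ([~ x, y]^-1) ^ x^-1)%g.
  by rewrite /commg /conjg !invgM !invgK !mulgA !(mulgK, mulgVK).
by apply: (nsubJ nM); apply: (nsubV nM).
Qed.

Lemma nsub_comm_gen A B x y : (forall a b, A a -> B b -> M [~ a, b]%g) ->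
  gen A x -> gen B y -> M [~ x, y]%g.
Proof.
move=> AB gx gy.
have gxb b : B b -> M [~ x, b]%g.
  move=> Bb; elim: gx => [|a Aa|z _ IH|z z' _ IH _ IH'].
  - by rewrite comm1g; exact: nsub1.
  - exact: AB.
  - exact: nsub_commVl.
  - exact: nsub_commMl.
apply: nsub_commV; elim: gy => [|b Bb|z _ IH|z z' _ IH _ IH'].
- by rewrite comm1g; exact: nsub1.
- by apply: nsub_commV; exact: gxb.
- exact: nsub_commVl.
- exact: nsub_commMl.
Qed.

(** Modulo [M] the elements of [Z] are central, so the conjugations in the identities for
    commutators of products disappear and the commutator becomes bilinear on powers. *)
Lemma cong_commX Z x y a q : (forall z g, Z z -> M [~ z, g]%g) ->
  (forall i j, Z [~ (x ^+ i)%g, (y ^+ j)%g]%g) ->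
  cong M [~ (x ^+ a)%g, (y ^+ q)%g]%g ([~ x, y] ^+ (a * q))%g.
Proof.
move=> Zc Zxy.
have right j : cong M [~ x, (y ^+ j)%g]%g ([~ x, y] ^+ j)%g.
  elim: j => [|j IH]; first by rewrite !expg0 commg1; exact: cong_refl.
  have -> : ([~ x, y ^+ j.+1] = [~ x, y ^+ j] * [~ x, y] ^ (y ^+ j))%g.
    by rewrite expgS /commg /conjg !invgM !mulgA !(mulgK, mulgVK).
  rewrite expgSr; apply: congM => //; apply: cong_sym; apply: cong_conj; apply: Zc.
  by have := Zxy 1%N 1%N; rewrite !expg1.
elim: a => [|a IH]; first by rewrite mul0n !expg0 comm1g; exact: cong_refl.
have -> : ([~ x ^+ a.+1, y ^+ q] = [~ x, y ^+ q] ^ (x ^+ a) * [~ x ^+ a, y ^+ q])%g.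
  by rewrite expgS /commg /conjg !invgM !mulgA !(mulgK, mulgVK).
rewrite mulSn expgnDr; apply: congM => //.
apply: cong_trans (right q); apply: cong_sym; apply: cong_conj; apply: Zc.
by have := Zxy 1%N q; rewrite expg1.
Qed.

End Cong.

Lemma gen_subset A B : (forall a, A a -> B a) -> forall x, gen A x -> gen B x.
Proof.
move=> AB x; elim=> [|a Aa|y _|y z _ gy _ gz].
- exact: gen_one.
- by apply: gen_in; exact: AB.
- exact: gen_inv.
- exact: gen_mul.
Qed.

(** Conjugation by [s] might map the subgroup into itself without being onto, so the induction on
    the conjugating element carries its inverse along. *)
Lemma normal_gen A (S : set G) : (forall x, gen S x) ->
  (forall a s, A a -> S s -> gen A (a ^ s)%g /\ gen A (a ^ s^-1)%g) -> normal_sub (gen A).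
Proof.
move=> genS AS; split; [exact: gen_one|exact: gen_mul|exact: gen_inv|].
have conj (y : G) : (forall a, A a -> gen A (a ^ y)%g) -> forall x, gen A x -> gen A (x ^ y)%g.
  move=> Ay x; elim=> [|a /Ay//|z _|z z' _ h _ h'].
  - by rewrite conj1g; exact: gen_one.
  - by rewrite conjVg; exact: gen_inv.
  - by rewrite conjMg; exact: gen_mul.
suff H y : (forall x, gen A x -> gen A (x ^ y)%g) /\ (forall x, gen A x -> gen A (x ^ y^-1)%g).
  by move=> x y; apply: (H y).1.
elim: (genS y) => [|s Ss|z _ [h1 h2]|z z' _ [h1 h2] _ [h1' h2']].
- by rewrite invg1; split=> x; rewrite conjg1.
- by split; apply: conj => a Aa; have [] := AS _ _ Aa Ss.
- by split; rewrite ?invgK.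
- split=> x gx; first by rewrite conjgM; apply: h1'; exact: h1.
  by rewrite invgM conjgM; apply: h2; exact: h2'.
Qed.

End NormalSubgroups.

(** * Weights and powers of formal commutators *)

Section CommutatorPowers.
Context (R : realType) (G : groupType) (mu : G -> R) (Sig : seq G) (Fw : G -> R -> R).
Notation W := (@fweight R G Sig Fw).
Notation ev := (@feval G Sig).
Implicit Types (c : fcomm (size Sig)).
Hypotheses (mu0 : forall x, 0 <= mu x) (genSig : forall x, gen [set s | s \in Sig] x)
  (wFw : forall s, s \in Sig -> weight (Fw s))
  (uFw : forall s, s \in Sig -> unbounded (Fw s))
  (small_letters : forall s (B : R), s \in Sig -> 1 <= B -> exists2 K : R, 0 <= K &
    forall (t : R) (n : nat), 1 <= t -> n%:R <= B * Fw s t -> small mu (K * t) (s ^+ n)%g).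

Lemma weight_fcomm c : weight (W c).
Proof.
elim: c => [j b|c1 w1 c2 w2] /=; first by apply: wFw; exact: mem_nth.
exact: weight_mul.
Qed.

Lemma unbounded_fcomm c : unbounded (W c).
Proof.
elim: c => [j b|c1 u1 c2 _] /=; first by apply: uFw; exact: mem_nth.
have w1 := weight_fcomm c1; have w2 := weight_fcomm c2 => M.
have p2 := weight_gt0 w2 (lexx 1).
have [t t1 Mt] := u1 (Num.max M 0 / W c2 1); exists t => //.
apply: (@le_trans _ _ (Num.max M 0)); first by rewrite le_max lexx.
rewrite -(@divfK _ (W c2 1) _ (Num.max M 0)) ?gt_eqF//.
apply: ler_pM => //; first by rewrite divr_ge0 ?le_max ?lexx ?orbT ?(ltW p2).
  exact: ltW.
by apply: weight_mono w2 _ _ _ t1.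
Qed.

Definition fle c c' := preceq_inf (W c) (W c').
Definition flt c c' := prec_strict_inf (W c) (W c').

Lemma fleP c c' : fle c c' <->
  exists2 C : R, 0 < C & forall t : R, 1 <= t -> W c t <= C * W c' t.
Proof. exact: weight_preceqP (weight_fcomm c) (weight_fcomm c'). Qed.

Lemma fle_refl c : fle c c.
Proof. by apply/fleP; exists 1 => // t _; rewrite mul1r. Qed.

Lemma fle_trans c' c c'' : fle c c' -> fle c' c'' -> fle c c''.
Proof.
move=> /fleP[C C0 H] /fleP[D D0 H']; apply/fleP; exists (C * D); first exact: mulr_gt0.
move=> t t1; apply: le_trans (H t t1) _; rewrite -mulrA ler_pM2l//; exact: H'.
Qed.

Lemma fle_lt_trans c' c c'' : fle c c' -> flt c' c'' -> flt c c''.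
Proof.
move=> h [h1 h2]; split; first exact: fle_trans h1.
by move=> h3; apply: h2; exact: fle_trans h.
Qed.

Lemma flt_le_trans c' c c'' : flt c c' -> fle c' c'' -> flt c c''.
Proof.
move=> [h1 h2] h; split; first exact: fle_trans h.
by move=> h3; apply: h2; exact: fle_trans h3.
Qed.

Lemma fle_com c1 c2 c1' c2' : fle c1 c1' -> fle c2 c2' -> fle (FCom c1 c2) (FCom c1' c2').
Proof.
move=> /fleP[C C0 H] /fleP[D D0 H']; apply/fleP; exists (C * D); first exact: mulr_gt0.
move=> t t1 /=; rewrite mulrACA; have t0 : 0 <= t by lra.
by apply: ler_pM; rewrite ?H ?H' ?(weight_ge0 (weight_fcomm _)).
Qed.

Lemma fle_comC c1 c2 : fle (FCom c1 c2) (FCom c2 c1).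
Proof. by apply/fleP; exists 1 => // t _ /=; rewrite mul1r mulrC. Qed.

(* Cancelling the common factor W c2 uses that, all weights being doubling,
   the rescaling of t in preceq can be absorbed in the constant. *)
Lemma flt_coml c1 c2 c1' c2' : flt c1 c1' -> fle c2 c2' -> flt (FCom c1 c2) (FCom c1' c2').
Proof.
move=> [h1 h2] h; split; first exact: fle_com.
move=> /fleP[C C0 H]; apply: h2; move: h => /fleP[D D0 H']; apply/fleP.
exists (C * D); first exact: mulr_gt0.
move=> t t1; have t0 : 0 <= t by lra.
have p2 := weight_gt0 (weight_fcomm c2') t1.
rewrite -(ler_pM2r p2); apply: le_trans (H t t1) _ => /=.
rewrite [leRHS](_ : _ = C * (W c1 t * (D * W c2' t))); last by ring.
by rewrite ler_pM2l// ler_wpM2l ?H' ?(weight_ge0 (weight_fcomm _)).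
Qed.

Lemma flt_comr c1 c2 c1' c2' : fle c1 c1' -> flt c2 c2' -> flt (FCom c1 c2) (FCom c1' c2').
Proof.
move=> h h'; apply: fle_lt_trans (fle_comC _ _) _.
by apply: flt_le_trans (fle_comC _ _); exact: flt_coml.
Qed.

(** Strictness rests on the unboundedness of the weights: a reverse comparison would bound the
    weight of [c']. *)
Lemma flt_com c c' : flt c (FCom c c').
Proof.
have w := weight_fcomm c; have w' := weight_fcomm c'; split.
  have p := weight_gt0 w' (lexx 1).
  apply/fleP; exists (W c' 1)^-1; first by rewrite invr_gt0.
  move=> t t1 /=; have t0 : 0 <= t by lra.
  rewrite mulrC -mulrA ler_peMr ?(weight_ge0 w)// ler_pdivlMr// mul1r.
  by apply: weight_mono w' _ _ _ t1.
move=> /fleP[C C0 H]; have [t t1 Ct] := unbounded_fcomm c' (C + 1).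
have := H t t1 => /=; rewrite mulrC ler_pM2r ?(weight_gt0 w)//; lra.
Qed.

Definition Ngen (P : fcomm (size Sig) -> Prop) := gen [set g | exists c, P c /\ g = ev c].

(** A conjugate g^s is g [g, s], and [g, s] is again the value of a formal commutator. The inverse
    letters take care of conjugation by s^-1. *)
Lemma normal_Ngen P : (forall c c', P c -> P (FCom c c')) -> normal_sub (Ngen P).
Proof.
move=> PF; apply: (@normal_gen _ _ [set s | s \in Sig]) => // _ s [c [Pc ->]] /= sS.
have hs : (index s Sig < size Sig)%N by rewrite index_mem.
have es : nth 1%g Sig (Ordinal hs) = s by rewrite nth_index.
have key b y : ev (FLet (Ordinal hs) b) = y -> Ngen P (ev c ^ y)%g.
  move=> <-; have -> : forall g h : G, (g ^ h = g * [~ g, h])%g by move=> g h; rewrite mulVKg.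
  apply: gen_mul; apply: gen_in; first by exists c.
  exists (FCom c (FLet (Ordinal hs) b)); split => //; exact: PF.
by split; [apply: (key false)|apply: (key true)]; rewrite /= es.
Qed.

Lemma normal_ge c : normal_sub (Ngen (fle c)).
Proof. by apply: normal_Ngen => c1 c2 h; have [h1 _] := flt_com c1 c2; exact: fle_trans h1. Qed.

Lemma normal_gt c : normal_sub (Ngen (flt c)).
Proof.
by apply: normal_Ngen => c1 c2 h; have [h1 _] := flt_com c1 c2; exact: flt_le_trans h1.
Qed.

Lemma Ngen_com (P1 P2 P : fcomm (size Sig) -> Prop) x y : normal_sub (Ngen P) ->
  (forall c c', P1 c -> P2 c' -> P (FCom c c')) ->
  Ngen P1 x -> Ngen P2 y -> Ngen P [~ x, y]%g.
Proof.
move=> nP H; apply: nsub_comm_gen => // _ _ [c [P1c ->]] [c' [P2c ->]].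
by apply: gen_in; exists (FCom c c'); split => //; exact: H.
Qed.

Lemma Ngen_central c (P : fcomm (size Sig) -> Prop) x y : normal_sub (Ngen P) ->
  (forall c' c'', fle c c' -> P (FCom c' c'')) -> Ngen (fle c) x -> Ngen P [~ x, y]%g.
Proof.
move=> nP H gx; apply: (nsub_comm_gen nP _ gx (genSig y)) => _ s [c' [cc' ->]] /= sS.
have hs : (index s Sig < size Sig)%N by rewrite index_mem.
have es : nth 1%g Sig (Ordinal hs) = s by rewrite nth_index.
by apply: gen_in; exists (FCom c' (FLet (Ordinal hs) false)); rewrite /= es; split => //; exact: H.
Qed.

(** Write x = c1^a u and y = c2^q v with u, v of larger weight. Commutators involving u or v lie
    above [FCom c1 c2] in weight, and those of weight at least [FCom c1 c2] are central modulo such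
    elements, so [cong_commX] computes what is left. *)
Lemma cong_com c1 c2 x y a q :
  cong (Ngen (flt c1)) (ev c1 ^+ a)%g x -> cong (Ngen (flt c2)) (ev c2 ^+ q)%g y ->
  cong (Ngen (flt (FCom c1 c2))) (ev (FCom c1 c2) ^+ (a * q))%g [~ x, y]%g.
Proof.
move=> cx cy; set M := Ngen (flt (FCom c1 c2)).
have nM : normal_sub M by exact: normal_gt.
have ge_ev c n : Ngen (fle c) (ev c ^+ n)%g.
  elim: n => [|n IH]; first exact: gen_one.
  by rewrite expgS; apply: gen_mul => //; apply: gen_in; exists c; split => //; exact: fle_refl.
have gt_ge c u : Ngen (flt c) u -> Ngen (fle c) u.
  by apply: gen_subset => _ [c' [[h _] ->]]; exists c'.
have Zc z g : Ngen (fle (FCom c1 c2)) z -> M [~ z, g]%g.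
  apply: Ngen_central => // c' c'' h; exact: fle_lt_trans (flt_com _ _).
have comZ u v : Ngen (fle c1) u -> Ngen (fle c2) v -> Ngen (fle (FCom c1 c2)) [~ u, v]%g.
  by apply: Ngen_com; [exact: normal_ge|exact: fle_com].
apply: cong_sym => //; apply: (@cong_trans _ _ nM [~ (ev c1 ^+ a)%g, (ev c2 ^+ q)%g]%g); last first.
  apply: (cong_commX nM _ _ Zc) => i j; exact: comZ.
pose u := ((ev c1 ^+ a)^-1 * x)%g; pose v := ((ev c2 ^+ q)^-1 * y)%g.
have -> : x = (ev c1 ^+ a * u)%g by rewrite /u mulVKg.
have gy : Ngen (fle c2) y.
  have -> : y = (ev c2 ^+ q * v)%g by rewrite /v mulVKg.
  by apply: gen_mul; [exact: ge_ev|exact: (gt_ge _ _ cy)].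
have e1 (g h k : G) : ([~ g * h, k] = [~ g, k] ^ h * [~ h, k])%g.
  by rewrite /commg /conjg !invgM !mulgA !(mulgK, mulgVK).
have e2 (g h k : G) : ([~ g, h * k] = [~ g, k] * [~ g, h] ^ k)%g.
  by rewrite /commg /conjg !invgM !mulgA !(mulgK, mulgVK).
rewrite e1 -[X in cong _ _ X]mulg1; apply: congM => //; last first.
  apply: cong1 => //; apply: (Ngen_com nM _ (cx : Ngen _ u) gy) => c c'.
  exact: flt_coml.
apply: cong_trans (_ : cong _ _ [~ ev c1 ^+ a, y]%g) _ => //.
  apply: cong_sym => //; apply: cong_conj; apply: Zc; exact: comZ.
have -> : y = (ev c2 ^+ q * v)%g by rewrite /v mulVKg.
rewrite e2 -[X in cong _ _ X]mul1g; apply: congM => //.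
  apply: cong1 => //; apply: (Ngen_com nM _ (ge_ev c1 a) (cy : Ngen _ v)) => c c'.
  exact: flt_comr.
apply: cong_sym => //; apply: cong_conj; apply: Zc; exact: comZ.
Qed.

(** The four factors are joined by three products, with constants 4, 10 and 22. *)
Lemma small_comm (K : R) x y : 0 <= K -> small mu K x -> small mu K y ->
  small mu (22 * K) [~ x, y]%g.
Proof.
move=> K0 sx sy; rewrite /commg /conjg.
have h1 := smallM K0 K0 sx sy.
have k1 : 0 <= 2 * (K + K) by rewrite mulr_ge0// addr_ge0.
have h2 := smallM K0 k1 (smallV sy) h1.
have k2 : 0 <= 2 * (K + 2 * (K + K)) by rewrite mulr_ge0// addr_ge0.
have h3 := smallM K0 k2 (smallV sx) h2.
by apply: small_le h3 => //; lra.
Qed.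

Lemma commutator_powers c (B : R) : exists2 K : R, 0 <= K &
  forall (t : R) (n : nat), 1 <= t -> n%:R <= B * W c t ->
  exists2 y, cong (Ngen (flt c)) (ev c ^+ n)%g y & small mu (K * t) y.
Proof.
elim: c B => [j b|c1 IH1 c2 IH2] B.
  have sS : nth 1%g Sig j \in Sig by exact: mem_nth.
  have m1 : 1 <= Num.max 1 B by rewrite le_max lexx.
  have [K K0 HK] := small_letters sS m1; exists K => // t n t1 nB.
  have sm : small mu (K * t) (nth 1%g Sig j ^+ n)%g.
    apply: HK => //; apply: (le_trans nB) => /=; apply: ler_wpM2r.
      by apply: weight_ge0 (wFw sS) _ _; lra.
    by rewrite le_max lexx orbT.
  exists (ev (FLet j b) ^+ n)%g; first exact: cong_refl (normal_gt _) _.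
  by case: b {nB} => //=; rewrite expVgn; exact: smallV.
have w1 := weight_fcomm c1; have w2 := weight_fcomm c2.
have p1 := weight_gt0 w1 (lexx 1); have p2 := weight_gt0 w2 (lexx 1).
(* [B1] allows for rounding the weight of [c1] up to the integer [a]. [B2] covers the quotient [q]
   as well as the exponent 1 that accompanies the remainder. These differ from [B], hence the
   induction for all [B]. *)
pose B1 := 1 + (W c1 1)^-1; pose B2 := Num.max B (W c2 1)^-1.
have [K1 K10 H1] := IH1 B1; have [K2 K20 H2] := IH2 B2.
have K0 : 0 <= K1 + K2 by rewrite addr_ge0.
(* 88 = 2 (22 + 22), for a product of two commutators. *)
exists (88 * (K1 + K2)); first by rewrite mulr_ge0.
move=> t n t1 nB; have t0 : 0 <= t by lra.
have W1 : W c1 1 <= W c1 t by apply: weight_mono w1 _ _ _ t1.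
have W2 : W c2 1 <= W c2 t by apply: weight_mono w2 _ _ _ t1.
pose a := (Num.truncn (W c1 t)).+1.
have a1 : W c1 t <= a%:R by apply/ltW/truncnS_gt.
have aB : a%:R <= B1 * W c1 t.
  rewrite /B1 mulrDl mul1r /a -natr1; apply: lerD.
    by rewrite truncn_le// (le_trans (ltW p1)).
  by rewrite mulrC ler_pdivlMr// mul1r.
have W1p : 0 < W c1 t by apply: lt_le_trans W1.
have W2p : 0 < W c2 t by apply: lt_le_trans W2.
pose q := (n %/ a)%N; pose d := (n %% a)%N.
(* The remainder is treated as [c1^d, c2^1], a second instance of [cong_com]. *)
have en : n = (a * q + d * 1)%N by rewrite muln1 mulnC -divn_eq.
have qB : q%:R <= B2 * W c2 t.
  have h : (q * a)%:R <= B * (W c1 t * W c2 t).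
    by apply: le_trans nB; rewrite ler_nat leq_trunc_div.
  apply: le_trans (_ : B * W c2 t <= _); last first.
    by apply: ler_wpM2r; [exact: ltW|rewrite /B2 le_max lexx].
  rewrite -(ler_pM2r W1p); apply: le_trans (_ : q%:R * a%:R <= _).
    by rewrite ler_wpM2l.
  by rewrite -natrM (le_trans h)// le_eqVlt; apply/orP; left; apply/eqP; ring.
have dB : d%:R <= B1 * W c1 t.
  by apply: le_trans aB; rewrite ler_nat ltnW// ltn_pmod.
have oneB : 1%:R <= B2 * W c2 t.
  apply: le_trans (_ : (W c2 1)^-1 * W c2 t <= _).
    by rewrite mulrC ler_pdivlMr// mul1r.
  by apply: ler_wpM2r; [exact: ltW|rewrite /B2 le_max lexx orbT].
have [y1 cy1 sy1] := H1 t a t1 aB; have [y2 cy2 sy2] := H2 t q t1 qB.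
have [z1 cz1 sz1] := H1 t d t1 dB; have [z2 cz2 sz2] := H2 t 1%N t1 oneB.
exists ([~ y1, y2] * [~ z1, z2])%g.
  rewrite en expgnDr; apply: congM; [exact: normal_gt|exact: cong_com|exact: cong_com].
have Kt : 0 <= (K1 + K2) * t by rewrite mulr_ge0.
have l1 : K1 * t <= (K1 + K2) * t by rewrite ler_wpM2r// lerDl.
have l2 : K2 * t <= (K1 + K2) * t by rewrite ler_wpM2r// lerDr.
have s1 := small_comm Kt (small_le mu0 l1 sy1) (small_le mu0 l2 sy2).
have s2 := small_comm Kt (small_le mu0 l1 sz1) (small_le mu0 l2 sz2).
have k22 : 0 <= 22 * ((K1 + K2) * t) by rewrite mulr_ge0.
apply: small_le (smallM k22 k22 s1 s2) => //; lra.
Qed.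

End CommutatorPowers.

(** * Ordered products of powers *)

Section PowerProducts.
Context (G : groupType).
Implicit Types (l : seq G) (m : seq nat).

Fixpoint powprod l m : G :=
  match l, m with
  | b :: l', k :: m' => (b ^+ k * powprod l' m')%g
  | _, _ => 1%g
  end.

Fixpoint zpowprod l (z : seq int) : G :=
  match l, z with
  | b :: l', k :: z' => (zexp b k * zpowprod l' z')%g
  | _, _ => 1%g
  end.

Lemma zpowprodE l z : size z = size l ->
  zpowprod l z =
  \big[(fun x y => (x * y)%g)/1%g]_(i < size l) zexp (nth 1%g l i) (nth 0 z i).
Proof.
elim: l z => [|b l IH] [|k z]//=; first by rewrite big_ord0.
by move=> [sz]; rewrite big_ord_recl/= IH.
Qed.

Lemma zexp_sub (x : G) (m n : nat) : zexp x (n%:Z - m%:Z) = ((x ^+ m)^-1 * x ^+ n)%g.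
Proof.
have [mn|/ltnW nm] := leqP m n.
  by rewrite subzn// -{2}(subnKC mn) expgnDr mulKg.
rewrite -opprB subzn//; case E : (m - n)%N => [|k].
  rewrite oppr0 /= expg0; have -> : m = n by apply/eqP; rewrite eqn_leq nm -subn_eq0 E.
  by rewrite mulVg.
have -> : - Posz k.+1 = Negz k by rewrite NegzE.
by rewrite /= -(subnKC nm) E expgnDr invgM mulgVK.
Qed.

(** The entries of [l] are central modulo [M], so a quotient of two products collects into one
    product with the differences as exponents. A coincidence of cosets thereby becomes a relation to
    which [indep_mod] applies. *)
Lemma zpowprod_diff (M : set G) l m m' : normal_sub M ->
  (forall x y, x \in l -> M [~ x, y]%g) -> size m = size l -> size m' = size l ->
  cong M (powprod l m) (powprod l m') ->
  M (zpowprod l [seq n.2%:Z - n.1%:Z | n <- zip m m']).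
Proof.
move=> nM central sm sm' cm.
suff h : cong M ((powprod l m)^-1 * powprod l m')%g
                (zpowprod l [seq n.2%:Z - n.1%:Z | n <- zip m m']).
  exact: (cong_mem nM h cm).
elim: l m m' central sm sm' {cm} => [|b l IH] [|k m] [|k' m']//= central.
  by move=> _ _; rewrite invg1 mulg1; exact: (cong_refl nM).
move=> [sm] [sm']; rewrite zexp_sub invgM -!mulgA.
have cl x y : x \in l -> M [~ x, y]%g by move=> xl; apply: central; rewrite inE xl orbT.
have /(cong_trans nM) := IH m m' cl sm sm'.
set u := powprod l m; set v := powprod l m'.
move=> h.
have hb y : M [~ b, y]%g by apply: central; rewrite mem_head.
have hw i y : M [~ (b ^+ i)%g, y]%g.
  elim: i => [|i IHi]; first by rewrite expg0 comm1g; exact: nsub1.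
  by rewrite expgS; exact: nsub_commMl.
pose w := ((b ^+ k)^-1 * b ^+ k')%g.
have hww y : M [~ w, y]%g by apply: nsub_commMl => //; exact: nsub_commVl.
apply: (cong_trans nM (y := (w * (u^-1 * v))%g)).
  have -> : (u^-1 * ((b ^+ k)^-1 * (b ^+ k' * v)) = (u^-1 * w) * v)%g by rewrite /w !mulgA.
  rewrite [(w * (_ * _))%g]mulgA; apply: (congM nM); last exact: (cong_refl nM).
  by apply: cong_commute.
rewrite /w -!mulgA; apply: congM => //; first exact: (cong_refl nM).
apply: congM => //; first exact: (cong_refl nM).
by apply: h; exact: (cong_refl nM).
Qed.

End PowerProducts.

(** * The filtration by weights and the counting of small elements *)

Section LevelSets.
Context (R : realType) (G : groupType) (mu : G -> R) (Sig : seq G) (Fw : G -> R -> R)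
  (Fs : seq (R -> R)) (rs : seq nat).
Notation W := (@fweight R G Sig Fw).
Notation ev := (@feval G Sig).
Notation Fn j := (nth (fun _ : R => 0 : R) Fs j).
Notation J := (size Fs).
Hypotheses (mu0 : forall x, 0 <= mu x) (genSig : forall x, gen [set s | s \in Sig] x)
  (wFw : forall s, s \in Sig -> weight (Fw s))
  (uFw : forall s, s \in Sig -> unbounded (Fw s))
  (small_letters : forall s (B : R), s \in Sig -> 1 <= B -> exists2 K : R, 0 <= K &
    forall (t : R) (n : nat), 1 <= t -> n%:R <= B * Fw s t -> small mu (K * t) (s ^+ n)%g)
  (vd : volume_data Sig Fw Fs rs).

Definition above (c : fcomm (size Sig)) : Prop :=
  if Fs is f0 :: _ then prec_strict_inf (last f0 Fs) (W c) else True.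

(** Levels are numbered from 0: [level j] below is N_{j+1}, and the index j = J, beyond the listed
    classes, gives the trivial last subgroup. *)
Definition in_level (j : nat) (c : fcomm (size Sig)) : Prop :=
  if (j < J)%N then preceq_inf (Fn j) (W c) else above c.

Definition level (j : nat) : set G := Ngen (in_level j).

Let vd' : [/\ size rs = J /\ (forall j, (j < J)%N -> exists c, Fn j = W c),
   forall j, (j.+1 < J)%N -> prec_strict_inf (Fn j) (Fn j.+1),
   forall c, (exists2 j, (j < J)%N & simeq_inf (W c) (Fn j)) \/ above c,
   level J = [set 1%g] &
   forall j, (j < J)%N -> tf_rank (level j) (level j.+1) (nth 0%N rs j)].
Proof.
have E j : level j = (if (j < J)%N
      then gen [set g | exists c, preceq_inf (Fn j) (W c) /\ g = ev c]
      else gen [set g | exists c, above c /\ g = ev c]).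
  by rewrite /level /Ngen /in_level; case: ifP.
case: vd => h1 h2 h3 [_ h4] h5; split => //.
  by rewrite E.
by move=> j jJ; rewrite !E; exact: h5.
Qed.

Let repr j : (j < J)%N -> exists c, Fn j = W c.
Proof. by have [[_ h] _ _ _ _] := vd'; exact: h. Qed.

Lemma Fn_mono i j : (i <= j)%N -> (j < J)%N -> preceq_inf (Fn i) (Fn j).
Proof.
have [_ inc _ _ _] := vd'; move=> /subnKC <-; elim: (j - i)%N => [|n IH].
  by rewrite addn0 => /repr[c ->]; exact: fle_refl.
rewrite addnS => h; have h' := ltnW h; have h0 := leq_ltn_trans (leq_addr n i) h'.
have := IH h'; have [+ _] := inc _ h.
have [c ->] := repr h0; have [c' ->] := repr h'; have [c'' ->] := repr h.
by move=> b a; apply: (fle_trans wFw a b).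
Qed.

Let last_Fn f0 : (0 < J)%N -> last f0 Fs = Fn J.-1.
Proof. by move=> J0; rewrite nth_last; case: (Fs) J0. Qed.

Let aboveE c : (0 < J)%N -> above c = prec_strict_inf (Fn J.-1) (W c).
Proof. by move=> J0; rewrite -(last_Fn (fun _ => 0)) // /above; case: (Fs) J0. Qed.

Lemma in_level_above j c : (j < J)%N -> above c -> in_level j c.
Proof.
move=> jJ; have J0 : (0 < J)%N by apply: leq_ltn_trans jJ.
rewrite aboveE // /in_level jJ => -[h _].
have JJ : (J.-1 < J)%N by rewrite ltn_predL.
have jJ1 : (j <= J.-1)%N by rewrite -ltnS prednK.
move: (Fn_mono jJ1 JJ) h; have [c1 ->] := repr jJ; have [c2 ->] := repr JJ.
exact: fle_trans.
Qed.

(** Every weight is equivalent to a listed one or lies above them all. The class of [c'] cannot have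
    index at most j, and no class lies between two consecutive ones. *)
Lemma in_levelS j c c' : (j < J)%N -> in_level j c -> flt Fw c c' -> in_level j.+1 c'.
Proof.
move=> jJ; rewrite /in_level jJ => jc cc'.
have J0 : (0 < J)%N by apply: leq_ltn_trans jJ.
have [_ _ cls _ _] := vd'.
have below i : (i <= j)%N -> ~ preceq_inf (W c') (Fn i).
  move=> ij h; have [_] := cc'; apply.
  move: (Fn_mono ij jJ) h jc; have [c1 ->] := repr jJ.
  have [c2 ->] := repr (leq_ltn_trans ij jJ) => h1 h2 h3.
  exact: (fle_trans wFw h2 (fle_trans wFw h1 h3)).
case: (cls c') => [[i iJ [h1 h2]]|ab]; last first.
  by case: ifP => // jJ1; have := in_level_above jJ1 ab; rewrite /in_level jJ1.
have ji : (j < i)%N by rewrite ltnNge; apply/negP => /below /(_ h1).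
have jJ1 : (j.+1 < J)%N by apply: leq_ltn_trans iJ.
rewrite jJ1; move: (Fn_mono ji iJ) h2; have [c1 ->] := repr jJ1; have [c2 ->] := repr iJ.
exact: fle_trans.
Qed.

Lemma in_level_com j c c' : (j <= J)%N -> in_level j c -> in_level j (FCom c c').
Proof.
have lt := flt_com wFw uFw c c'.
rewrite leq_eqVlt => /orP[/eqP ->|jJ].
  rewrite /in_level ltnn; have [J0|J0] := posnP J.
    by rewrite /above; case: (Fs) J0.
  have JJ : (J.-1 < J)%N by rewrite ltn_predL.
  rewrite !aboveE//; have [c1 ->] := repr JJ => h.
  exact: (flt_le_trans wFw h lt.1).
rewrite /in_level jJ; have [c1 ->] := repr jJ => h.
by have [h2 _] := lt; exact: fle_trans h2.
Qed.

Lemma normal_level j : (j <= J)%N -> normal_sub (level j).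
Proof. by move=> jJ; apply: (normal_Ngen genSig) => c c'; exact: in_level_com. Qed.

Lemma level_central j x y : (j < J)%N -> level j x -> level j.+1 [~ x, y]%g.
Proof.
move=> jJ; have [c Ec] := repr jJ.
have -> : level j = Ngen (fle Fw c) by rewrite /level /in_level jJ Ec.
apply: (Ngen_central genSig); first exact: normal_level.
move=> c' c'' h; apply: (@in_levelS j c'); rewrite /in_level ?jJ ?Ec//.
exact: flt_com.
Qed.

Lemma level_sub j x : (j < J)%N -> level j.+1 x -> level j x.
Proof.
move=> jJ; apply: gen_subset => _ [c [h ->]]; exists c; split => //.
move: h; rewrite {1}/in_level; case: ifP => [jJ1|_]; last exact: in_level_above.
rewrite /in_level jJ; move: (Fn_mono (leqnSn j) jJ1).
have [c1 ->] := repr jJ; have [c2 ->] := repr jJ1; exact: fle_trans.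
Qed.

(** Induction on the way [b] is generated. Generators are [commutator_powers], whose errors fall
    into the next level; for products, (x y)^n is congruent to x^n y^n because level j is central
    modulo level j + 1. *)
Lemma level_powers j b (B : R) : (j < J)%N -> level j b -> exists2 K : R, 0 <= K &
  forall (t : R) (n : nat), 1 <= t -> n%:R <= B * Fn j t ->
  exists2 y, cong (level j.+1) (b ^+ n)%g y & small mu (K * t) y.
Proof.
move=> jJ lb; have nM := normal_level jJ; have [cj Ej] := repr jJ.
have Fpos t : 1 <= t -> 0 < Fn j t.
  by rewrite Ej; apply: weight_gt0; exact: weight_fcomm.
have one (t K : R) : 1 <= t -> 0 <= K -> 0 <= K * t.
  by move=> t1 K0; rewrite mulr_ge0//; lra.
elim: lb => [|_ [c [h ->]]|x _ [K K0 H]|x y lx [K K0 H] _ [K' K0' H']].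
- exists 0 => // t n t1 _; exists 1%g; first by rewrite expg1n; exact: (cong_refl nM).
  by rewrite mul0r; exact: small1.
- move: h; rewrite /in_level jJ Ej => h.
  have [C C0 HC] := (fleP wFw cj c).1 h.
  have [K K0 HK] := commutator_powers mu0 genSig wFw uFw small_letters c (Num.max B 0 * C).
  exists K => // t n t1 nB; have [|y cy sy] := HK t n t1; last first.
    exists y => //; move: cy; apply: gen_subset => _ [c' [h' ->]]; exists c'; split => //.
    by apply: in_levelS h'; rewrite // /in_level jJ Ej.
  apply: (le_trans nB); rewrite -mulrA.
  apply: le_trans (_ : Num.max B 0 * W cj t <= _).
    by apply: ler_wpM2r; [rewrite -Ej ltW// Fpos|rewrite le_max lexx].
  by apply: ler_wpM2l; [rewrite le_max lexx orbT|exact: HC].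
- exists K => // t n t1 nB; have [y cy sy] := H t n t1 nB; exists (y^-1)%g.
    by rewrite expVgn; exact: congV.
  exact: smallV.
- exists (2 * (K + K')); first by rewrite mulr_ge0// addr_ge0.
  move=> t n t1 nB; have [u cu su] := H t n t1 nB; have [v cv sv] := H' t n t1 nB.
  exists (u * v)%g; last first.
    apply: small_le (smallM (one _ _ t1 K0) (one _ _ t1 K0') su sv) => //; lra.
  apply: (cong_trans nM (y := (x ^+ n * y ^+ n)%g)); last exact: congM.
  elim: n {nB cu cv} => [|n IH]; first by rewrite !expg0 mulg1; exact: (cong_refl nM).
  rewrite !expgS; apply: (cong_trans nM (congM nM (cong_refl nM _) IH)).
  rewrite -!mulgA; apply: congM => //; first exact: (cong_refl nM).
  rewrite !mulgA; apply: congM => //; last exact: (cong_refl nM).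
  apply: cong_commute => //; apply: level_central => //.
  elim: n {IH} => [|n IH]; first exact: gen_one.
  by rewrite expgS; exact: gen_mul.
Qed.

Lemma level_products j (l : seq G) : (j < J)%N -> (forall x, x \in l -> level j x) ->
  exists2 K : R, 0 <= K & forall (t : R) (m : seq nat), 1 <= t -> size m = size l ->
    (forall n, n \in m -> n%:R <= Fn j t) ->
    exists2 y, cong (level j.+1) (powprod l m) y & small mu (K * t) y.
Proof.
move=> jJ; have nM := normal_level jJ.
elim: l => [|b l IH] ll.
  exists 0 => // t m t1 _ _; exists 1%g; first exact: (cong_refl nM).
  by rewrite mul0r; exact: small1.
have [|K K0 H] := IH; first by move=> x xl; apply: ll; rewrite inE xl orbT.
have [|K' K0' H'] := @level_powers j b 1 jJ; first by apply: ll; rewrite mem_head.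
exists (2 * (K' + K)); first by rewrite mulr_ge0// addr_ge0.
move=> t [//|k m] t1 [sm] Hm; have t0 : 0 <= t by lra.
have kF : k%:R <= 1 * Fn j t by rewrite mul1r; apply: Hm; rewrite mem_head.
have [u cu su] := H' t k t1 kF.
have [|v cv sv] := H t m t1 sm.
  by move=> n nm; apply: Hm; rewrite inE nm orbT.
exists (u * v)%g; first exact: congM.
by apply: small_le (smallM (mulr_ge0 K0' t0) (mulr_ge0 K0 t0) su sv) => //; lra.
Qed.

Lemma indep_powprod j (l : seq G) (m m' : seq nat) : (j < J)%N ->
  (forall x, x \in l -> level j x) -> indep_mod (level j.+1) l ->
  size m = size l -> size m' = size l ->
  cong (level j.+1) (powprod l m) (powprod l m') -> m = m'.
Proof.
move=> jJ ll ind sm sm' cm; have nM := normal_level jJ.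
have central x y : x \in l -> level j.+1 [~ x, y]%g.
  by move=> xl; apply: level_central => //; exact: ll.
have := zpowprod_diff nM central sm sm' cm.
set z := [seq _ | n <- _]; have sz : size z = size l.
  by rewrite size_map size_zip sm sm' minnn.
rewrite (zpowprodE sz) => /(ind z sz) hz.
apply: (@eq_from_nth _ 0%N); first by rewrite sm.
move=> i im; have iz : (i < size (zip m m'))%N by rewrite size_zip sm sm' minnn -sm.
have := hz i; rewrite /z (nth_map (0%N, 0%N))// nth_zip ?sm//=.
by move/eqP; rewrite subr_eq0 => /eqP -[].
Qed.

(** Downward induction on j. A small representative of each product of powers at level i is
    multiplied by the elements found for level i + 1; modulo that level a coincidence forces equal
    exponents by independence, hence equal remaining factors. *)
Lemma level_box j : (j <= J)%N -> exists2 K : R, 0 <= K &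
  forall t : R, 1 <= t -> exists Q : seq G, [/\ uniq Q, (0 < size Q)%N,
    (forall x, x \in Q -> level j x),
    \prod_(j <= i < J) Fn i t ^+ nth 0%N rs i <= (size Q)%:R &
    forall x, x \in Q -> small mu (K * t) x].
Proof.
move=> /subKn <-; elim: (J - j)%N (leq_subr j J) => [|n IH] nJ.
  exists 0 => // t t1; exists [:: 1%g]; rewrite subn0; split => //.
  - by move=> x; rewrite inE => /eqP ->; exact: gen_one.
  - by rewrite big_geq.
  - by move=> x; rewrite inE => /eqP ->; rewrite mul0r; exact: small1.
have [K K0 HK] := IH (ltnW nJ).
set i := (J - n.+1)%N; have iJ : (i < J)%N by rewrite /i ltn_subrL/= (leq_ltn_trans _ nJ).
have ei : (J - n)%N = i.+1 by rewrite /i -subSn.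
rewrite ei in HK.
have [_ _ _ _ rk] := vd'; have [[l [sl [ll ind]]] _] := rk i iJ.
have [K' K0' HK'] := level_products iJ ll.
exists (2 * (K' + K)); first by rewrite mulr_ge0// addr_ge0.
move=> t t1; have t0 : 0 <= t by lra.
have [Q [uQ Q0 QL Qv Qs]] := HK t t1.
set r := nth 0%N rs i in sl *.
have [ci Ei] := repr iJ.
have Fp : 0 < Fn i t by rewrite Ei; apply: weight_gt0 => //; exact: weight_fcomm.
(* The exponents 0, ..., k - 1 all stay below [Fn i t], yet there are k >= [Fn i t] of them. *)
pose k := (Num.truncn (Fn i t)).+1.
pose box : seq (seq nat) := [seq [seq nat_of_ord o | o <- tval x] | x <- enum {: r.-tuple 'I_k}].
have ubox : uniq box.
  rewrite map_inj_uniq ?enum_uniq// => x y /(inj_map val_inj) e; exact: val_inj.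
have sbox : size box = (k ^ r)%N by rewrite size_map -cardE card_tuple card_ord.
have boxP m : m \in box -> size m = size l /\ forall o, o \in m -> o%:R <= Fn i t.
  move=> /mapP[x _ ->]; split; first by rewrite size_map size_tuple sl.
  move=> o /mapP[w _ ->]; apply: le_trans (_ : (Num.truncn (Fn i t))%:R <= _).
    by rewrite ler_nat -ltnS.
  by rewrite truncn_le// ltW.
have ex (m : seq nat) : exists y : G, m \in box -> cong (level i.+1) (powprod l m) y /\ small mu (K' * t) y.
  have [mb|nb] := boolP (m \in box); last by exists 1%g.
  have [sm mF] := boxP m mb; have [y cy sy] := HK' t m t1 sm mF.
  by exists y.
have [Y HY] := choice ex.
have nM := normal_level iJ.
exists [seq (Y m * q)%g | m <- box, q <- Q]; split.
- apply: allpairs_uniq => // -[m q] [m' q'] /allpairsP[[a b] /= [aB bQ [-> ->]]].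
  move=> /allpairsP[[a' b'] /= [aB' bQ' [-> ->]]] /= e.
  have [ca _] := HY _ aB; have [ca' _] := HY _ aB'.
  have [sa _] := boxP _ aB; have [sa' _] := boxP _ aB'.
  have cY : cong (level i.+1) (Y a) (Y a').
    rewrite /cong; have -> : ((Y a)^-1 * Y a' = b * b'^-1)%g.
      by apply: (mulgI (Y a)); rewrite mulVKg mulgA e mulgK.
    by apply: gen_mul; [exact: QL|apply: gen_inv; exact: QL].
  have eab : a = a'.
    apply: (indep_powprod iJ ll ind sa sa').
    exact: (cong_trans nM ca (cong_trans nM cY (cong_sym nM ca'))).
  by rewrite -eab in e *; move/mulgI: e => ->.
- by rewrite size_allpairs muln_gt0 Q0 sbox expn_gt0.
- move=> x /allpairsP[[m q] /= [mB qQ ->]]; have [sm _] := boxP _ mB.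
  have [cm _] := HY _ mB.
  apply: gen_mul; last by apply: level_sub => //; exact: QL.
  have -> : Y m = (powprod l m * ((powprod l m)^-1 * Y m))%g by rewrite mulVKg.
  apply: gen_mul; last by apply: level_sub.
  elim: (l) (m) ll => [|b l' IHl] [|o m'] hl //=; try exact: gen_one.
  apply: gen_mul; last by apply: IHl => a al; apply: hl; rewrite inE al orbT.
  have bb : level i b by apply: hl; rewrite mem_head.
  elim: (o) => [|o' IHo]; first exact: gen_one.
  by rewrite expgS; exact: gen_mul.
- rewrite big_ltn// size_allpairs natrM sbox natrX; apply: ler_pM => //.
  + by rewrite exprn_ge0// ltW.
  + rewrite big_seq_cond prodr_ge0// => a; rewrite andbT mem_index_iota => /andP[_ aJ].
    have [ca ->] := repr aJ; apply: exprn_ge0; apply: weight_ge0 => //; exact: weight_fcomm.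
  + by rewrite lerXn2r ?nnegrE ?(ltW Fp)//; exact/ltW/truncnS_gt.
- move=> x /allpairsP[[m q] /= [mB qQ ->]]; have [_ sm] := HY _ mB.
  by apply: small_le (smallM (mulr_ge0 K0' t0) (mulr_ge0 K0 t0) sm (Qs _ qQ)) => //; lra.
Qed.

Lemma volume_box : exists2 K : R, 0 <= K &
  forall t : R, 1 <= t -> exists Q : seq G, [/\ uniq Q, (0 < size Q)%N,
    volume_fn Fs rs t <= (size Q)%:R & forall x, x \in Q -> small mu (K * t) x].
Proof.
have [K K0 H] := level_box (leq0n J); exists K => // t t1.
have [Q [uQ Q0 _ vQ sQ]] := H t t1; exists Q; split => //.
by rewrite /volume_fn -(big_mkord xpredT (fun i => Fn i t ^+ nth 0%N rs i)).
Qed.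

Lemma weight_volume : weight (volume_fn Fs rs).
Proof.
rewrite /volume_fn.
have H n : (n <= J)%N -> weight (fun t => \prod_(i < n) Fn i t ^+ nth 0%N rs i).
  elim: n => [|n IH] nJ.
    rewrite (_ : (fun t => _) = fun=> 1); first exact: weight_cst1.
    by apply/funext => t; rewrite big_ord0.
  rewrite (_ : (fun t => _) = fun t => (\prod_(i < n) Fn i t ^+ nth 0%N rs i) *
     (Fn n t ^+ nth 0%N rs n)); last by apply/funext => t; rewrite big_ord_recr.
  apply: weight_mul; first exact: IH (ltnW nJ).
  by apply: weight_exp; have [c ->] := repr nJ; exact: weight_fcomm.
exact: H.
Qed.

(** One positive rank gives an unbounded factor, and the other factors are bounded below by their
    values at 1. The alternative is kept apart because the inverse of a constant function
    degenerates. *)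
Lemma volume_trivial_or_unbounded :
  volume_fn Fs rs = (fun=> 1) \/ unbounded (volume_fn Fs rs).
Proof.
have [[i /andP[iJ ri]]|no] := pselect (exists i, (i < J)%N && (0 < nth 0%N rs i)%N); last first.
  left; apply/funext => t; rewrite /volume_fn big1// => i _.
  have [->|ri] := posnP (nth 0%N rs i); first by rewrite expr0.
  by exfalso; apply: no; exists (val i); rewrite ltn_ord.
right => M; pose H (t : R) := \prod_(k < J | k != Ordinal iJ) Fn k t ^+ nth 0%N rs k.
have [ci Ei] := repr iJ.
have Hge t : 1 <= t -> 0 < H 1 /\ H 1 <= H t.
  move=> t1; have p (k : 'I_J) s : 1 <= s -> 0 < Fn k s.
    by move=> s1; have [ck ->] := repr (ltn_ord k); apply: weight_gt0 => //; exact: weight_fcomm.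
  split; first by rewrite prodr_gt0// => k _; rewrite exprn_gt0// p.
  apply: ler_prod => k _; rewrite exprn_ge0 ?(ltW (p _ _ _))//=.
  rewrite lerXn2r// ?nnegrE ?(ltW (p _ _ _))//.
  by have [ck ->] := repr (ltn_ord k); apply: weight_mono (weight_fcomm wFw ck) _ _ _ t1.
have [t t1 Mt] := unbounded_fcomm wFw uFw ci (Num.max 1 (Num.max M 0 / H 1)).
have [h1 h2] := Hge t t1; exists t => //.
rewrite /volume_fn (bigD1 (Ordinal iJ))//= -/(H t) Ei.
move: Mt; rewrite ge_max => /andP[W1 WM].
have WW : W ci t <= W ci t ^+ nth 0%N rs i.
  by rewrite -{1}(expr1 (W ci t)) ler_weXn2l.
apply: le_trans (_ : Num.max M 0 <= _); first by rewrite le_max lexx.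
rewrite -(divfK (lt0r_neq0 h1) (Num.max M 0)); apply: ler_pM => //.
- by rewrite divr_ge0 ?(ltW h1)// le_max lexx orbT.
- exact: ltW.
- exact: le_trans WW.
Qed.

End LevelSets.

(** * Finite maxima of weights *)

Section BigMax.
Context (R : realType) (I : eqType).
Implicit Types (F : I -> R -> R) (P : pred I) (r : seq I).

Lemma weight_ext (f g : R -> R) : (forall t : R, 0 <= t -> f t = g t) -> weight f -> weight g.
Proof.
move=> fg [m p q [A A1 HA] [d d0 Hd]].
have p1 (t : R) : 1 <= t -> 0 <= t by move=> ?; lra.
split.
- by move=> s t s0 st; rewrite -!fg ?m// (le_trans s0).
- by move=> t t0; rewrite -fg ?p.
- by move=> t t1; rewrite -fg ?q ?p1.
- by exists A => // t t1; have t0 := p1 _ t1; rewrite -!fg ?HA// mulr_ge0.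
- by exists d => // t t0 td; rewrite -fg ?Hd.
Qed.

Lemma bigmax_attained F P r t : (forall i, P i -> 0 <= F i t) -> has P r ->
  exists2 i, (i \in r) && P i & \big[Num.max/0]_(i <- r | P i) F i t = F i t.
Proof.
move=> F0; elim: r => [//|x r IH] /=; rewrite big_cons.
case: ifPn => [Px _|_ /= /IH[i /andP[ir Pi] ->]]; last by exists i => //; rewrite inE ir Pi orbT.
have [/IH[i /andP[ir Pi] ->]|nP] := boolP (has P r).
  have [h|h] := leP (F x t) (F i t); first by exists i => //; rewrite inE ir Pi orbT.
  by exists x => //; rewrite mem_head.
exists x; first by rewrite mem_head.
by rewrite big_hasC//; apply/max_idPl; exact: F0.
Qed.

Lemma bigmax_weight F P r : (forall i, P i -> weight (F i)) -> has P r ->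
  weight (fun t => \big[Num.max/0]_(i <- r | P i) F i t).
Proof.
move=> wF; elim: r => [//|x r IH] /=.
case: (boolP (P x)) => [Px _|nPx /= hr]; last first.
  by apply: weight_ext (IH hr) => t _; rewrite big_cons (negbTE nPx).
have [hr|nP] := boolP (has P r).
  by apply: weight_ext (weight_max (wF _ Px) (IH hr)) => t _; rewrite big_cons Px.
apply: weight_ext (wF _ Px) => t t0; rewrite big_cons Px big_hasC//.
by apply/esym/max_idPl; apply: weight_ge0 (wF _ Px) _ t0.
Qed.

Lemma bigmax_unbounded F P r : (forall i, P i -> weight (F i)) ->
  (forall i, P i -> unbounded (F i)) -> has P r ->
  unbounded (fun t => \big[Num.max/0]_(i <- r | P i) F i t).
Proof.
move=> wF uF; elim: r => [//|x r IH] /= hr M.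
case: (boolP (P x)) hr => [Px _|nPx /= hr]; last first.
  by have [t t1 Mt] := IH hr M; exists t => //; rewrite big_cons (negbTE nPx).
have [t t1 Mt] := uF _ Px M; exists t => //.
by rewrite big_cons Px le_max Mt.
Qed.

End BigMax.

(** * From the count of small elements to the two estimates *)

Section VolumeConsequences.
Context (R : realType) (G : groupType) (mu : G -> R) (V : R -> R) (K : R).
Hypotheses (mu_prob : prob_measure mu) (mu_sym : symmetric_measure mu)
  (mu1 : 0 < mu 1%g) (K0 : 0 <= K) (wV : weight V)
  (box : forall t : R, 1 <= t -> exists Q : seq G, [/\ uniq Q, (0 < size Q)%N,
    V t <= (size Q)%:R & forall x, x \in Q -> small mu (K * t) x]).

Let mu0 x : 0 <= mu x. Proof. by case: mu_prob. Qed.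

Lemma spectral_profile_lower : V = (fun=> 1) \/ unbounded V ->
  exists c1 c2 : R, 0 < c1 /\ 0 < c2 /\ forall v : R, 1 <= v ->
    ((1 / inv_incr V v)%:E <= c1%:E * spectral_profile mu (Num.max (c2 * v) 1)%R)%E.
Proof.
case=> [V1|uV].
  exists 1, 1; split => //; split => // v v1.
  (* The set in [inv_incr] is unbounded, so [sup] takes its default value 0, as does the quotient 1
     / 0; only nonnegativity of the profile remains to be shown. *)
  have -> : inv_incr V v = 0.
    apply: sup_out => -[_ [M HM]].
    have M0 : 0 <= Num.max M 0 + 1 by rewrite addr_ge0// le_max lexx orbT.
    have V1v : V (Num.max M 0 + 1) <= v by rewrite V1.
    have := HM _ (conj M0 V1v); rewrite leNgt => /negP; apply.
    by rewrite ltr_pwDr// le_max lexx.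
  by rewrite invr0 mulr0 mul1e; exact: spectral_profile_ge0.
have sup_v v : 1 <= v -> has_sup [set t | 0 <= t /\ V t <= v].
  move=> v1; have [d d0 Hd] := weight_small wV; split.
    by exists 0; split => //=; apply: le_trans v1; apply: Hd => //; exact: ltW.
  have [T T1 VT] := uV (v + 1); exists T => t [t0 tv].
  rewrite leNgt; apply/negP => Tt.
  have : V T <= V t by apply: weight_mono wV _ _ _ (ltW Tt); lra.
  lra.
have [d d0 Hd] := weight_small wV.
have dX v : 1 <= v -> d <= inv_incr V v.
  move=> v1; apply: ub_le_sup; first by have [] := sup_v v v1.
  by split; [exact: ltW|apply: le_trans v1; apply: Hd => //; exact: ltW].
have [T T1 VT] := uV 2.
have K1 : 0 < K + 1 by rewrite ltr_wpDl.
have Td : 0 <= T / d by rewrite divr_ge0 ?(ltW d0)//; lra.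
exists (2 * (K + 1) * (2 + T / d)), (1 / 2); split; last split => //.
  by rewrite !mulr_gt0// ltr_pwDl.
move=> v v1; have dXv := dX v v1; set X := inv_incr V v in dXv *.
have X0 : 0 < X by apply: lt_le_trans dXv.
(* [2 * X] lies strictly beyond the supremum, so V(t) >= v; [T] gives V(t) >= 2, for the case where
   the argument of the profile is 1. As X >= d, t is still at most a constant times X. *)
pose t := Num.max (2 * X) T.
have tT : T <= t by rewrite /t le_max lexx orbT.
have t1 : 1 <= t by apply: le_trans tT.
have t0 : 0 < t by lra.
have tX : 2 * X <= t by rewrite /t le_max lexx.
have Vv : v <= V t.
  rewrite leNgt; apply/negP => Vt.
  have : t <= X.
    by apply: ub_le_sup; [have [] := sup_v v v1|split; apply: ltW].
  lra.
have V2 : 2 <= V t.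
  by apply: (le_trans VT); apply: weight_mono wV _ _ _ tT; lra.
have [Q [uQ Q0 VQ sQ]] := box t1.
have Kt : 0 < (K + 1) * t by rewrite mulr_gt0.
have profile : ((1 / (2 * ((K + 1) * t)))%:E <= spectral_profile mu (Num.max (1 / 2 * v) 1)%R)%E.
  apply: (spectral_profile_ge mu0 Kt uQ Q0).
    apply: le_trans VQ; have [h|h] := leP (1 / 2 * v) 1; lra.
  by move=> g gQ; apply: small_le (sQ g gQ) => //; rewrite ler_wpM2r ?(ltW t0)// lerDl.
have c0 : 0 <= 2 * (K + 1) * (2 + T / d) by rewrite !mulr_ge0 ?(ltW K1)// addr_ge0.
apply: le_trans (lee_wpmul2l _ profile); last by rewrite lee_fin.
rewrite -EFinM lee_fin ler_pdivrMr//.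
have tle : t <= (2 + T / d) * X.
  rewrite /t (mulrDl 2) ge_max; apply/andP; split.
    by rewrite lerDl mulr_ge0// ltW.
  apply: ler_wpDl; first by rewrite mulr_ge0// ltW.
  rewrite mulrAC ler_pdivlMr// ler_wpM2l//; lra.
rewrite [leRHS](_ : _ = (2 + T / d) * X / t); last by field; lra.
by rewrite ler_pdivlMr// mul1r.
Qed.

Lemma convpow_upper : exists c1 c2 : R, 0 < c1 /\ 0 < c2 /\
  forall n : nat, (1 <= n)%N ->
    convpow mu n 1%g <= c1 * (1 / V (Num.max (c2 * n%:R) 1)).
Proof.
pose a n := convpow mu (n + n) 1%g.
have p0 k x : 0 <= convpow mu k x by case: (convpow_prob mu_prob mu_sym k).
have [A A1 HA] := weight_doubling wV.
have Vm (s t : R) : 1 <= s -> s <= t -> V s <= V t.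
  by move=> s1 st; apply: weight_mono wV _ _ _ st; lra.
pose C := Num.max 1 (K * (2 / mu 1%g)).
have C1 : 1 <= C by rewrite /C le_max lexx.
have aS n : a n.+1 <= a n by exact: convpow_even_le.
have a1 : a 0%N <= 1 by apply: prob_le1; exact: convpow_prob.
have step n t : 1 <= t -> a n <= C * t * (a n - a n.+1) + 2 / V t.
  move=> t1; have [Q [uQ Q0 VQ sQ]] := box t1; have t0 : 0 <= t by lra.
  have Kt : 0 <= K * t by rewrite mulr_ge0.
  have h := convpow_nash_step mu_prob mu_sym n Kt mu1 uQ Q0 sQ.
  apply: (le_trans h); rewrite -/(a n) -/(a n.+1).
  have da : 0 <= a n - a n.+1 by rewrite subr_ge0.
  apply: lerD.
    apply: ler_wpM2r => //; rewrite mulrAC; apply: ler_wpM2r => //.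
    by rewrite /C le_max lexx orbT.
  by rewrite ler_wpM2l// lef_pV2 ?posrE ?(weight_gt0 wV t1)// ltr0n.
have [B [M [B0 M0 HB]]] := nash_recursion (fun n => p0 _ _) aS a1 C1 A1
  (weight_gt0 wV) Vm HA step.
have MR : 0 < M%:R :> R by rewrite ltr0n.
(* The recursion runs over even times and bounds by m / (2M) with m = n./2. Since n <= 3 m unless n
   = 1, n / (6M) is admissible, and for n = 1 the maximum is 1 anyway. *)
exists B, (1 / (6 * M%:R)); split => //; split; first by rewrite divr_gt0// mulr_gt0.
move=> n n1; pose m := n./2.
have am : convpow mu n 1%g <= a m.
  rewrite -(odd_double_half n) -/m -addnn /a; case: (odd n); last by rewrite add0n.
  by rewrite add1n -addnS; exact: convpow_odd_le.
apply: (le_trans am); apply: (le_trans (HB m)); rewrite mul1r.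
have m1 (x : R) : 1 <= Num.max x 1 by rewrite le_max lexx orbT.
rewrite ler_wpM2l ?(ltW B0)// lef_pV2 ?posrE ?(weight_gt0 wV)//; apply: Vm => //.
rewrite ge_max m1 andbT le_max.
have n3 : (n <= 3 * m)%N || (n == 1)%N.
  have e : (odd n + m.*2 = n)%N := odd_double_half n.
  have [m0|m0] := posnP m.
    by move: n1; rewrite -e m0; case: (odd n).
  by rewrite -e mulSn mul2n leq_add2r (leq_trans (leq_b1 _) m0).
case/orP: n3 => [n3|/eqP ->].
  apply/orP; left; rewrite mulrAC mul1r ler_pdivrMr ?mulr_gt0//.
  rewrite [leRHS](_ : _ = 3 * m%:R); last by field; lra.
  by rewrite -natrM ler_nat.
apply/orP; right; rewrite mulr1 ler_pdivrMr ?mulr_gt0// mul1r.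
have : 1 <= M%:R :> R by rewrite ler1n.
lra.
Qed.

End VolumeConsequences.

(** * Verification for the measures of the theorem *)

Section RegularMeasures.
Context (R : realType) (G : groupType) (mu : G -> R) (k : nat) (p : nat -> R)
  (mus : nat -> G -> R) (H : nat -> set G) (phi : nat -> R -> R) (S : nat -> seq G).
Hypotheses (Hmu : Preg_le mu k p mus H phi)
  (S0 : forall x, x \in S 0%N <-> mus 0%N x != 0)
  (Si : forall i, (1 <= i <= k)%N ->
     (forall s, s \in S i -> (s^-1)%g \in S i) /\
     (forall x, H i x <-> gen [set s | s \in S i] x)).

Lemma Preg_p_ge0 i : (i <= k)%N -> 0 <= p i.
Proof.
case: Hmu => -[_ [p0 [pi _]]] _ _ _ _; case: i => // i ik.
by apply/ltW/pi.
Qed.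

Lemma Preg_mus_le i x : (i <= k)%N -> p i * mus i x <= mu x.
Proof.
move=> ik; case: Hmu => -[muE _] [pm _] _ _ _.
rewrite muE (bigD1 (Ordinal (ik : (i < k.+1)%N)))//= lerDl sumr_ge0// => j _.
have jk : (j <= k)%N by rewrite -ltnS.
by rewrite mulr_ge0 ?Preg_p_ge0//; have [[h _] _] := pm j jk; exact: h.
Qed.

Lemma Preg_prob : prob_measure mu.
Proof.
case: Hmu => -[muE [_ [_ p1]]] [pm _] _ _ _.
have mus0 (j : 'I_k.+1) x : 0 <= p j * mus j x.
  have jk : (j <= k)%N by rewrite -ltnS.
  by rewrite mulr_ge0 ?Preg_p_ge0//; have [[h _] _] := pm j jk; exact: h.
split; first by move=> x; rewrite muE; apply: sumr_ge0.
under eq_esum => x _ do rewrite muE -sumEFin.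
rewrite esum_sum; last by move=> x j _ _; rewrite lee_fin.
rewrite -p1 -sumEFin; apply: eq_bigr => j _.
have jk : (j <= k)%N by rewrite -ltnS.
have [[h h1] _] := pm j jk.
under eq_esum => x _ do rewrite EFinM.
by rewrite esumZl ?Preg_p_ge0// ?h1 ?mule1// => x; rewrite lee_fin.
Qed.

Lemma Preg_sym : symmetric_measure mu.
Proof.
case: Hmu => -[muE _] [pm _] _ _ _ x; rewrite !muE; apply: eq_bigr => j _.
have jk : (j <= k)%N by rewrite -ltnS.
by have [_ h] := pm j jk; rewrite h.
Qed.

Lemma Preg_scale i : (i <= k)%N -> scale_fun (PhiI phi i).
Proof.
case: i => [_|i ik]; first exact: scale_Phi0.
have [_ _ hi _ _] := Hmu; have [T [d [_ _ [ppos [pmono [gam [g0 reg]]]] _ _]]] := hi i.+1 ik.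
exact: scale_PhiReg ppos pmono g0 reg.
Qed.

Lemma Preg_small x : exists2 K : R, 0 <= K & small mu K x.
Proof.
have [mu0 _] := Preg_prob; case: Hmu => _ _ _ [eps [e0 [gmu _]]] _.
by have := small_gen mu0 e0 (gmu x).
Qed.

(** For i = 0 the quadratic bound on powers suffices, as Phi_0(n) >= n^2. For i >= 1, lengths refer
    to the generating set that comes with the estimate of mu_i; [S i] matters only as a subset of
    H_i. *)
Lemma Preg_letters i s : (i <= k)%N -> s \in S i -> exists2 C : R, 0 <= C &
  forall n : nat, small mu (C * PhiI phi i n%:R) (s ^+ n)%g.
Proof.
have [mu0 _] := Preg_prob; have [K K0 sK] := Preg_small s.
case: i => [_ _|i ik sS].
  exists K => // n; apply: small_le (smallX n K0 sK) => //.
  by rewrite mulrC ler_wpM2l// /PhiI/= /Phi0 le_max lexx orbT.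
have [[muE [p0 [ppos _]]] [pm _] hi _ _] := Hmu.
have [T [d [[Tsym TH] grow [phpos [phmono [gam [g0 reg]]]] [c1 [c2 [c10 [_ low]]]] _]]] := hi i.+1 ik.
have [[nu0 _] _] := pm i.+1 (ik : (i.+1 <= k)%N).
have Hs : gen [set t | t \in T] s.
  by apply/TH; have [_ HS] := Si (i := i.+1) ik; apply/HS; exact: gen_in.
have nu_ge h n : gen [set t | t \in T] h -> is_wlen T h n ->
    c1 / (phi i.+1 (1 + n%:R) * (1 + n%:R) ^+ d) <= mus i.+1 h.
  by move=> gh wn; have [] := low h n ((TH h).2 gh) wn.
have [C C0 HC] := letter_powers mu0 nu0 (ppos i.+1 ik) (fun x => Preg_mus_le x ik)
  Tsym grow phpos phmono g0 reg c10 nu_ge Hs K0 sK.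
by exists C; first exact: ltW.
Qed.

Section Letters.
Variable Sig : seq G.
Hypotheses (SigS : forall s, s \in Sig -> s != 1%g /\ exists2 i, (i <= k)%N & s \in S i)
  (SSig : forall s, (exists2 i, (i <= k)%N & s \in S i) -> s != 1%g ->
     exists2 t, t \in Sig & t = s \/ t = (s^-1)%g).

(** An element of mass above eps is charged by some mu_j, so it lies in S_0 or in the subgroup
    generated by S_j; up to inversion the letters exhaust these sets. *)
Lemma gen_letters x : gen [set s | s \in Sig] x.
Proof.
have inS i s : (i <= k)%N -> s \in S i -> gen [set s | s \in Sig] s.
  move=> ik sS; have [->|s1] := eqVneq s 1%g; first exact: gen_one.
  have [t tS [<-|e]] := SSig (ex_intro2 _ _ i ik sS) s1; first exact: gen_in.
  by rewrite -(invgK s) -e; apply: gen_inv; exact: gen_in.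
have [[muE [_ _]] _ hi [eps [e0 [gmu _]]] _] := Hmu.
elim: (gmu x) => [|y /= ey|y _|y z _ gy _ gz].
- exact: gen_one.
- have muy : mu y != 0 by rewrite gt_eqF// (lt_trans e0).
  have [j [jk jy]] : exists j, (j <= k)%N /\ mus j y != 0.
    apply: contrapT => no; move/negP: muy; apply; rewrite muE big1// => j _.
    have jk : (j <= k)%N by rewrite -ltnS.
    have [->|jy] := eqVneq (mus j y) 0; first by rewrite mulr0.
    by exfalso; apply: no; exists (val j).
  case: j jk jy => [_ /S0|j jk jy]; first exact: inS.
  have [T [d [_ _ _ _ off]]] := hi j.+1 jk.
  have Hy : H j.+1 y.
    by apply: contrapT => /off e; rewrite e eqxx in jy.
  have [_ HS] := Si (i := j.+1) jk.
  have /HS := Hy; elim=> [|a /= aS|u _|u v _ gu _ gv].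
  + exact: gen_one.
  + exact: inS aS.
  + exact: gen_inv.
  + exact: gen_mul.
- exact: gen_inv.
- exact: gen_mul.
Qed.

Let F i := inv_incr (PhiI phi i).
Let idx := index_enum 'I_k.+1.

Let FsigmaE s : Fsigma k phi S s = fun t =>
  \big[Num.max/0]_(i <- idx | s \in S i) F i t.
Proof. by []. Qed.

Let hasS s : s \in Sig -> has (fun i : 'I_k.+1 => s \in S i) idx.
Proof.
move=> /SigS[_ [i ik sS]]; apply/hasP; exists (Ordinal (ik : (i < k.+1)%N)) => //.
exact: mem_index_enum.
Qed.

Let wF (i : 'I_k.+1) : weight (F i).
Proof. by apply: weight_inv_incr; apply: Preg_scale; rewrite -ltnS. Qed.

Lemma weight_Fsigma s : s \in Sig -> weight (Fsigma k phi S s).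
Proof. by move=> /hasS h; rewrite FsigmaE; apply: bigmax_weight h => i _; exact: wF. Qed.

Lemma unbounded_Fsigma s : s \in Sig -> unbounded (Fsigma k phi S s).
Proof.
move=> /hasS h; rewrite FsigmaE; apply: bigmax_unbounded h => i _; first exact: wF.
by apply: inv_incr_unbounded; apply: Preg_scale; rewrite -ltnS.
Qed.

(** The index realising the maximum may change with t, so the constants of all indices are summed.
    The factor [(2 * B) ^+ 2] comes from [scale_le_inv_incr]. *)
Lemma small_Fsigma s (B : R) : s \in Sig -> 1 <= B -> exists2 K : R, 0 <= K &
  forall (t : R) (n : nat), 1 <= t -> n%:R <= B * Fsigma k phi S s t ->
    small mu (K * t) (s ^+ n)%g.
Proof.
move=> sS B1; have [mu0 _] := Preg_prob.
have ex (i : 'I_k.+1) : exists C : R, 0 <= C /\ (s \in S i ->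
    forall n : nat, small mu (C * PhiI phi i n%:R) (s ^+ n)%g).
  have [si|ni] := boolP (s \in S i); last by exists 0.
  have ik : (i <= k)%N by rewrite -ltnS.
  by have [C C0 HC] := Preg_letters ik si; exists C.
have [C HC] := choice ex.
have C0 i : 0 <= C i by have [] := HC i.
exists ((\sum_i C i) * (2 * B) ^+ 2); first by rewrite mulr_ge0 ?sqr_ge0// sumr_ge0.
move=> t n t1 nB; have t0 : 0 <= t by lra.
have [i /andP[_ si] e] := @bigmax_attained R _ (fun i : 'I_k.+1 => F i)
  (fun i => s \in S i) idx t (fun i _ => weight_ge0 (wF i) t0) (hasS sS).
rewrite FsigmaE e in nB.
have ik : (i <= k)%N by rewrite -ltnS.
have h := scale_le_inv_incr (Preg_scale ik) (ler0n R n) B1 t0 nB.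
have [_ /(_ si n)] := HC i; apply: small_le => //.
rewrite -mulrA; apply: ler_pM => //.
  by apply: scale_ge0 (Preg_scale ik) _ _.
by rewrite (bigD1 i)//= lerDl sumr_ge0.
Qed.

End Letters.
End RegularMeasures.

Theorem mainTheorem5 (R : realType) (G : groupType) (mu : G -> R)
    (k : nat) (p : nat -> R) (mus : nat -> G -> R) (H : nat -> set G)
    (phi : nat -> R -> R) (S : nat -> seq G) (Sig : seq G) :
  finitely_generated G -> nilpotent G ->
  Preg_le mu k p mus H phi ->
  (* S_0 is the support of mu_0 *)
  (forall x, x \in S 0%N <-> mus 0%N x != 0) ->
  (* S_i is a finite symmetric generating set of H_i *)
  (forall i, (1 <= i <= k)%N ->
     (forall s, s \in S i -> (s^-1)%g \in S i) /\
     (forall x, H i x <-> gen [set s | s \in S i] x)) ->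
  (* Sigma: distinct representatives of (U_i S_i) \ {e} modulo s ~ s^-1 *)
  uniq Sig ->
  (forall s, s \in Sig -> s != 1%g /\ exists2 i, (i <= k)%N & s \in S i) ->
  (forall s, (exists2 i, (i <= k)%N & s \in S i) -> s != 1%g ->
     exists2 t, t \in Sig & t = s \/ t = (s^-1)%g) ->
  (forall s t, s \in Sig -> t \in Sig -> t = (s^-1)%g -> t = s) ->
  forall (Fs : seq (R -> R)) (rs : seq nat),
    volume_data Sig (Fsigma k phi S) Fs rs ->
    (exists c1 c2 : R, 0 < c1 /\ 0 < c2 /\
       forall v : R, 1 <= v ->
         ((1 / inv_incr (volume_fn Fs rs) v)%:E <=
            c1%:E * spectral_profile mu (Num.max (c2 * v) 1)%R)%E) /\
    (exists c1 c2 : R, 0 < c1 /\ 0 < c2 /\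
       forall n : nat, (1 <= n)%N ->
         convpow mu n 1%g <= c1 * (1 / volume_fn Fs rs (Num.max (c2 * n%:R) 1))).
Proof.
move=> _ _ Hmu S0 Si _ SigS SSig _ Fs rs vd.
have pmu := Preg_prob Hmu; have [mu0 _] := pmu.
have mu1 : 0 < mu 1%g.
  by case: Hmu => _ _ _ [eps [e0 [_ h]]] _; exact: lt_trans h.
have gS := gen_letters Hmu S0 Si SSig.
have wF := @weight_Fsigma _ _ _ _ _ _ _ _ S Hmu Sig SigS.
have uF := @unbounded_Fsigma _ _ _ _ _ _ _ _ S Hmu Sig SigS.
have sF := @small_Fsigma _ _ _ _ _ _ _ _ S Hmu Si Sig SigS.
have [K K0 box] := volume_box mu0 gS wF uF sF vd.
have wV := weight_volume wF vd.
split.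
  exact: spectral_profile_lower pmu K0 wV box (volume_trivial_or_unbounded wF uF vd).
exact: convpow_upper pmu (Preg_sym Hmu) mu1 K0 wV box.
Qed.
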